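(* Let $d\ge1$ be an integer and let $\beta,\gamma\in(0,1)$ be such that $\beta+d\gamma>d$. There exists a unique bilinear map $$C^\beta([0,1]^d)\times\operatorname{sch}^\gamma([0,1]^d)\to\operatorname{sch}^\gamma([0,1]^d),\qquad (f,\boldsymbol{\omega})\mapsto f\cdot\boldsymbol{\omega},$$ satisfying: (A) for all $f\in C^\beta([0,1]^d)$ and $g\in L^{1/(1-\gamma)}([0,1]^d)$, $f\cdot(g\,d\mathcal{L})=fg\,d\mathcal{L}$; (B) if $(f_p)$ is a sequence in $C^\beta([0,1]^d)$ converging uniformly to $f$, $(\boldsymbol{\omega}_p)$ is a sequence in $\operatorname{sch}^\gamma([0,1]^d)$ converging to $\boldsymbol{\omega}$ in norm in $\operatorname{sch}([0,1]^d)$, $\sup_p\operatorname{Lip}^\beta(f_p)<\infty$ and $\sup_p\|\boldsymbol{\omega}_p\|_\gamma<\infty$, then $\lim_{p\to\infty}f_p\cdot\boldsymbol{\omega}_p=f\cdot\boldsymbol{\omega}$ in $\operatorname{sch}([0,1]^d)$. Furthermore, there is a constant $C\ge0$, independent of $f$, $\boldsymbol{\omega}$ and $K$, such that for all $f\in C^\beta([0,1]^d)$, $\boldsymbol{\omega}\in\operatorname{sch}^\gamma([0,1]^d)$ and every dyadic cube $K\subseteq[0,1]^d$, $$|(f\cdot\boldsymbol{\omega})(K)|\le C\left(\|f_{\mid K}\|_\infty+|K|^{\beta/d}\operatorname{Lip}^\beta(f)\right)\|\boldsymbol{\omega}\|_\gamma|K|^\gamma .$$ In particular, $\|f\cdot\boldsymbol{\omega}\|_\gamma\le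 C\left(\|f\|_\infty+\operatorname{Lip}^\beta(f)\right)\|\boldsymbol{\omega}\|_\gamma$.
   Context: $|E|$ denotes Lebesgue measure. For integrable $u:\mathbb{R}^d\to\mathbb{R}$, $\mathbf{V}u=\sup\{\int u\operatorname{div}v: v\in C^1_c(\mathbb{R}^d;\mathbb{R}^d),\ |v(x)|\le 1\ \forall x\}$. The perimeter of a measurable set $A$ is $\|A\|=\mathbf{V}\mathbf{1}_A$; a $BV$-set is a bounded measurable set of finite perimeter. $\mathcal{BV}([0,1]^d)$ is the collection of $BV$-subsets of $[0,1]^d$. A sequence $(B_n)$ in $\mathcal{BV}([0,1]^d)$ $BV$-converges to $B$ if $|B_n\triangle B|\to0$ and $\sup_n\|B_n\|<\infty$. A charge on $[0,1]^d$ is a function $\boldsymbol{\omega}:\mathcal{BV}([0,1]^d)\to\mathbb{R}$ such that $\boldsymbol{\omega}(B_1\cup B_2)=\boldsymbol{\omega}(B_1)+\boldsymbol{\omega}(B_2)$ whenever $|B_1\cap B_2|=0$, and $\boldsymbol{\omega}(B_n)\to\boldsymbol{\omega}(B)$ whenever $(B_n)$ $BV$-converges to $B$. For $g\in L^1([0,1]^d)$, $g\,d\mathcal{L}$ is the charge $B\mapsto\int_Bg$. Strong charges: let $BV([0,1]^d)$ be the space of functions of bounded variation on $\mathbb{R}^d$ vanishing a.e. outside $[0,1]^d$, normed by $\|u\|_{BV}=\mathbf{V}u$. For $g\in L^d([0,1]^d)$ let $T_g\in BV([0,1]^d)^*$, $T_g(u)=\int gu$. A charge $\boldsymbol{\omega}$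 is strong if there is $\lambda$ in the norm closure of $\{T_g:g\in L^d\}$ in $BV([0,1]^d)^*$ with $\boldsymbol{\omega}(B)=\lambda(\mathbf{1}_B)$ for all $B$; such $\lambda$ is unique and $\|\boldsymbol{\omega}\|$ denotes its operator norm. $\operatorname{sch}([0,1]^d)$ is the Banach space of strong charges. A dyadic cube is a set $\prod_{i=1}^d[2^{-n}k_i,2^{-n}(k_i+1)]$ with integers $n\ge0$, $0\le k_i\le 2^n-1$. For $\frac{d-1}{d}<\gamma\le1$, a charge is $\gamma$-Hölder if $\|\boldsymbol{\omega}\|_\gamma:=\sup\{|\boldsymbol{\omega}(K)|/|K|^\gamma: K\text{ dyadic cube}\}<\infty$; $\operatorname{sch}^\gamma([0,1]^d)$ is the space of $\gamma$-Hölder charges, which are automatically strong. If $g\in L^{1/(1-\gamma)}$ then $g\,d\mathcal{L}\in\operatorname{sch}^\gamma([0,1]^d)$. For $f$ on $[0,1]^d$, $\operatorname{Lip}^\beta(f)=\sup_{x\ne y}|f(x)-f(y)|/|x-y|^\beta$; $C^\beta([0,1]^d)$ is the set of $f$ with $\operatorname{Lip}^\beta(f)<\infty$. *)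

(* Defs.v *)
From HB Require Import structures.
From mathcomp Require Import all_boot all_order all_algebra.
From mathcomp Require Import all_classical all_reals all_analysis.

Set Implicit Arguments.
Unset Strict Implicit.
Unset Printing Implicit Defensive.

Import Order.TTheory GRing.Theory Num.Theory.
Import numFieldNormedType.Exports.

Local Open Scope classical_set_scope.
Local Open Scope ring_scope.

(** Points of R^d are row vectors. The library norm of ['rV[R]_d] is the sup
    norm, hence the separate Euclidean norm; both induce the same topology. *)
Definition enorm (R : realType) (d : nat) (x : 'rV[R]_d) : R :=
  Num.sqrt (\sum_i x 0 i ^+ 2).

Definition box (R : realType) (d : nat) (a b : 'rV[R]_d) : set 'rV[R]_d :=
  [set x | forall i, a 0 i <= x 0 i <= b 0 i].

Definition cube (R : realType) (d : nat) : set 'rV[R]_d :=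
  box 0 (const_mx 1).
Arguments cube : clear implicits.

Section lebesgue.
Context (R : realType) (d : nat).

Definition box_volume (a b : 'rV[R]_d) : R :=
  \prod_i Num.max 0 (b 0 i - a 0 i).

(** Lebesgue outer measure: infimum of the total volume over countable
    (possibly finite) covers by closed boxes. *)
Definition leb_outer (A : set 'rV[R]_d) : \bar R :=
  ereal_inf [set s | exists (D : set nat) (a b : nat -> 'rV[R]_d),
    A `<=` \bigcup_(k in D) box (a k) (b k) /\
    s = (\esum_(k in D) (box_volume (a k) (b k))%:E)%E].

Let box_volume_ge0 a b : (0 <= (box_volume a b)%:E)%E.
Proof. by rewrite lee_fin prodr_ge0// => i _; rewrite le_max lexx. Qed.

Let esum_box_ge0 (D : set nat) (a b : nat -> 'rV[R]_d) :
  (0 <= \esum_(k in D) (box_volume (a k) (b k))%:E)%E.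
Proof. by apply: esum_ge0 => k _; exact: box_volume_ge0. Qed.

Let leb_outer0 : leb_outer set0 = 0%E.
Proof.
apply/eqP; rewrite eq_le; apply/andP; split.
  apply: ereal_inf_lbound; exists set0; exists (fun=> 0); exists (fun=> 0).
  by split => //; rewrite esum_set0.
by apply: le_ereal_inf_tmp => _ [D [a [b [_ ->]]]]; exact: esum_box_ge0.
Qed.

Let leb_outer_ge0 A : (0 <= leb_outer A)%E.
Proof.
by apply: le_ereal_inf_tmp => _ [D [a [b [_ ->]]]]; exact: esum_box_ge0.
Qed.

Let le_leb_outer : {homo leb_outer : A B / A `<=` B >-> (A <= B)%E}.
Proof.
move=> A B AB; apply/ereal_inf_le_tmp => _ [D [a [b [BD ->]]]].
by exists D; exists a; exists b; split => //; exact: subset_trans BD.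
Qed.

Let leb_outer_sigma_subadditive : sigma_subadditive leb_outer.
Proof.
move=> A; have [[i ioo]|] := pselect (exists i, leb_outer (A i) = +oo%E).
  rewrite (eseries_pinfty _ _ ioo) ?leey// => n _.
  by rewrite -ltNye (lt_le_trans _ (leb_outer_ge0 _)).
rewrite -forallNE => Aoo; apply/lee_addgt0Pr => e e0.
rewrite (le_trans _ (epsilon_trick _ _ (ltW e0)))//.
pose P n (c : set nat * ((nat -> 'rV[R]_d) * (nat -> 'rV[R]_d))) :=
  A n `<=` \bigcup_(k in c.1) box (c.2.1 k) (c.2.2 k) /\
  (\esum_(k in c.1) (box_volume (c.2.1 k) (c.2.2 k))%:E <=
   leb_outer (A n) + (e / (2 ^ n.+1)%:R)%:E)%E.
have [G PG] : {G & forall n, P n (G n)}.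
  apply: (@choice _ _ P) => n.
  have Afin : leb_outer (A n) \is a fin_num.
    by rewrite ge0_fin_numE// ltey; apply/eqP; exact: Aoo.
  have en : 0 < e / (2 ^ n.+1)%:R by rewrite divr_gt0// ltr0n expn_gt0.
  have [_ [D [a [b [AD ->]]]] lt] := lb_ereal_inf_adherent en Afin.
  by exists (D, (a, b)); split => //=; exact: ltW.
pose v (p : nat * nat) : \bar R :=
  (box_volume ((G p.1).2.1 p.2) ((G p.1).2.2 p.2))%:E.
have v0 p : (0 <= v p)%E by exact: box_volume_ge0.
apply: (@le_trans _ _
    (\sum_(i <oo) \esum_(k in (G i).1) v (i, k))%E); last first.
  apply: lee_nneseries => n _; last exact: (PG n).2.
  by move=> _; exact: esum_box_ge0.
rewrite nneseries_esumT; last by move=> n; exact: esum_box_ge0.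
rewrite esum_esum//.
have /card_esym/ppcard_eqP[f] := card_nat2.
pose D := [set k | (G (f k).1).1 (f k).2].
rewrite (@reindex_esum _ _ _ D _ f).
  apply: ereal_inf_lbound; exists D; exists (fun k => (G (f k).1).2.1 (f k).2);
    exists (fun k => (G (f k).1).2.2 (f k).2); split => //.
  move=> t [n _ Ant]; have [k Dk tk] := (PG n).1 _ Ant.
  by exists (f^-1%FUN (n, k)); rewrite /D/= invK ?inE.
split => [k Dk|j k _ _ fjk|[n k] /= [_ Gk]]; first by split.
- by apply: 'inj_f fjk; rewrite inE.
- by exists (f^-1%FUN (n, k)); rewrite /D/= invK ?inE.
Qed.

HB.instance Definition _ := isOuterMeasure.Build R 'rV[R]_d leb_outer
  leb_outer0 leb_outer_ge0 le_leb_outer leb_outer_sigma_subadditive.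

End lebesgue.

(** R^d with its sigma-algebra of Lebesgue (i.e. Caratheodory) measurable
    sets. *)
Notation Rd R d := (caratheodory_type (@leb_outer R d)).

Definition leb (R : realType) (d : nat) : set (Rd R d) -> \bar R :=
  @leb_outer R d.
Arguments leb : clear implicits.

HB.instance Definition _ (R : realType) (d : nat) :=
  isMeasure.Build _ (Rd R d) R (leb R d)
    (@caratheodory_measure0 _ _ (@leb_outer R d))
    (@caratheodory_measure_ge0 _ _ (@leb_outer R d))
    (@caratheodory_measure_sigma_additive _ _ (@leb_outer R d)).

Section perimeter.
Context (R : realType) (d : nat).

Definition divergence (v : 'rV[R]_d -> 'rV[R]_d) (x : 'rV[R]_d) : R :=
  \sum_(i < d) ('D_(delta_mx 0 i) v x) 0 i.

Definition C1 (v : 'rV[R]_d -> 'rV[R]_d) : Prop :=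
  forall i : 'I_d, (forall x, derivable v x (delta_mx 0 i)) /\
    continuous ('D_(delta_mx 0 i) v).

Definition compactly_supported (v : 'rV[R]_d -> 'rV[R]_d) : Prop :=
  compact (closure [set x | v x != 0]).

Definition variation (u : Rd R d -> R) : \bar R :=
  ereal_sup [set (\int[leb R d]_x (u x * divergence v x)%:E)%E |
    v in [set v | [/\ C1 v, compactly_supported v
                    & forall x, enorm (v x) <= 1]]].

Definition perimeter (A : set (Rd R d)) : \bar R := variation \1_A.

Definition BV_set (A : set (Rd R d)) : Prop :=
  [/\ bounded_set (A : set 'rV[R]_d), measurable A
    & (perimeter A < +oo)%E].

Record cubeBV := CubeBV {
  cubeBV_set :> set (Rd R d) ;
  cubeBV_BV : BV_set cubeBV_set ;
  cubeBV_sub : cubeBV_set `<=` cube R d }.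

Definition BV_cvg (B_ : nat -> cubeBV) (B : cubeBV) : Prop :=
  (fun n => leb R d (B_ n `+` B)) @ \oo --> 0%E /\
  (ereal_sup (range (fun n => perimeter (B_ n))) < +oo)%E.

Definition dyadic_cube (K : set 'rV[R]_d) : Prop :=
  exists (n : nat) (k : 'I_d -> nat), (forall i, (k i < 2 ^ n)%N) /\
    K = box (\row_i ((k i)%:R / 2 ^+ n)) (\row_i ((k i).+1%:R / 2 ^+ n)).

End perimeter.
Arguments cubeBV : clear implicits.

Section ereal_sup_lty.
Context (R : realType) (I : Type) (P : set I).
Implicit Types F G H : I -> R.

Lemma ereal_sup_ltyP F :
  (ereal_sup [set (F i)%:E | i in P] < +oo)%E <->
  exists M, forall i, P i -> F i <= M.
Proof.
split=> [|[M FM]]; last first.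
  apply: (@le_lt_trans _ _ M%:E); last by rewrite ltry.
  by apply: ge_ereal_sup => _ [i Pi <-]; rewrite lee_fin FM.
have ub i : P i -> ((F i)%:E <= ereal_sup [set (F i)%:E | i in P])%E.
  by move=> Pi; apply: ereal_sup_ubound; exists i.
case: (ereal_sup _) ub => [M ub _|//|ub _].
  by exists M => i /ub; rewrite lee_fin.
by exists 0 => i /ub.
Qed.

Lemma ereal_sup_lty_comb F G H a : 0 <= a ->
  (forall i, P i -> H i <= a * F i + G i) ->
  (ereal_sup [set (F i)%:E | i in P] < +oo)%E ->
  (ereal_sup [set (G i)%:E | i in P] < +oo)%E ->
  (ereal_sup [set (H i)%:E | i in P] < +oo)%E.
Proof.
move=> a0 HFG /ereal_sup_ltyP[M FM] /ereal_sup_ltyP[N GN].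
apply/ereal_sup_ltyP; exists (a * M + N) => i Pi.
by apply: (le_trans (HFG i Pi)); rewrite lerD ?ler_wpM2l ?FM ?GN.
Qed.

End ereal_sup_lty.

Section cube_functions.
Context (R : realType) (d : nat).
Implicit Types f g : cube R d -> R.

Definition lip (beta : R) f : \bar R :=
  ereal_sup [set (`|f p.1 - f p.2| / enorm (val p.1 - val p.2) `^ beta)%:E |
    p in [set p : cube R d * cube R d | p.1 != p.2]].

Definition sup_norm (A : set 'rV[R]_d) f : \bar R :=
  ereal_sup [set `|f x|%:E | x in [set x : cube R d | A (val x)]].

(** ['valL_0 g] is the extension of [g] by zero to R^d. *)
Definition Lp (p : R) g : Prop :=
  ('valL_0 g : Rd R d -> R) \in Lfun (leb R d) p%:E.

Definition density g (B : cubeBV R d) : R :=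
  \int[leb R d]_(x in B) ('valL_0 g : Rd R d -> R) x.

Definition holder_pred (beta : R) : {pred cube R d -> R} :=
  [pred f | `[< (lip beta f < +oo)%E >]].

Lemma holder_submod_closed beta : submod_closed (holder_pred beta).
Proof.
split=> [|a f g /asboolP lf /asboolP lg]; apply/asboolP.
  by apply/ereal_sup_ltyP; exists 0 => p _; rewrite subrr normr0 mul0r.
apply: (ereal_sup_lty_comb (normr_ge0 a) _ lf lg) => p _.
rewrite mulrA -mulrDl ler_wpM2r ?invr_ge0 ?powR_ge0//.
by rewrite -normrM mulrBr (le_trans _ (ler_normD _ _))// opprD addrACA.
Qed.

HB.instance Definition _ beta :=
  GRing.isSubmodClosed.Build R (cube R d -> R) (holder_pred beta)
    (holder_submod_closed beta).

Record holder (beta : R) := Holder {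
  holder_fun :> cube R d -> R ;
  holderP : holder_fun \in holder_pred beta }.

HB.instance Definition _ beta := [isSub for @holder_fun beta].
HB.instance Definition _ beta := [Choice of holder beta by <:].
HB.instance Definition _ beta := [SubChoice_isSubLmodule of holder beta by <:].

End cube_functions.
Arguments holder : clear implicits.

Section charges.
Context (R : realType) (d : nat).
Implicit Types w : cubeBV R d -> R.

(** Unions of BV-sets are BV-sets, so additivity is stated for every element
    [B] of [cubeBV R d] equal to the union. *)
Definition is_bv_charge w : Prop :=
  (forall B1 B2 B : cubeBV R d, leb R d (B1 `&` B2) = 0%E ->
     B = B1 `|` B2 :> set (Rd R d) -> w B = w B1 + w B2) /\
  (forall B_ B, BV_cvg B_ B -> w \o B_ @ \oo --> w B).

(** Closed dyadic cubes are BV-sets, so [K] does range over all of them. *)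
Definition holder_norm (gamma : R) w : \bar R :=
  ereal_sup [set (`|w K| / fine (leb R d K) `^ gamma)%:E |
    K in [set K : cubeBV R d | dyadic_cube K]].

Definition holder_charge_pred (gamma : R) : {pred cubeBV R d -> R} :=
  [pred w | `[< is_bv_charge w /\ (holder_norm gamma w < +oo)%E >]].

Lemma holder_charge_submod_closed gamma :
  submod_closed (holder_charge_pred gamma).
Proof.
split=> [|a w1 w2 /asboolP[[add1 cvg1] n1] /asboolP[[add2 cvg2] n2]].
  apply/asboolP; split; first split.
  - by move=> *; rewrite addr0.
  - by move=> *; exact: cvg_cst.
  - by apply/ereal_sup_ltyP; exists 0 => K _; rewrite normr0 mul0r.
apply/asboolP; split; first split.
- move=> B1 B2 B B12 BU; rewrite !fctE (add1 _ _ _ B12 BU) (add2 _ _ _ B12 BU).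
  by rewrite scalerDr addrACA.
- move=> B_ B BB; apply: (@cvgD _ R^o); last exact: cvg2.
  by apply: (@cvgZr _ R^o); exact: cvg1.
- apply: (ereal_sup_lty_comb (normr_ge0 a) _ n1 n2) => K _.
  rewrite mulrA -mulrDl ler_wpM2r ?invr_ge0 ?powR_ge0//.
  by rewrite -normrM ler_normD.
Qed.

HB.instance Definition _ gamma :=
  GRing.isSubmodClosed.Build R (cubeBV R d -> R) (holder_charge_pred gamma)
    (holder_charge_submod_closed gamma).

Record holder_charge (gamma : R) := HolderCharge {
  holder_charge_fun :> cubeBV R d -> R ;
  holder_chargeP : holder_charge_fun \in holder_charge_pred gamma }.

HB.instance Definition _ gamma := [isSub for @holder_charge_fun gamma].
HB.instance Definition _ gamma := [Choice of holder_charge gamma by <:].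
HB.instance Definition _ gamma :=
  [SubChoice_isSubLmodule of holder_charge gamma by <:].

Definition BV_function (u : Rd R d -> R) : Prop :=
  [/\ (leb R d).-integrable setT (EFin \o u), (variation u < +oo)%E
    & {ae leb R d, forall x, ~ cube R d x -> u x = 0}].

(** The dual of BV([0,1]^d) normed by [variation]: its elements are functionals
    on all functions, of which only the values on [BV_function] matter. Being
    bounded, they do not distinguish a.e. equal functions. *)
Definition dual_norm (l : (Rd R d -> R) -> R) : \bar R :=
  ereal_sup [set `|l u|%:E |
    u in [set u | BV_function u /\ (variation u <= 1)%E]].

Definition BV_dual (l : (Rd R d -> R) -> R) : Prop :=
  (forall (a : R) u v, BV_function u -> BV_function v ->
     l (a *: u + v) = a * l u + l v) /\
  (dual_norm l < +oo)%E.

Definition pairing (g : cube R d -> R) (u : Rd R d -> R) : R :=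
  \int[leb R d]_x (('valL_0 g : Rd R d -> R) x * u x).

Definition strong_representation w (l : (Rd R d -> R) -> R) : Prop :=
  [/\ BV_dual l,
      forall e : R, 0 < e -> exists2 g : cube R d -> R, Lp d%:R g &
        (dual_norm (fun u => (l u - pairing g u)%R) < e%:E)%E
    & forall B : cubeBV R d, w B = l \1_B].

(** The norm of sch([0,1]^d). All the representations of a strong charge agree
    on [BV_function], so the infimum is over a single value; it is infinite if
    the charge is not strong. *)
Definition strong_norm w : \bar R :=
  ereal_inf [set dual_norm l | l in strong_representation w].

End charges.
Arguments holder_charge : clear implicits.

Section products.
Context (R : realType) (d : nat) (beta gamma : R).
Variable m : holder R d beta -> holder_charge R d gamma ->
  holder_charge R d gamma.

(** For [g] in L^(1 / (1 - gamma)), [density g] is an element of sch^gamma,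
    represented here by any [w] having it as underlying function. *)
Definition extends_density_product : Prop :=
  forall (f : holder R d beta) (g : cube R d -> R)
         (w : holder_charge R d gamma),
    Lp (1 - gamma)^-1 g -> w = density g :> (cubeBV R d -> R) ->
    m f w = density (f \* g) :> (cubeBV R d -> R).

Definition strongly_continuous : Prop :=
  forall (f_ : nat -> holder R d beta) (f : holder R d beta)
         (w_ : nat -> holder_charge R d gamma) (w : holder_charge R d gamma),
    {uniform, (fun p => f_ p : cube R d -> R) @ \oo --> (f : cube R d -> R)} ->
    (fun p => strong_norm (w_ p - w)) @ \oo --> 0%E ->
    (ereal_sup (range (fun p => lip beta (f_ p))) < +oo)%E ->
    (ereal_sup (range (fun p => holder_norm gamma (w_ p))) < +oo)%E ->
    (fun p => strong_norm (m (f_ p) (w_ p) - m f w)) @ \oo --> 0%E.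

End products.

(* Main.v *)
From HB Require Import structures.
Require Import Defs.
From mathcomp Require Import all_boot all_order all_algebra.
From mathcomp Require Import all_classical all_reals all_analysis.
From mathcomp Require Import measurable_realfun ring lra zify.

Set Implicit Arguments.
Unset Strict Implicit.
Unset Printing Implicit Defensive.

Import Order.TTheory GRing.Theory Num.Theory.
Import numFieldNormedType.Exports.
Import Defs.

Local Open Scope classical_set_scope.
Local Open Scope ring_scope.

(** Halving the unit cube along its coordinates in turn gives a binary tree of
    cells, those of level [m] having volume [2^-m] and sides of order
    [2^(-m/d)]. Let [D_m u] be the integral of [u] against the step function
    equal to [f x_w * nu Q_w / |Q_w|] on each cell [Q_w] of level [m], where
    [x_w] is the lower corner of [Q_w]. Testing the variation of [u] against a
    field that is a tent across the plane halving each cell shows that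
    [|D_(m+1) u - D_m u|] is at most a multiple of
    [2^(m (1 - gamma - beta/d)) V u]. Since [beta + d gamma > d], the functionals
    [D_m] converge geometrically in the dual of [BV], and their limit, evaluated
    at indicators, is the product of [f] and [nu]. It agrees on dyadic cubes with
    [fg] when [nu] has density [g], which determines it because a charge
    vanishing on dyadic cubes is zero: by a coarea argument, suitable level sets
    of the averages of the indicator of [B] over the grid of mesh [2^-n] have
    bounded perimeters and [BV]-converge to [B]. Uniqueness follows, [nu] being a
    strong limit of charges with step densities, bounded in sch^gamma. *)

(** * Lebesgue measure of boxes *)

(** A cell is halved in one coordinate only, so refining a step function by one level adds one
    coefficient per cell, with opposite signs on the two halves. This is the divergence of a tent
    field, and the disjointness of the cells lets one field serve a whole level. In the increment
    the division by volumes contributes [2^m], the charge [2^(-m gamma)], and the tent height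
    [2^(-m/d)]. The oscillation of [f] contributes [2^(-m beta/d)] instead of the latter; it is the
    larger since [beta < 1], and fixes the rate. The oscillation term carries no difference of
    halves: it needs a bound of the integral of [u] against any bounded step function by its sup
    norm times [V u]. The same tents give it, summed over the coarser levels and starting from the
    unit cube paired with a translate on which [u] vanishes.

    Each [D_m] is integration against a bounded function, so convergence in the dual norm is what
    makes the limit strong. The uniform tail reduces every continuity claim to a fixed level, where
    finitely many cell values matter. *)

Definition set_coord (R : Type) (d : nat) (x : 'rV[R]_d) (j : 'I_d) (c : R) :
  'rV[R]_d := \row_i (if i == j then c else x 0 i).

Section boxes.
Context (R : realType) (d : nat).
Implicit Types (a b x y : 'rV[R]_d) (i j : 'I_d) (c : R).

Definition halfspace j c : set 'rV[R]_d := [set x | x 0 j <= c].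

Definition open_box a b : set 'rV[R]_d :=
  [set x | forall i, a 0 i < x 0 i < b 0 i].

Lemma box_volume_ge0 a b : 0 <= box_volume a b.
Proof. by rewrite prodr_ge0// => i _; rewrite le_max lexx. Qed.

Lemma box_volumeE a b : (forall i, a 0 i <= b 0 i) ->
  box_volume a b = \prod_i (b 0 i - a 0 i).
Proof. by move=> ab; apply: eq_bigr => i _; rewrite max_r// subr_ge0. Qed.

(** No position of [c] is excluded: [min] and [max] clip the cutting plane, and the truncation in
    [box_volume] makes a piece with reversed bounds count for zero. *)
Lemma box_volume_split a b j c :
  box_volume a (set_coord b j (Num.min (b 0 j) c)) +
  box_volume (set_coord a j (Num.max (a 0 j) c)) b = box_volume a b.
Proof.
rewrite /box_volume !(bigD1 (P := predT) j)//=.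
under eq_bigr => i /negbTE ij do rewrite mxE ij.
under [in X in _ + X]eq_bigr => i /negbTE ij do rewrite mxE ij.
rewrite !mxE eqxx -mulrDl; congr (_ * _).
rewrite !/Num.max !/Num.min; case: ifPn; case: ifPn; case: ifPn; case: ifPn;
  case: ifPn; rewrite -?leNgt => *; try lra.
Qed.

Lemma leb_outer_le_esum (A : set 'rV[R]_d) (D : set nat)
    (a b : nat -> 'rV[R]_d) : A `<=` \bigcup_(k in D) box (a k) (b k) ->
  (leb_outer A <= \esum_(k in D) (box_volume (a k) (b k))%:E)%E.
Proof.
by move=> AD; apply: ereal_inf_lbound; exists D; exists a; exists b.
Qed.

Lemma leb_box_le a b : (leb R d (box a b) <= (box_volume a b)%:E)%E.
Proof.
have /(_ _)/le_trans := @leb_outer_le_esum (box a b) [set 0%N] (fun=> a) (fun=> b).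
apply; first by move=> x abx; exists 0%N.
by rewrite esum_set1// lee_fin box_volume_ge0.
Qed.

(** Carathéodory's test on [X]: the plane cuts every box of a cover of [X] in two, the pieces cover
    the two parts of [X], and [box_volume_split] conserves the total volume. *)
Lemma measurable_halfspace j c :
  measurable (halfspace j c : set (Rd R d)).
Proof.
apply: le_caratheodory_measurable => X /=.
apply: le_ereal_inf_tmp => _ [D [a [b [XD ->]]]].
under eq_esum => k _ do rewrite -(box_volume_split (a k) (b k) j c) EFinD.
rewrite esumD; try by move=> *; rewrite lee_fin box_volume_ge0.
apply: leeD; apply: leb_outer_le_esum => x [] /XD[k Dk abk] xc;
  exists k => // i; have := abk i; rewrite mxE; case: eqP => // -> /andP[ax bx].
  by rewrite ax le_min bx.
by rewrite bx andbT ge_max ax/=; move: xc => /negP; rewrite -ltNge => /ltW.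
Qed.

Lemma measurable_halfspace_lt j c :
  measurable ([set x | x 0 j < c] : set (Rd R d)).
Proof.
rewrite [X in measurable X](_ : _ =
  \bigcup_n (halfspace j (c - n.+1%:R^-1) : set (Rd R d))); last first.
  apply/seteqP; split => x /=.
    move=> xc; have xc' : 0 < c - x 0 j by rewrite subr_gt0.
    exists (Num.bound (c - x 0 j)^-1) => //; rewrite /halfspace/= lerBrDr -lerBrDl.
    rewrite -[leRHS]invrK lef_pV2 ?posrE ?invr_gt0//.
    by rewrite (le_trans (ltW (archi_boundP _)))// ?invr_ge0 ?ltW// ltr_nat.
  by move=> [n _]; rewrite /halfspace/= => /le_lt_trans; apply; rewrite ltrBlDr ltrDl.
by apply: bigcupT_measurable => n; exact: measurable_halfspace.
Qed.

Lemma box_setI a b : box a b = \big[setI/setT]_(i <- enum 'I_d)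
  (halfspace i (b 0 i) `&` ~` [set x | x 0 i < a 0 i]).
Proof.
rewrite -bigcap_seq; apply/seteqP; split => x /=.
  move=> abx i /= _; have /andP[ax xb] := abx i; split => //.
  by apply/negP; rewrite -leNgt.
move=> h i; have [xb /negP] := h i (mem_enum _ _).
by rewrite -leNgt => ->.
Qed.

Lemma measurable_box a b : measurable (box a b : set (Rd R d)).
Proof.
rewrite box_setI; apply: bigsetI_measurable => i _; apply: measurableI.
  exact: measurable_halfspace.
by apply: measurableC; exact: measurable_halfspace_lt.
Qed.

Lemma measurable_open_box a b : measurable (open_box a b : set (Rd R d)).
Proof.
rewrite [X in measurable X](_ : _ = \big[setI/setT]_(i <- enum 'I_d)
   ([set x : Rd R d | x 0 i < b 0 i] `&` ~` halfspace i (a 0 i))).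
  apply: bigsetI_measurable => i _; apply: measurableI.
    exact: measurable_halfspace_lt.
  by apply: measurableC; exact: measurable_halfspace.
rewrite -bigcap_seq; apply/seteqP; split => x /=.
  move=> abx i /= _; have /andP[ax xb] := abx i; split => //.
  by apply/negP; rewrite -ltNge.
move=> h i; have [xb /negP] := h i (mem_enum _ _).
by rewrite /halfspace/= -ltNge => ->.
Qed.

Lemma leb_box_lty a b : (leb R d (box a b) < +oo)%E.
Proof. by rewrite (le_lt_trans (leb_box_le a b))// ltry. Qed.

Lemma leb_box_degenerate a b j : b 0 j <= a 0 j -> leb R d (box a b) = 0%E.
Proof.
move=> ba; apply/eqP; rewrite eq_le measure_ge0 andbT.
rewrite (le_trans (leb_box_le a b))// lee_fin /box_volume (bigD1 j)//=.
by rewrite max_l ?mul0r// subr_le0.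
Qed.

Lemma box_split a b j c : a 0 j <= c <= b 0 j ->
  box a b = box a (set_coord b j c) `|` box (set_coord a j c) b.
Proof.
move=> /andP[ac cb]; apply/seteqP; split => x; rewrite /box/=.
  move=> abx; have [xc|xc] := leP (x 0 j) c.
    left=> i; have := abx i; rewrite [set_coord _ _ _ _ _]mxE.
    by case: eqP => // ->; rewrite xc => /andP[-> _].
  right=> i; have := abx i; rewrite [set_coord _ _ _ _ _]mxE.
  by case: eqP => // ->; rewrite (ltW xc) => /andP[_ ->].
case=> abx i; have := abx i; rewrite [set_coord _ _ _ _ _]mxE.
  by case: eqP => // -> /andP[-> /le_trans->].
by case: eqP => // -> /andP[cx ->]; rewrite andbT (le_trans ac cx).
Qed.

Lemma box_split_null a b j c :
  leb R d (box a (set_coord b j c) `&` box (set_coord a j c) b) = 0%E.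
Proof.
apply/eqP; rewrite -measure_le0 -(@leb_box_degenerate
  (set_coord a j c) (set_coord b j c) j); last by rewrite !mxE eqxx.
apply: le_measure; rewrite ?inE; try exact: measurable_box.
  by apply: measurableI; exact: measurable_box.
by move=> x [x0 x1] i; have := x0 i; have := x1 i => /andP[-> _] /andP[_ ->].
Qed.

End boxes.

(** Integrating out one coordinate after the other turns the indicators of a
    cover of the cube into the volumes of its members. *)
Lemma cube_cover_volume (R : realType) (d : nat) (a b : nat -> 'rV[R]_d) :
  cube R d `<=` \bigcup_k box (a k) (b k) ->
  (1 <= \sum_(k <oo) (box_volume (a k) (b k))%:E)%E.
Proof.
move=> cov.
(* [s] lists the coordinates already integrated out: they carry a side length, the others still an
   indicator at [x]. The empty [s] expresses the covering, the full [s] the claim. *)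
pose w (s : seq 'I_d) k (x : 'rV[R]_d) i : R :=
  if i \in s then Num.max 0 (b k 0 i - a k 0 i)
  else (a k 0 i <= x 0 i <= b k 0 i)%R%:R.
have w0 s k x i : 0 <= w s k x i.
  by rewrite /w; case: ifP => // _; rewrite le_max lexx.
suff H s : uniq s -> forall x, cube R d x ->
    (1 <= \sum_(k <oo) (\prod_i w s k x i)%:E)%E.
  have := H (enum 'I_d) (enum_uniq _) 0 _.
  rewrite (_ : (fun n => _) = fun n =>
    \sum_(0 <= k < n) (box_volume (a k) (b k))%:E)%E; last first.
    apply/funext => n; apply: eq_bigr => k _; congr EFin.
    by apply: eq_bigr => i _; rewrite /w mem_enum.
  by apply => i; rewrite !mxE lexx ler01.
elim: s => [_ x xc|j s IH /= /andP[js us] x xc].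
  have [k _ abx] := cov x xc.
  rewrite (le_trans _ (nneseries_lim_ge k.+1 _))//.
    rewrite big_nat_recr//= (le_trans _ (leeDr _ _))//.
      rewrite lee_fin big1// => i _; rewrite /w in_nil.
      by rewrite (abx i).
    by apply: sume_ge0 => n _; rewrite lee_fin prodr_ge0.
  by move=> n _ _; rewrite lee_fin prodr_ge0.
pose F k := \prod_(i | i != j) w s k x i.
have F0 k : 0 <= F k by rewrite prodr_ge0.
have I01 t : t \in `[(0:R), 1] ->
    (1 <= \sum_(k <oo) (F k * \1_(`[a k 0 j, b k 0 j]%classic) t)%:E)%E.
  rewrite in_itv/= => t01.
  have := IH us (set_coord x j t); rewrite (_ : (fun n => _) = fun n =>
    \sum_(0 <= k < n) (F k * \1_(`[a k 0 j, b k 0 j]%classic) t)%:E)%E; last first.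
    apply/funext => n; apply: eq_bigr => k _; congr EFin.
    rewrite (bigD1 j)//= mulrC; congr (_ * _).
      by apply: eq_bigr => i ij; rewrite /w mxE (negbTE ij).
    rewrite /w (negbTE js) !mxE eqxx indicE.
    by congr (_ %:R); rewrite mem_setE in_itv.
  by apply => i; rewrite !mxE; case: eqP => // _; have := xc i; rewrite !mxE.
have -> : 1%E = (\int[@lebesgue_measure R]_(t in `[0%R, 1%R]) (cst 1%E t))%E.
  by rewrite integral_cst//= lebesgue_measure_itv/= lte_fin ltr01 oppr0 adde0 mule1.
pose D01 : set R := [set` `[0%R, 1%R]].
have mD01 : measurable D01 by exact: measurable_itv.
have mS k : measurable_fun D01
    (EFin \o (fun t : R => F k * \1_(`[a k 0 j, b k 0 j]%classic) t)).
  by apply/measurable_EFinP; apply: measurable_funM.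
have S0 k (t : R) : (0 <= (F k * \1_(`[a k 0 j, b k 0 j]%classic) t)%:E)%E.
  by rewrite lee_fin mulr_ge0.
apply: (@le_trans _ _ (\int[@lebesgue_measure R]_(t in `[0%R, 1%R])
    (\sum_(k <oo) (F k * \1_(`[a k 0 j, b k 0 j]%classic) t)%:E))%E).
  apply: ge0_le_integral => //=.
    apply: (@ge0_emeasurable_sum _ _ _ D01 (fun k => EFin \o
      (fun t : R => F k * \1_(`[a k 0 j, b k 0 j]%classic) t)) xpredT) => [k t _ _|k _].
      by rewrite lee_fin mulr_ge0.
    exact: mS.
rewrite (@integral_nneseries _ _ _ lebesgue_measure D01 _
  (fun k t => (F k * \1_(`[a k 0 j, b k 0 j]%classic) t)%:E) mS)//.
apply: lee_nneseries => k _; first by move=> _; apply: integral_ge0.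
under eq_integral do rewrite EFinM.
have mI : measurable_fun D01 (EFin \o (\1_(`[a k 0 j, b k 0 j]%classic) : R -> R)).
  by apply/measurable_EFinP; apply: measurable_indic.
rewrite (@ge0_integralZl _ _ _ lebesgue_measure D01 mD01 _ mI);
  [|by move=> t _; rewrite lee_fin|by rewrite lee_fin].
rewrite /comp.
rewrite integral_indic//.
rewrite (bigD1 j)//= mulrC EFinM.
rewrite (eq_bigr (w s k x)); last first.
  by move=> i ij; rewrite /w in_cons (negbTE ij).
apply: lee_pmul; [by rewrite lee_fin|exact: measure_ge0|by rewrite lee_fin|].
apply: (@le_trans _ _ (@lebesgue_measure R `[a k 0 j, b k 0 j]%classic)).
  apply: le_measure; rewrite ?inE; [|exact: measurable_itv|exact: subIsetl].
  by apply: measurableI; [exact: measurable_itv|exact: mD01].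
rewrite lebesgue_measure_itv/= lte_fin /w mem_head.
case: ifPn => [ab|_]; last by rewrite lee_fin le_max lexx.
by rewrite -EFinD lee_fin le_max lexx orbT.
Qed.

Lemma leb_cube (R : realType) (d : nat) : leb R d (cube R d) = 1%E.
Proof.
apply/eqP; rewrite eq_le; apply/andP; split.
  rewrite (le_trans (leb_box_le _ _))// lee_fin box_volumeE.
    by rewrite big1// => i _; rewrite !mxE subr0.
  by move=> i; rewrite !mxE.
apply: le_ereal_inf_tmp => _ [D [a [b [cov ->]]]].
have v0 k : (0 <= (box_volume (a k) (b k))%:E)%E by rewrite lee_fin box_volume_ge0.
rewrite -(set_mem_set D) -nneseries_esum//.
(* In dimension 0 the cube is a point and every box has the empty product 1 as volume, so one member
   of the cover suffices. In positive dimension the indices outside [D] can be given boxes with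
   reversed bounds, of volume 0. *)
case: d a b cov v0 => [|e] a b cov v0.
  have [k Dk _] : (\bigcup_(k in D) box (a k) (b k)) 0 by apply: cov => -[].
  rewrite (le_trans _ (nneseries_lim_ge k.+1 _))//.
  rewrite big_mkcond big_nat_recr//= mem_set// (le_trans _ (leeDr _ _))//.
    by rewrite /box_volume big_ord0.
  by apply: sume_ge0 => n _; case: ifP.
pose a' k := if k \in D then a k else const_mx 1.
pose b' k := if k \in D then b k else 0.
rewrite eseries_mkcond (le_trans (@cube_cover_volume _ _ a' b' _))//.
  move=> x /cov[k Dk abx]; exists k => //; by rewrite /a' /b' mem_set.
apply: lee_nneseries => [k _ _|k _]; first by rewrite lee_fin box_volume_ge0.
rewrite /a' /b'; case: ifPn => // _.
by rewrite lee_fin /box_volume (bigD1 ord0)//= !mxE sub0r max_l ?mul0r// lerN10.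
Qed.

(** * The tree of cells *)

Section cells.
Context (R : realType) (d : nat).
Hypothesis d_gt0 : (0 < d)%N.
Implicit Types (w : seq bool) (m n : nat) (i : 'I_d).

(** Number of times that the coordinate [i] is halved when the coordinates
    are halved cyclically, [m] times in total. *)
Definition halvings m i : nat := (m + (d.-1 - i)) %/ d.

Definition split_dir m : 'I_d := Ordinal (ltn_pmod m d_gt0).

(** Words are read from right to left: the last halving is the head. *)
Fixpoint cell_index w i : nat :=
  if w is b :: w' then
    if i == split_dir (size w') then ((cell_index w' i).*2 + b)%N
    else cell_index w' i
  else 0.

Definition cell_lo w : 'rV[R]_d :=
  \row_i ((cell_index w i)%:R / 2 ^+ halvings (size w) i).

Definition cell_hi w : 'rV[R]_d :=
  \row_i ((cell_index w i).+1%:R / 2 ^+ halvings (size w) i).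

Definition cell w : set (Rd R d) := box (cell_lo w) (cell_hi w).

Fixpoint words m : seq (seq bool) :=
  if m is m'.+1 then map (cons false) (words m') ++ map (cons true) (words m')
  else [:: [::]].

Lemma size_words m w : w \in words m -> size w = m.
Proof.
elim: m w => [w|m IH w /=]; first by rewrite inE => /eqP ->.
by rewrite mem_cat => /orP[] /mapP[w' /IH <- ->].
Qed.

Lemma mem_words w : w \in words (size w).
Proof.
elim: w => //= b w IH; rewrite mem_cat; apply/orP.
by case: b; [right|left]; apply: map_f.
Qed.

Lemma words_uniq m : uniq (words m).
Proof.
elim: m => //= m IH; rewrite cat_uniq !map_inj_uniq ?IH//=; try by move=> ? ? [].
by rewrite andbT; apply/hasPn => _ /mapP[w _ ->]; apply/negP => /mapP[].
Qed.

Lemma big_words (V : nmodType) m (F : seq bool -> V) :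
  \sum_(w <- words m.+1) F w =
  \sum_(w <- words m) (F (false :: w) + F (true :: w)).
Proof. by rewrite /= big_cat/= !big_map big_split. Qed.

Lemma big_words_cat (V : nmodType) m n (F : seq bool -> V) :
  \sum_(w <- words (n + m)) F w =
  \sum_(w <- words m) \sum_(v <- words n) F (v ++ w).
Proof.
elim: n F => [|n IH] F.
  by apply: eq_bigr => w _; rewrite big_seq1.
rewrite addSn big_words IH; apply: eq_bigr => w _.
by rewrite big_words.
Qed.

Lemma halvings0 i : halvings 0 i = 0.
Proof. by rewrite /halvings add0n divn_small//; have := ltn_ord i; lia. Qed.

Lemma halvingsM n i : halvings (n * d) i = n.
Proof.
by rewrite /halvings divnMDl// divn_small ?addn0//; have := ltn_ord i; lia.
Qed.

Lemma halvingsS m i : halvings m.+1 i = (halvings m i + (i == split_dir m))%N.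
Proof.
rewrite /halvings addSn divnS// addnC; congr (_ + _)%N.
have id := ltn_ord i; rewrite -val_eqE/=.
suff -> : (d %| (m + (d.-1 - i)).+1)%N = (i == m %% d :> nat)%N by [].
rewrite [in LHS](divn_eq m d) -addnA -addnS dvdn_addr ?dvdn_mull//.
have md := ltn_pmod m d_gt0; set r := (m %% d)%N in md *.
have [->|ir] := eqVneq (i : nat) r.
  by rewrite (_ : _.+1 = d) ?dvdnn//; lia.
have [ir'|ir'] := ltnP i r.
  rewrite (_ : _.+1 = d + (r - i))%N; last lia.
  by rewrite dvdn_addr// gtnNdvd//; lia.
by rewrite gtnNdvd//; lia.
Qed.

Lemma leq_halvings m i : (m %/ d <= halvings m i)%N.
Proof. by rewrite leq_div2r// leq_addr. Qed.

Lemma cell_index_lt w i : (cell_index w i < 2 ^ halvings (size w) i)%N.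
Proof.
elim: w => [|b w IH] /=; first by rewrite halvings0.
rewrite halvingsS; case: eqP => _; last by rewrite addn0.
by rewrite addn1 expnS; case: b; lia.
Qed.

Definition cell_mid w : R :=
  (cell_lo w 0 (split_dir (size w)) + cell_hi w 0 (split_dir (size w))) / 2.

Lemma cell_lo_hi w i : cell_lo w 0 i < cell_hi w 0 i.
Proof. by rewrite !mxE ltr_pM2r ?invr_gt0 ?exprn_gt0// ltr_nat. Qed.

Lemma cell_side w i :
  cell_hi w 0 i - cell_lo w 0 i = 2^-1 ^+ halvings (size w) i.
Proof. by rewrite !mxE -mulrBl -natrB// subSnn mul1r exprVn. Qed.

Lemma cell_lo0 w : cell_lo (false :: w) = cell_lo w.
Proof.
apply/rowP => i; rewrite !mxE/= halvingsS; case: eqP => _; last by rewrite addn0.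
by rewrite !addn0 addn1 exprS -mul2n natrM; field; rewrite ?expf_neq0 ?pnatr_eq0.
Qed.

Lemma cell_hi1 w : cell_hi (true :: w) = cell_hi w.
Proof.
apply/rowP => i; rewrite !mxE/= halvingsS; case: eqP => _; last by rewrite addn0.
rewrite !addn1 exprS -mul2n (_ : (2 * _).+2 = 2 * (cell_index w i).+1)%N; last lia.
by rewrite natrM; field; rewrite ?expf_neq0 ?pnatr_eq0.
Qed.

Lemma cell_lo1 w :
  cell_lo (true :: w) = set_coord (cell_lo w) (split_dir (size w)) (cell_mid w).
Proof.
apply/rowP => i; rewrite /cell_mid !mxE/= halvingsS; case: eqP => [->|_].
  rewrite !addn1 exprS -mul2n -[(2 * _).+1%:R]natr1 -[(cell_index w _).+1%:R]natr1.
  by rewrite natrM; field; rewrite ?expf_neq0 ?pnatr_eq0.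
by rewrite addn0.
Qed.

Lemma cell_hi0 w :
  cell_hi (false :: w) = set_coord (cell_hi w) (split_dir (size w)) (cell_mid w).
Proof.
apply/rowP => i; rewrite /cell_mid !mxE/= halvingsS; case: eqP => [->|_].
  rewrite !addn1 addn0 exprS -mul2n -[(2 * _).+1%:R]natr1 -[(cell_index w _).+1%:R]natr1.
  by rewrite natrM; field; rewrite ?expf_neq0 ?pnatr_eq0.
by rewrite addn0.
Qed.

Lemma cell_mid_between w : cell_lo w 0 (split_dir (size w)) < cell_mid w <
  cell_hi w 0 (split_dir (size w)).
Proof. by rewrite !midf_lt// cell_lo_hi. Qed.

Lemma cell_nil : cell [::] = cube R d.
Proof.
congr box; apply/rowP => i; rewrite !mxE ?mul0r//.
by rewrite halvings0 expr0 divr1.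
Qed.

Lemma cell_split w : cell w = cell (false :: w) `|` cell (true :: w).
Proof.
rewrite /cell cell_lo0 cell_hi1 cell_lo1 cell_hi0; apply: box_split.
by have /andP[/ltW-> /ltW->] := cell_mid_between w.
Qed.

Lemma cell_split_null w : leb R d (cell (false :: w) `&` cell (true :: w)) = 0%E.
Proof.
by rewrite /cell cell_lo0 cell_hi1 cell_lo1 cell_hi0; exact: box_split_null.
Qed.

Lemma measurable_cell w : measurable (cell w).
Proof. exact: measurable_box. Qed.

Lemma sub_cell_cat v w : cell (v ++ w) `<=` cell w.
Proof.
elim: v => //= b v IH; apply: subset_trans IH.
by rewrite [X in _ `<=` X]cell_split; case: b; [exact: subsetUr|exact: subsetUl].
Qed.

Lemma sub_cell_cube w : cell w `<=` cube R d.
Proof. by rewrite -cell_nil -[w]cats0; exact: sub_cell_cat. Qed.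

Lemma cell_volume w : box_volume (cell_lo w) (cell_hi w) = 2^-1 ^+ size w.
Proof.
elim: w => [|b w IH].
  rewrite box_volumeE; last by move=> i; exact/ltW/cell_lo_hi.
  by rewrite big1// => i _; rewrite cell_side halvings0.
rewrite box_volumeE in IH; last by move=> i; exact/ltW/cell_lo_hi.
rewrite box_volumeE; last by move=> i; exact/ltW/cell_lo_hi.
rewrite /= exprS -IH !(bigD1 (P := predT) (split_dir (size w)))//= mulrA.
congr (_ * _); last first.
  apply: eq_bigr => i /negbTE iw; rewrite !cell_side/= halvingsS iw addn0//.
by rewrite !cell_side/= halvingsS eqxx addn1 exprS.
Qed.

(** Covers only bound the measure of a cell from above. Equality goes down the tree from the unit
    cube: each half has at most half the measure of its parent, and together they have at least all
    of it. *)
Lemma leb_cell w : leb R d (cell w) = (2^-1 ^+ size w)%:E.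
Proof.
elim: w => [|b w IH]; first by rewrite cell_nil leb_cube.
have le b' : (leb R d (cell (b' :: w)) <= (2^-1 ^+ (size w).+1)%:E)%E.
  by rewrite (le_trans (leb_box_le _ _))// cell_volume.
have fin b' : leb R d (cell (b' :: w)) \is a fin_num.
  by rewrite ge0_fin_numE ?measure_ge0// leb_box_lty.
have : (leb R d (cell w) <= leb R d (cell (false :: w)) + leb R d (cell (true :: w)))%E.
  by rewrite cell_split measureU2//; exact: measurable_cell.
rewrite IH; move: (le false) (le true).
rewrite -(fineK (fin false)) -(fineK (fin true)) -(fineK (fin b)) -EFinD !lee_fin.
rewrite exprS => h0 h1 h; congr EFin; move: h0 h1 h.
case: b; move: (fine (leb R d (cell (false :: w)))) (fine (leb R d (cell (true :: w))))
  (_ ^+ size w) => x y z; lra.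
Qed.

Lemma dyadic_cell n w : size w = (n * d)%N -> dyadic_cube (cell w).
Proof.
move=> wn; exists n, (cell_index w); split.
  by move=> i; have := cell_index_lt w i; rewrite wn halvingsM.
by congr box; apply/rowP => i; rewrite !mxE wn halvingsM.
Qed.

(** The halvings of a coordinate read its index from the most significant bit on: after [m] halvings
    in total, the word has recorded [k i] without its last [n - halvings m i] bits. *)
Lemma cell_of_index n (k : 'I_d -> nat) : (forall i, k i < 2 ^ n)%N ->
  exists2 w, size w = (n * d)%N &
    box (\row_i ((k i)%:R / 2 ^+ n)) (\row_i ((k i).+1%:R / 2 ^+ n)) = cell w.
Proof.
move=> kn.
have H m : (m <= n * d)%N -> exists2 w, size w = m &
    forall i, cell_index w i = (k i %/ 2 ^ (n - halvings m i))%N.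
  elim: m => [_|m IH mn].
    exists [::] => // i /=; rewrite halvings0 subn0 divn_small//.
  have [w wm kw] := IH (ltnW mn).
  pose j := split_dir m.
  have jn : (halvings m.+1 j <= n)%N.
    by rewrite -(halvingsM n j) leq_div2r// leq_add2r.
  pose q := (k j %/ 2 ^ (n - halvings m.+1 j))%N.
  exists (odd q :: w) => /=; first by rewrite wm.
  move=> i; rewrite wm; case: eqP => [->|ij]; last first.
    by rewrite kw halvingsS; case: eqP => // _; rewrite addn0.
  rewrite kw -/j -/q.
  have -> : (n - halvings m j = (n - halvings m.+1 j).+1)%N.
    by move: jn; rewrite halvingsS eqxx; lia.
  rewrite expnS mulnC divnMA -/q divn2 addnC -[RHS]odd_double_half//.
have [w wm kw] := H _ (leqnn _).
by exists w => //; congr box; apply/rowP => i; rewrite !mxE wm kw halvingsM subnn divn1.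
Qed.

Lemma dyadic_cubeP (K : set (Rd R d)) : dyadic_cube K ->
  exists n, exists2 w, size w = (n * d)%N & K = cell w.
Proof.
by move=> [n [k [kn ->]]]; have [w wn ->] := cell_of_index kn; exists n, w.
Qed.

(** Closed cells share faces, hence the interiors: a point is interior to at most one of the two
    halves, and then to the parent. *)
Lemma sum_open_cell_le1 m (x : 'rV[R]_d) :
  \sum_(w <- words m) (\1_(open_box (cell_lo w) (cell_hi w)) x : R) <= 1.
Proof.
apply: (@le_trans _ _ (\1_(open_box (cell_lo [::]) (cell_hi [::])) x)); last first.
  by rewrite indicE lern1 leq_b1.
elim: m => [|m IH]; first by rewrite big_seq1.
apply: le_trans IH; rewrite big_words; apply: ler_sum => w _.
rewrite cell_lo0 cell_hi1 cell_lo1 cell_hi0 !indicE -natrD ler_nat.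
set A0 := open_box _ _; set A1 := open_box _ _; set A := open_box _ _.
set j := split_dir (size w).
have /andP[lm mh] := cell_mid_between w.
have A0A : A0 `<=` A.
  move=> y A0y i; have /andP[-> /=] := A0y i; rewrite mxE; case: eqP => // -> ym.
  exact: lt_trans mh.
have A1A : A1 `<=` A.
  move=> y A1y i; have /andP[+ ->] := A1y i; rewrite andbT mxE; case: eqP => // -> ym.
  exact: lt_trans ym.
case: (boolP (x \in A0)) => [xA0|_]; last first.
  by case: (boolP (x \in A1)) => // /set_mem/A1A/mem_set ->.
rewrite (mem_set (A0A _ (set_mem xA0))) memNset// => A1x.
have := A1x j; have := set_mem xA0 j; rewrite !mxE eqxx => /andP[_ xm] /andP[].
by move=> /(lt_trans xm); rewrite ltxx.
Qed.

End cells.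

(** * Measurability of open sets and of continuous functions *)

Section lebesgue_borel.
Context (R : realType) (d : nat).

Lemma measurable_open (A : set 'rV[R]_d) :
  open A -> measurable (A : set (Rd R d)).
Proof.
move=> oA.
pose q (x : 'rV[rat]_d) : 'rV[R]_d := \row_i ratr (x 0 i).
pose F (p : 'rV[rat]_d * 'rV[rat]_d) : set (Rd R d) :=
  if pselect (open_box (q p.1) (q p.2) `<=` A) then open_box (q p.1) (q p.2)
  else set0.
rewrite [X in measurable X](_ : _ = \bigcup_p F p); last first.
  apply/seteqP; split => x /=; last first.
    by move=> [p _]; rewrite /F; case: pselect => //= pA /pA.
  move=> Ax; have /nbhs_ballP[e /= e0 eA] := open_nbhs_nbhs (conj oA Ax).
  have ha i : exists r : rat, ratr r \in `](x 0 i - e), (x 0 i)[.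
    by apply: rat_in_itvoo; rewrite ltrBlDr ltrDl.
  have hb i : exists r : rat, ratr r \in `](x 0 i), (x 0 i + e)[.
    by apply: rat_in_itvoo; rewrite ltrDl.
  pose a := \row_i sval (cid (ha i)); pose b := \row_i sval (cid (hb i)).
  exists (a, b) => //; rewrite /F; case: pselect => /= [_|[]].
    move=> i; rewrite !mxE; case: cid => ra /=; case: cid => rb /=.
    by rewrite !in_itv/= => /andP[-> _] /andP[_ ->].
  move=> y aby; apply: eA; split => // i j; rewrite ord1.
  have := aby j; rewrite !mxE; case: cid => ra /=; case: cid => rb /=.
  rewrite !in_itv/= /ball/= => /andP[? ?] /andP[? ?] /andP[? ?].
  by rewrite ltr_distl; apply/andP; split; lra.
apply: countable_bigcupT_measurable => [|p]; [exact: countableP|]; rewrite /F.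
by case: pselect => h /=; [exact: measurable_open_box|exact: measurable0].
Qed.

Lemma continuous_measurable_Rd (g : 'rV[R]_d -> R) :
  continuous g -> measurable_fun setT (g : Rd R d -> R).
Proof.
move=> cg; apply: (measurability _ (RGenOpens.measurableE R)).
move=> /= _ [_ [a [b ->] <-]]; apply: measurableI => //.
by apply: measurable_open; apply: open_comp => // x _; exact: cg.
Qed.

End lebesgue_borel.

(** * Integrals of real-valued functions *)

Section Rintegral_extra.
Context (disp : measure_display) (T : measurableType disp) (R : realType).
Variable mu : {measure set T -> \bar R}.
Implicit Types (A B : set T) (u : T -> R).

Lemma Rintegral_null A u : measurable A -> mu A = 0%E ->
  measurable_fun A u -> \int[mu]_(x in A) u x = 0.
Proof.
move=> mA A0 mu_; rewrite /Rintegral null_set_integral//.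
exact/measurable_EFinP.
Qed.

Lemma Rintegral_setU_null A B u : measurable A -> measurable B ->
  mu.-integrable (A `|` B) (EFin \o u) -> mu (A `&` B) = 0%E ->
  \int[mu]_(x in A `|` B) u x = \int[mu]_(x in A) u x + \int[mu]_(x in B) u x.
Proof.
move=> mA mB iu AB0.
have intB : mu.-integrable B (EFin \o u).
  by apply: integrableS iu => //; exact: measurableU.
have mAB : measurable (A `&` B) by exact: measurableI.
have mBA : measurable (B `\` A) by exact: measurableD.
have AUB : A `|` B = A `|` (B `\` A).
  apply/seteqP; split => x; last by case=> [|[]]; [left|right].
  case=> [|Bx]; first by left.
  by have [Ax|nAx] := pselect (A x); [left|right].
have BE : B = (A `&` B) `|` (B `\` A).
  apply/seteqP; split => x; last by case=> -[].
  by move=> Bx; have [Ax|nAx] := pselect (A x); [left|right].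
rewrite AUB Rintegral_setU//; last 2 first.
- by rewrite -AUB.
- by apply/disj_setPS => x [Ax []].
congr (_ + _); rewrite [in RHS]BE Rintegral_setU//.
- rewrite (Rintegral_null mAB)// ?add0r//.
  apply/measurable_EFinP; apply: (measurable_int mu).
  by apply: integrableS intB => //; exact: subIsetr.
- by rewrite -BE.
- by apply/disj_setPS => x [[Ax _] []].
Qed.

Lemma Rintegral_indicM A u : \int[mu]_x (u x * \1_A x) = \int[mu]_(x in A) u x.
Proof.
rewrite [RHS]Rintegral_mkcond; apply: eq_Rintegral => x _.
by rewrite patch_indic.
Qed.

Lemma Rintegral_bound A u M : measurable A -> (mu A < +oo)%E ->
  measurable_fun A u -> (forall x, A x -> `|u x| <= M) ->
  `|\int[mu]_(x in A) u x| <= M * fine (mu A).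
Proof.
move=> mA Aoo mu_ uM.
have iu : mu.-integrable A (EFin \o u).
  apply: measurable_bounded_integrable => //.
  exists M; split; first exact: num_real.
  by move=> y My x Ax; exact: le_trans (uM _ Ax) (ltW My).
rewrite (le_trans (le_normr_Rintegral _ _))// -Rintegral_cst//.
apply: le_Rintegral => //.
- by rewrite (_ : EFin \o _ = abse \o (EFin \o u))//; exact: integrable_abse.
- apply: measurable_bounded_integrable => //.
  exists `|M|; split; first exact: num_real.
  by move=> y My x Ax; exact: ltW.
Qed.

Lemma cvg_Rintegral_dominated A (f_ : nat -> T -> R) u (g : T -> R) :
  measurable A -> (forall n, measurable_fun A (f_ n)) ->
  (forall x, A x -> f_ ^~ x @ \oo --> u x) ->
  mu.-integrable A (EFin \o g) ->
  (forall n x, A x -> `|f_ n x| <= g x) ->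
  (fun n => \int[mu]_(x in A) f_ n x) @ \oo --> \int[mu]_(x in A) u x.
Proof.
move=> mA mf fu ig fg.
have mu_ : measurable_fun A u by exact: (measurable_fun_cvg mf fu).
have [||||iu _ H] := dominated_convergence mA (f_ := fun n => EFin \o f_ n)
  (f := EFin \o u) (g := EFin \o g) _ _ _ ig.
- by move=> n; exact/measurable_EFinP.
- exact/measurable_EFinP.
- by apply: aeW => x Ax; apply: cvg_EFin; [exact: nearW|exact: fu].
- by apply: aeW => x n Ax; rewrite /= lee_fin; exact: fg.
apply: fine_cvg; rewrite fineK; first exact: H.
exact: integrable_fin_num.
Qed.

End Rintegral_extra.

(** * Translation invariance *)

Section translation.
Context (R : realType) (d : nat).
Implicit Types (t : 'rV[R]_d) (A : set 'rV[R]_d).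

Let leb_outer_translate_le t A :
  (leb_outer [set x | A (x + t)%R] <= leb_outer A)%E.
Proof.
apply: le_ereal_inf_tmp => _ [D [a [b [AD ->]]]].
rewrite (eq_esum (b := fun k => (box_volume (a k - t) (b k - t))%:E)); last first.
  move=> k _; congr EFin; apply: eq_bigr => i _; rewrite !mxE; congr Num.max.
  by rewrite opprB addrA subrK.
apply: leb_outer_le_esum => x /= /AD[k Dk abk]; exists k => // i.
by have := abk i; rewrite !mxE lerBlDr lerBrDr.
Qed.

Lemma leb_outer_translate t A : leb_outer [set x | A (x + t)] = leb_outer A.
Proof.
apply/eqP; rewrite eq_le leb_outer_translate_le/=.
have /= := leb_outer_translate_le (- t) [set x | A (x + t)].
by under eq_set do rewrite subrK.
Qed.

Lemma caratheodory_translate t A :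
  (@leb_outer R d).-caratheodory A ->
  (@leb_outer R d).-caratheodory [set x | A (x + t)].
Proof.
move=> mA X; have := mA [set x | X (x - t)].
rewrite -(leb_outer_translate t) -[X in _ = (X + _)%E](leb_outer_translate t).
rewrite -[X in _ = (_ + X)%E](leb_outer_translate t) /=.
under eq_set do rewrite addrK.
move=> ->; congr (_ + _)%E; apply: (congr1 (@leb_outer R d));
  by apply/seteqP; split => x /=; rewrite addrK.
Qed.

Lemma measurable_translate t :
  measurable_fun setT (+%R^~ t : Rd R d -> Rd R d).
Proof.
by move=> _ A mA; rewrite setTI; exact: caratheodory_translate.
Qed.

Lemma Rintegral_translate_box t (a b : 'rV[R]_d) (g : 'rV[R]_d -> R) M :
  measurable_fun setT (g : Rd R d -> R) -> (forall x, `|g x| <= M) ->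
  \int[leb R d]_(x in box a b) g (x + t) =
  \int[leb R d]_(x in box (a + t) (b + t)) g x.
Proof.
move=> mg gM; rewrite /Rintegral; congr fine.
have mtr := @measurable_translate t.
have boxE : box a b = (+%R^~ t) @^-1` (box (a + t) (b + t)).
  by apply/seteqP; split => x abx i; have := abx i; rewrite !mxE !lerD2r.
transitivity (\int[pushforward (leb R d) (+%R^~ t : Rd R d -> Rd R d)]_(x in
    box (a + t) (b + t)) (EFin \o g) x)%E.
  rewrite (integral_pushforward mtr).
  - by rewrite -boxE.
  - exact/measurable_EFinP.
  - rewrite -boxE; apply: measurable_bounded_integrable.
    + exact: measurable_box.
    + exact: leb_box_lty.
    + apply: measurable_funTS; exact: measurableT_comp mg mtr.
    + exists M; split; first exact: num_real.
      by move=> y My x _; exact: le_trans (gM _) (ltW My).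
  - exact: measurable_box.
by apply: eq_measure_integral => A mA _; exact: leb_outer_translate.
Qed.

End translation.

Lemma cvg_sum_seq (R : realType) (T I : Type) (F : set_system T)
    (FF : Filter F) (s : seq I) (f : I -> T -> R) (l : I -> R) :
  (forall i, f i @ F --> l i) ->
  (fun x => \sum_(i <- s) f i x) @ F --> \sum_(i <- s) l i.
Proof.
move=> fl; elim: s => [|i s IH].
  by under eq_fun do rewrite big_nil; rewrite big_nil; exact: cvg_cst.
under eq_fun do rewrite big_cons.
by rewrite big_cons; apply: (@cvgD _ R^o).
Qed.

Lemma cvg_prod_seq (R : realType) (T I : Type) (F : set_system T)
    (FF : Filter F) (s : seq I) (P : pred I) (f : I -> T -> R) (l : I -> R) :
  (forall i, f i @ F --> l i) ->
  (fun x => \prod_(i <- s | P i) f i x) @ F --> \prod_(i <- s | P i) l i.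
Proof.
move=> fl; elim: s => [|i s IH].
  by under eq_fun do rewrite big_nil; rewrite big_nil; exact: cvg_cst.
under eq_fun do rewrite big_cons.
by rewrite big_cons; case: (P i) => //; apply: cvgM.
Qed.

(** * Test fields and variation *)

Section partial_derivatives.
Context (R : realType) (d : nat).
Implicit Types (G : 'rV[R]_d -> R) (x y e : 'rV[R]_d) (i j : 'I_d).

Lemma normr_coord_le x j : `|x 0 j| <= `|x|.
Proof.
by rewrite [leRHS]/Num.Def.normr/= mx_normrE; exact: (le_bigmax _ _ (ord0, j)).
Qed.

Lemma enorm_coord_le x j : `|x 0 j| <= enorm x.
Proof.
rewrite -sqrtr_sqr ler_sqrt ?sumr_ge0// => [|i _]; last exact: sqr_ge0.
by rewrite (bigD1 j)//= lerDl sumr_ge0// => i _; exact: sqr_ge0.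
Qed.

Lemma is_derive_line G e x t : derivable G (x + t *: e) e ->
  is_derive t (1 : R) (fun s => G (x + s *: e)) ('D_e G (x + t *: e)).
Proof.
move=> dG.
have E : (fun h : R => h^-1 *: (((fun s => G (x + s *: e)) \o shift t) (h *: 1) -
    G (x + t *: e))) =
  (fun h => h^-1 *: ((G \o shift (x + t *: e)) (h *: e) - G (x + t *: e))).
  apply/funext => h /=; congr (_ *: (G _ - _)).
  by rewrite -[h *: 1]/(h * 1) mulr1 scalerDl addrCA.
by split; rewrite /derivable ?/derive E.
Qed.

Lemma partial_mvt G e M : (forall y, derivable G y e) ->
  (forall y, `|'D_e G y| <= M) ->
  forall x t, `|G (x + t *: e) - G x| <= M * `|t|.
Proof.
move=> dG DM.
have pos x t : 0 < t -> `|G (x + t *: e) - G x| <= M * `|t|.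
  move=> t0; have dphi s := is_derive_line (dG (x + s *: e)).
  have [|s _] := MVT t0 (fun s _ => dphi s).
    apply: continuous_subspaceT => s.
    by apply/differentiable_continuous/derivable1_diffP; have [] := dphi s.
  rewrite scale0r addr0 subr0 => ->.
  by rewrite normrM ler_wpM2r.
move=> x t; have [t0|t0|->] := ltgtP t 0; last first.
- by rewrite scale0r addr0 subrr !normr0 mulr0.
- exact: pos.
have := pos (x + t *: e) (- t); rewrite oppr_gt0 scaleNr addrK normrN distrC.
exact.
Qed.

(** Walk from [x] to [y] one coordinate at a time. *)
Lemma bounded_partials_continuous G M :
  (forall i y, derivable G y (delta_mx 0 i)) ->
  (forall i y, `|'D_(delta_mx 0 i) G y| <= M) -> continuous G.
Proof.
move=> dG DM.
have lip x y : `|G y - G x| <= d%:R * (`|M| * `|y - x|).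
  pose p k : 'rV[R]_d := \row_(i < d) (if (i < k)%N then y 0 i else x 0 i).
  have p0 : p 0%N = x by apply/rowP => i; rewrite !mxE.
  have pd : p d = y by apply/rowP => i; rewrite !mxE ltn_ord.
  have H k : (k <= d)%N -> `|G (p k) - G x| <= k%:R * (`|M| * `|y - x|).
    elim: k => [_|k IH kd]; first by rewrite p0 subrr normr0 mul0r.
    have pk : p k.+1 = p k + (y 0 (Ordinal kd) - x 0 (Ordinal kd)) *: delta_mx 0 (Ordinal kd).
      apply/rowP => i; rewrite !mxE/= ltnS leq_eqVlt -val_eqE/=.
      have [ik|ik] := eqVneq (i : nat) k.
        have -> : i = Ordinal kd by apply/val_inj.
        by rewrite /= ltnn mulr1 addrC subrK.
      by rewrite /= mulr0 addr0.
    have -> : G (p k.+1) - G x = G (p k.+1) - G (p k) + (G (p k) - G x).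
      by rewrite addrA subrK.
    apply: le_trans (ler_normD _ _) _.
    rewrite -natr1 mulrDl mul1r addrC lerD ?IH 1?ltnW// pk.
    rewrite (le_trans (partial_mvt (dG _) (DM _) _ _))//.
    apply: ler_pM => //; first by rewrite (le_trans _ (DM (Ordinal kd) x)).
      exact: ler_norm.
    by have := normr_coord_le (y - x) (Ordinal kd); rewrite !mxE.
  by rewrite -{1}pd H.
have K0 : 0 < d%:R * `|M| + 1 by rewrite ltr_wpDl// mulr_ge0.
move=> x; apply/(@cvgrPdist_le _ _ _ (nbhs x) (nbhs_filter x)) => /= e e0.
apply/nbhs_ballP; exists (e / (d%:R * `|M| + 1)); first by rewrite /= divr_gt0.
move=> y; rewrite -ball_normE/= => xy.
rewrite distrC (le_trans (lip _ _))// mulrA.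
apply: (@le_trans _ _ ((d%:R * `|M| + 1) * `|y - x|)).
  by rewrite ler_wpM2r// lerDl.
by rewrite mulrC -ler_pdivlMr// distrC ltW.
Qed.

End partial_derivatives.

Section test_fields.
Context (R : realType) (d : nat).
Variable v : 'rV[R]_d -> 'rV[R]_d.
Hypotheses (vC1 : C1 v) (vsupp : compactly_supported v).

Lemma C1_derivable_coord i j x :
  derivable (fun x => v x 0 j) x (delta_mx 0 i).
Proof. by have [dv _] := vC1 i; have /derivable_mxP/(_ 0 j) := dv x. Qed.

Lemma C1_derive_coord i j x :
  'D_(delta_mx 0 i) v x 0 j = 'D_(delta_mx 0 i) (fun x => v x 0 j) x.
Proof. by have [dv _] := vC1 i; rewrite derive_mx// mxE. Qed.

Lemma continuous_partial i j :
  continuous (fun x => 'D_(delta_mx 0 i) (fun x => v x 0 j) x).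
Proof.
have [dv cv] := vC1 i.
rewrite (_ : (fun x => _) = (fun A : 'rV[R]_d => A 0 j) \o 'D_(delta_mx 0 i) v).
  by move=> x; apply: continuous_comp; [exact: cv|exact: coord_continuous].
by apply/funext => x /=; rewrite C1_derive_coord.
Qed.

(** A continuous partial derivative is bounded on the compact support; off the closed support the
    field vanishes in a neighbourhood, so the derivative is 0. *)
Lemma partials_bounded :
  exists M, forall i j x, `|'D_(delta_mx 0 i) (fun x => v x 0 j) x| <= M.
Proof.
suff /choice[M HM] : forall p : 'I_d * 'I_d, exists M, forall x,
    `|'D_(delta_mx 0 p.1) (fun x => v x 0 p.2) x| <= M.
  exists (\big[Num.max/0]_p M p) => i j x.
  by apply: le_trans (HM (i, j) x) _; exact: le_bigmax.
move=> [i j] /=.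
have cD := @continuous_partial i j.
have := compact_bounded (continuous_compact (continuous_subspaceT cD) vsupp).
(* The bound must exceed [M] strictly, and be nonnegative for the points off the support. *)
move=> [M [_ /(_ (Num.max 0 M + 1))]].
rewrite (le_lt_trans (_ : _ <= Num.max 0 M))// ?le_max ?lexx ?orbT//; last first.
  by rewrite ltrDl.
move=> /(_ isT) /= H; exists (Num.max 0 M + 1) => x.
have [xS|xS] := pselect (closure [set x | v x != 0] x).
  by apply: H; exists x.
rewrite (@near_eq_derive _ _ _ _ (cst 0)).
  by rewrite derive_cst normr0 addr_ge0// le_max lexx.
have : nbhs x (~` closure [set x | v x != 0]).
  by apply: open_nbhs_nbhs; split => //; apply: closed_openC; exact: closed_closure.
apply: filterS => y /= yS; have [->|vy] := eqVneq (v y) 0; first by rewrite mxE.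
by exfalso; apply: yS; exact: subset_closure.
Qed.

(** [C1] speaks of partial derivatives only, so the continuity of the field itself has to be
    recovered, here from their boundedness. *)
Lemma continuous_coord_field j : continuous (fun x => v x 0 j).
Proof.
have [M HM] := partials_bounded.
apply: (@bounded_partials_continuous _ _ _ M) => i y; last exact: HM.
exact: C1_derivable_coord.
Qed.

Lemma divergenceE x :
  divergence v x = \sum_(j < d) 'D_(delta_mx 0 j) (fun x => v x 0 j) x.
Proof. by apply: eq_bigr => j _; rewrite C1_derive_coord. Qed.

Lemma continuous_divergence : continuous (divergence v).
Proof.
rewrite (_ : divergence v =
  (fun x => \sum_(j < d) 'D_(delta_mx 0 j) (fun x => v x 0 j) x)); last first.
  by apply/funext => x; rewrite divergenceE.
by move=> x; apply: (cvg_sum_seq (nbhs_filter x)) => j; exact: continuous_partial.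
Qed.

Lemma divergence_bounded : exists M, forall x, `|divergence v x| <= M.
Proof.
have [M HM] := partials_bounded; exists (d%:R * M) => x.
rewrite divergenceE (le_trans (ler_norm_sum _ _ _))//.
apply: (@le_trans _ _ (\sum_(j < d) M)); first by apply: ler_sum => i _.
by rewrite sumr_const card_ord mulr_natl.
Qed.

Lemma measurable_divergence : measurable_fun setT (divergence v : Rd R d -> R).
Proof. by apply: continuous_measurable_Rd; exact: continuous_divergence. Qed.

End test_fields.

Section variation_basics.
Context (R : realType) (d : nat).
Implicit Types (u : Rd R d -> R) (v : 'rV[R]_d -> 'rV[R]_d).

Lemma C1_scale (s : R) v : C1 v -> C1 (fun x => s *: v x).
Proof.
move=> vC1 i; have [dv cv] := vC1 i; split=> [x|]; first exact: derivableZ.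
rewrite (_ : 'D_(delta_mx 0 i) _ = fun x => s *: 'D_(delta_mx 0 i) v x).
  by move=> x; apply: (@cvgZr _ 'rV[R]_d _ _ (nbhs_filter x)); exact: cv.
by apply/funext => x; rewrite deriveZ.
Qed.

Lemma compactly_supported_scale (s : R) v : compactly_supported v ->
  compactly_supported (fun x => s *: v x).
Proof.
move=> sv; apply: subclosed_compact sv _; first exact: closed_closure.
apply: closure_subset => x /=; apply: contra_neq => ->.
by rewrite scaler0.
Qed.

Lemma divergence_scale (s : R) v x : C1 v ->
  divergence (fun x => s *: v x) x = s * divergence v x.
Proof.
move=> vC1; rewrite /divergence mulr_sumr; apply: eq_bigr => i _.
by have [dv _] := vC1 i; rewrite deriveZ// mxE.
Qed.

Lemma enorm_scale (s : R) (x : 'rV[R]_d) : enorm (s *: x) = `|s| * enorm x.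
Proof.
rewrite /enorm; under eq_bigr do rewrite mxE exprMn.
by rewrite -mulr_sumr sqrtrM ?sqr_ge0// sqrtr_sqr.
Qed.

Lemma integrable_mul_divergence u v : C1 v -> compactly_supported v ->
  (leb R d).-integrable setT (EFin \o u) ->
  (leb R d).-integrable setT (EFin \o (fun x => u x * divergence v x)).
Proof.
move=> vC1 sv iu; have [M HM] := divergence_bounded vC1 sv.
have bd : [bounded (divergence v : Rd R d -> R) x | x in [set: Rd R d]].
  exists M; split; first exact: num_real.
  by move=> y My x _; exact: le_trans (HM _) (ltW My).
have := integrableMl measurableT iu (measurable_divergence vC1) bd.
by apply: eq_integrable => // x _ /=; rewrite EFinM.
Qed.

Lemma variation_ge0 u : (0 <= variation u)%E.
Proof.
apply: ereal_sup_ubound; exists (fun=> 0).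
  split.
  - move=> i; split=> [x|]; first exact: derivable_cst.
    rewrite (_ : 'D_(delta_mx 0 i) _ = cst 0).
      exact: cst_continuous.
    by apply/funext => x; rewrite derive_cst.
  - have E : [set x : 'rV[R]_d | (0 : 'rV[R]_d) != 0] = set0.
      by apply/seteqP; split => x //=; rewrite eqxx.
    by rewrite /compactly_supported E closure0; exact: compact0.
  - by move=> x; rewrite /enorm big1 ?sqrtr0// => i _; rewrite mxE expr0n.
rewrite (eq_integral (cst 0%E)) ?integral0// => x _.
rewrite /divergence big1 ?mulr0// => i _.
by rewrite derive_cst mxE.
Qed.

Lemma variation_test u v c : 0 < c ->
  (leb R d).-integrable setT (EFin \o u) -> (variation u < +oo)%E ->
  C1 v -> compactly_supported v -> (forall x, enorm (v x) <= c) ->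
  \int[leb R d]_x (u x * divergence v x) <= c * fine (variation u).
Proof.
move=> c0 iu uoo vC1 sv vc.
have sC1 := C1_scale c^-1 vC1; have ss := @compactly_supported_scale c^-1 v sv.
have fu : variation u \is a fin_num by rewrite ge0_fin_numE// variation_ge0.
rewrite -ler_pdivrMl// -RintegralZl//; last exact: integrable_mul_divergence.
rewrite -lee_fin [leRHS]fineK// /Rintegral fineK; last first.
  apply: integrable_fin_num => //; apply: (eq_integrable measurableT).
    move=> x _ /=; rewrite mulrCA -divergence_scale//.
  exact: integrable_mul_divergence.
apply: ereal_sup_ubound; exists (fun x => c^-1 *: v x) => /=.
  split => // x; rewrite enorm_scale gtr0_norm ?invr_gt0//.
  by rewrite ler_pdivrMl// mulr1.
by apply: eq_integral => x _; rewrite divergence_scale// mulrCA.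
Qed.

Lemma variation_le u (V : R) : (leb R d).-integrable setT (EFin \o u) ->
  (forall v, C1 v -> compactly_supported v -> (forall x, enorm (v x) <= 1) ->
    \int[leb R d]_x (u x * divergence v x) <= V) ->
  (variation u <= V%:E)%E.
Proof.
move=> iu H; apply: ge_ereal_sup => _ [v [vC1 sv v1] <-].
rewrite -[leLHS]fineK ?lee_fin; first exact: H.
by apply: integrable_fin_num => //; exact: integrable_mul_divergence.
Qed.

Lemma variation_comb (a : R) u w :
  (leb R d).-integrable setT (EFin \o u) -> (variation u < +oo)%E ->
  (leb R d).-integrable setT (EFin \o w) -> (variation w < +oo)%E ->
  (variation (a *: u + w)%R <=
    (`|a| * fine (variation u) + fine (variation w))%:E)%E.
Proof.
move=> iu uoo iw woo; apply: variation_le.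
  rewrite (_ : EFin \o _ = (fun x => a%:E * (EFin \o u) x + (EFin \o w) x)%E)//.
  by apply: integrableD => //; exact: integrableZl.
move=> v vC1 sv v1.
have iuv := integrable_mul_divergence vC1 sv iu.
have iwv := integrable_mul_divergence vC1 sv iw.
rewrite (@eq_Rintegral _ _ _ (leb R d) setT
  ((fun x => a * (u x * divergence v x)) \+ (fun x => w x * divergence v x))).
  rewrite RintegralD//; last first.
    have := integrableZl measurableT a iuv.
    by apply: eq_integrable => // x _ /=; rewrite EFinM.
  rewrite RintegralZl//; apply: lerD; last first.
    by rewrite -[leRHS]mul1r; exact: variation_test.
  rewrite (le_trans (ler_norm _))// normrM ler_wpM2l//.
  rewrite ler_norml; apply/andP; split; last first.
    by rewrite -[leRHS]mul1r; exact: variation_test.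
  (* The lower bound is the upper bound for the test field [- v]. *)
  rewrite lerNl -mulN1r -RintegralZl//.
  under eq_Rintegral do rewrite mulrCA -divergence_scale//.
  rewrite -[leRHS]mul1r; apply: (variation_test _ iu uoo) => [|||x].
  - exact: ltr01.
  - exact: C1_scale.
  - exact: compactly_supported_scale.
  - by rewrite enorm_scale normrN1 mul1r.
by move=> x _ /=; rewrite mulrA -mulrDl.
Qed.

End variation_basics.

(** * Divergence theorem on boxes *)

Section flux.
Context (R : realType) (d : nat).
Variables (v : 'rV[R]_d -> 'rV[R]_d) (j : 'I_d).
Hypotheses (vC1 : C1 v) (vsupp : compactly_supported v).
Hypothesis v_le1 : forall x, enorm (v x) <= 1.

Let G x := v x 0 j.

Let mG : measurable_fun setT (G : Rd R d -> R).
Proof. exact/continuous_measurable_Rd/continuous_coord_field. Qed.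

Let G1 x : `|G x| <= 1.
Proof. exact: le_trans (enorm_coord_le _ _) (v_le1 x). Qed.

(** Flux of [v] through the face of [box a b] at height [c] in the direction
    [j], averaged over a slab of width [1 / (n + 1)]. *)
Definition slab_flux (n : nat) (a b : 'rV[R]_d) (c : R) : R :=
  n.+1%:R * \int[leb R d]_(x in box (set_coord a j c)
    (set_coord b j (c + n.+1%:R^-1))) G x.

Lemma slab_flux_le n (a b : 'rV[R]_d) c : (forall i, a 0 i <= b 0 i) ->
  `|slab_flux n a b c| <= \prod_(i | i != j) (b 0 i - a 0 i).
Proof.
move=> ab; rewrite normrM normr_nat.
have mb := @measurable_box R d (set_coord a j c) (set_coord b j (c + n.+1%:R^-1)).
rewrite -ler_pdivlMl//.
apply: le_trans (Rintegral_bound (M := 1) mb (leb_box_lty _ _) _ _) _ => //.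
  exact: measurable_funTS.
rewrite mul1r -lee_fin fineK; last by rewrite ge0_fin_numE ?measure_ge0 ?leb_box_lty.
apply: le_trans (leb_box_le _ _) _; rewrite lee_fin box_volumeE; last first.
  by move=> i; rewrite !mxE; case: eqP => // _; rewrite lerDl invr_ge0.
rewrite (bigD1 j)//= !mxE eqxx addrAC subrr add0r ler_wpM2l ?invr_ge0//.
rewrite le_eqVlt; apply/orP; left; apply/eqP.
by apply: eq_bigr => i ij; rewrite !mxE (negbTE ij).
Qed.

(** No iterated integral is taken. By translation invariance, the integral over the box of a
    difference quotient of increment [1 / (n + 1)] compares the integrals of [G] over the translated
    box and over the box. Their common part cancels, and the two end slabs remain. Dominated
    convergence turns the quotient into the derivative. *)
Lemma box_flux (a b : 'rV[R]_d) : (forall i, a 0 i < b 0 i) ->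
  (fun n => slab_flux n a b (b 0 j) - slab_flux n a b (a 0 j)) @ \oo -->
  \int[leb R d]_(x in box a b) 'D_(delta_mx 0 j) G x.
Proof.
move=> ab.
have mb := @measurable_box R d a b.
have [M HM] := partials_bounded vC1 vsupp.
have dG x : derivable G x (delta_mx 0 j) by exact: C1_derivable_coord.
pose e : 'rV[R]_d := delta_mx 0 j.
pose h (n : nat) : R := n.+1%:R^-1.
pose f n x := n.+1%:R * (G (x + h n *: e) - G x).
have fM n x : `|f n x| <= M.
  rewrite normrM normr_nat -ler_pdivlMl//.
  rewrite (le_trans (partial_mvt dG (HM j j) _ _))//.
  by rewrite ger0_norm ?invr_ge0// mulrC.
have mf n : measurable_fun setT (f n : Rd R d -> R).
  apply: measurable_funM; first exact: measurable_cst.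
  apply: measurable_funB; last exact: mG.
  exact: measurableT_comp mG (measurable_translate (h n *: e)).
have flim x : f ^~ x @ \oo --> 'D_e G x.
  have E : (fun n => (h n)^-1 *: ((G \o shift x) (h n *: e) - G x)) = f ^~ x.
    by apply/funext => n; rewrite /f /h /= invrK [_ *: _ + x]addrC.
  rewrite -E; have /cvg_dnbhs_at_right/cvg_at_rightP := dG x; apply.
  by split; [move=> n; rewrite invr_gt0|exact: cvg_harmonic].
have iG A : measurable A -> (leb R d A < +oo)%E ->
    (leb R d).-integrable A (EFin \o (G : Rd R d -> R)).
  move=> mA Aoo; apply: (measurable_bounded_integrable mA Aoo).
    exact: measurable_funTS.
  exists 1; split; first exact: num_real.
  by move=> y y1 x _; exact: le_trans (G1 _) (ltW y1).
have iGt t : (leb R d).-integrable (box a b) (EFin \o (fun x => G (x + t))).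
  apply: (measurable_bounded_integrable mb (leb_box_lty _ _)).
    apply: measurable_funTS; exact: measurableT_comp mG (measurable_translate t).
  exists 1; split; first exact: num_real.
  by move=> y y1 x _; exact: le_trans (G1 _) (ltW y1).
have fint n : \int[leb R d]_(x in box a b) f n x =
    n.+1%:R * (\int[leb R d]_(x in box a b) G (x + h n *: e) -
               \int[leb R d]_(x in box a b) G x).
  rewrite RintegralZl//; last first.
    have := integrableB mb (iGt (h n *: e)) (iG _ mb (leb_box_lty _ _)).
    by apply: eq_integrable.
  by rewrite RintegralB//; exact: (iG _ mb (leb_box_lty _ _)).
apply: (@cvg_trans _ ((fun n => \int[leb R d]_(x in box a b) f n x) @ \oo)).
  apply: near_eq_cvg; near=> n.
  (* The increment must fit into the box for the box and its translate to share a middle part. *)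
  have hn : a 0 j + h n <= b 0 j.
    rewrite -lerBrDl; near: n.
    have ba : 0 < b 0 j - a 0 j by rewrite subr_gt0.
    have /cvgrPdist_le/(_ _ ba) := @cvg_harmonic R; apply: filterS => n.
    by rewrite sub0r normrN ger0_norm ?invr_ge0.
  have h0 : 0 <= h n by rewrite invr_ge0.
  rewrite fint (Rintegral_translate_box _ _ _ mG G1) /slab_flux -mulrBr.
  congr (_ * _).
  have trE (x : 'rV[R]_d) : x + h n *: e = set_coord x j (x 0 j + h n).
    apply/rowP => i; rewrite !mxE eqxx/=; case: eqP => [->|_].
      by rewrite mulr1.
    by rewrite mulr0 addr0.
  have idE (x : 'rV[R]_d) : set_coord x j (x 0 j) = x.
    by apply/rowP => i; rewrite !mxE; case: eqP => // ->.
  have twE (x : 'rV[R]_d) s t : set_coord (set_coord x j s) j t = set_coord x j t.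
    by apply/rowP => i; rewrite !mxE; case: eqP.
  have split3 (a' b' : 'rV[R]_d) c : a' 0 j <= c <= b' 0 j ->
      \int[leb R d]_(x in box a' b') G x =
      \int[leb R d]_(x in box a' (set_coord b' j c)) G x +
      \int[leb R d]_(x in box (set_coord a' j c) b') G x.
    move=> acb; rewrite (box_split acb) Rintegral_setU_null//.
    - exact: measurable_box.
    - exact: measurable_box.
    - rewrite -(box_split acb); apply: iG; [exact: measurable_box|exact: leb_box_lty].
    - exact: box_split_null.
  rewrite !trE idE (@split3 a b (a 0 j + h n)) ?hn ?andbT ?lerDl//.
  rewrite (@split3 _ _ (b 0 j)); last by rewrite !mxE !eqxx hn/= lerDl.
  by rewrite !twE idE -/h; ring.
apply: (cvg_Rintegral_dominated (g := fun=> M)) => //.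
- by move=> n; exact: measurable_funTS.
- apply: measurable_bounded_integrable => //; first exact: leb_box_lty.
  exists `|M|; split; first exact: num_real.
  by move=> y My x _; exact: ltW.
Unshelve. all: by end_near. Qed.

End flux.

(** * Variation against differences over halves of boxes *)

Section smooth_profiles.
Context (R : realType).
Implicit Types (f g : R -> R) (x y e : R).

Definition C1_with f f' := (forall x, is_derive x (1 : R) f (f' x)) /\ continuous f'.

Lemma C1_with_continuous f f' : C1_with f f' -> continuous f.
Proof.
by move=> [df _] x; apply/differentiable_continuous/derivable1_diffP; have [] := df x.
Qed.

Definition pos_part x : R := Num.max 0 x.
(** Squaring makes the positive part continuously differentiable; ramps, tents and plateaus are all
    built from it. *)
Definition pos_sqr x : R := pos_part x ^+ 2.

Lemma pos_part_ge0 x : 0 <= pos_part x.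
Proof. by rewrite le_max lexx. Qed.

Lemma pos_partE x : (pos_part x = x /\ 0 <= x) \/ (pos_part x = 0 /\ x <= 0).
Proof.
rewrite /pos_part; have [x0|x0] := leP 0 x; first by left.
by right; rewrite ltW.
Qed.

Lemma pos_partN x : x <= 0 -> pos_part x = 0.
Proof. by move=> x0; rewrite /pos_part max_l. Qed.

Lemma pos_partP x : 0 <= x -> pos_part x = x.
Proof. by move=> x0; rewrite /pos_part max_r. Qed.

Lemma continuous_pos_part : continuous pos_part.
Proof.
have E : pos_part = fun x => (x + `|x|) / 2.
  apply/funext => x; have [[-> x0]|[-> x0]] := pos_partE x.
    by rewrite ger0_norm//; field.
  by rewrite ler0_norm// subrr mul0r.
rewrite E => x; apply: cvgM; last exact: cvg_cst.
by apply: cvgD; [exact: cvg_id|exact: norm_continuous].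
Qed.

Lemma C1_with_pos_sqr : C1_with pos_sqr (fun x => 2 * pos_part x).
Proof.
split=> [x|]; last first.
  by move=> x; apply: cvgM; [exact: cvg_cst|exact: continuous_pos_part].
have H : (fun h : R => h^-1 *: ((pos_sqr \o shift x) (h *: 1) - pos_sqr x)) @ 0^'
    --> 2 * pos_part x.
  apply/cvgrPdist_le => /= e e0; near=> h.
  have h0 : h != 0 by near: h; exact: nbhs_dnbhs_neq.
  have he : `|h| <= e by near: h; exact: dnbhs0_le.
  rewrite -[h *: 1]/(h * 1) mulr1 -[_ *: _]/(h^-1 * _).
  have -> : 2 * pos_part x - h^-1 * (pos_sqr (h + x) - pos_sqr x) =
      - (h^-1 * (pos_sqr (h + x) - pos_sqr x - 2 * pos_part x * h)) by field.
  rewrite normrN normrM normfV ler_pdivrMl ?normr_gt0//.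
  (* The first-order remainder of [pos_sqr] is at most [h ^+ 2], by cases on the signs of [x] and
     [h + x]. *)
  apply: (@le_trans _ _ (h ^+ 2)).
    rewrite /pos_sqr; have := pos_partE x; have := pos_partE (h + x).
    by move=> [] [-> ?] [] [-> ?]; rewrite ler_norml; apply/andP; split; nra.
  by rewrite -[h ^+ 2]real_normK ?num_real// expr2 ler_wpM2l.
split; first by apply/cvg_ex; exists (2 * pos_part x).
exact: cvg_lim H.
Unshelve. all: by end_near. Qed.

Lemma eq_C1_with f f' g' : f' =1 g' -> C1_with f f' -> C1_with f g'.
Proof. by move=> /funext ->. Qed.

Lemma C1_with_cst (c : R) : C1_with (fun=> c) (fun=> 0).
Proof. by split=> [x|x]; [exact: is_derive_cst|exact: cvg_cst]. Qed.

Lemma C1_with_id : C1_with id (fun=> 1).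
Proof. by split=> [x|x]; [exact: is_derive_id|exact: cvg_cst]. Qed.

Lemma C1_withD f f' g g' : C1_with f f' -> C1_with g g' ->
  C1_with (fun x => f x + g x) (fun x => f' x + g' x).
Proof.
move=> [df cf] [dg cg]; split=> x; first exact: is_deriveD.
by apply: cvgD; [exact: cf|exact: cg].
Qed.

Lemma C1_withN f f' : C1_with f f' -> C1_with (fun x => - f x) (fun x => - f' x).
Proof.
move=> [df cf]; split=> x; first exact: is_deriveN.
by apply: cvgN; exact: cf.
Qed.

Lemma C1_withM f f' g g' : C1_with f f' -> C1_with g g' ->
  C1_with (fun x => f x * g x) (fun x => f x * g' x + g x * f' x).
Proof.
move=> fC gC; have [df cf] := fC; have [dg cg] := gC; split=> x.
  exact: is_deriveM.
by apply: cvgD; apply: cvgM => //;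
  [exact: (C1_with_continuous fC)|exact: cg|exact: (C1_with_continuous gC)|exact: cf].
Qed.

Lemma C1_with_comp f f' g g' : C1_with f f' -> C1_with g g' ->
  C1_with (fun x => f (g x)) (fun x => f' (g x) * g' x).
Proof.
move=> [df cf] gC; have [dg cg] := gC; split=> x.
  have H := is_derive1_comp (df (g x)) (dg x).
  exact: H.
apply: cvgM; last exact: cg.
by apply: continuous_comp; [exact: C1_with_continuous gC x|exact: cf].
Qed.

Lemma C1_withV f f' : (forall x, f x != 0) -> C1_with f f' ->
  C1_with (fun x => (f x)^-1) (fun x => - (f x) ^- 2 * f' x).
Proof.
move=> f0 fC; have [df cf] := fC; have cf0 := C1_with_continuous fC; split=> x.
  exact: is_deriveV.
apply: cvgM; last exact: cf.
apply: cvgN; apply: cvgV; first by rewrite expf_neq0.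
by apply: (cvg_comp f (fun y => y ^+ 2)); [exact: cf0|exact: exprn_continuous].
Qed.

(** [ramp e] and its derivative [ramp' e] approximate the positive part and
    the indicator of the positive reals. *)
Definition ramp e x := (2 * e)^-1 * (pos_sqr x - pos_sqr (x - e)).
Definition ramp' e x := (2 * e)^-1 * (2 * pos_part x - 2 * pos_part (x - e)).

Lemma C1_with_ramp e : C1_with (ramp e) (ramp' e).
Proof.
have Hs : C1_with (fun x => x - e) (fun=> 1 + 0).
  exact: C1_withD C1_with_id (C1_with_cst _).
have H := C1_withD C1_with_pos_sqr (C1_withN (C1_with_comp C1_with_pos_sqr Hs)).
apply: eq_C1_with (C1_withM (C1_with_cst (2 * e)^-1) H) => x.
by rewrite /ramp' mulr0 !addr0 mulr1.
Qed.

Lemma ramp_bound e x : 0 < e -> pos_part x - e <= ramp e x <= pos_part x.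
Proof.
move=> e0; rewrite /ramp ler_pdivlMl ?ler_pdivrMl ?mulr_gt0// /pos_sqr.
have := pos_partE x; have := pos_partE (x - e).
by move=> [] [-> ?] [] [-> ?]; apply/andP; split; nra.
Qed.

Lemma ramp'_bound e x : 0 < e -> 0 <= ramp' e x <= 1.
Proof.
move=> e0; rewrite /ramp' ler_pdivlMl ?ler_pdivrMl ?mulr_gt0//.
have := pos_partE x; have := pos_partE (x - e).
by move=> [] [-> ?] [] [-> ?]; apply/andP; split; lra.
Qed.

Lemma ramp_le0 e x : 0 < e -> x <= 0 -> ramp e x = 0.
Proof.
by move=> e0 x0; rewrite /ramp /pos_sqr !pos_partN ?subrr ?mulr0//; lra.
Qed.

Lemma ramp'_le0 e x : 0 < e -> x <= 0 -> ramp' e x = 0.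
Proof.
by move=> e0 x0; rewrite /ramp' !pos_partN ?subrr ?mulr0 ?subrr ?mulr0//; lra.
Qed.

Lemma ramp'_ge e x : 0 < e -> e <= x -> ramp' e x = 1.
Proof.
move=> e0 ex; rewrite /ramp' !pos_partP; try lra.
have := lt0r_neq0 e0 => ?; by field.
Qed.

(** The tent of height and half-width [l] centred at the origin; the shift by
    [e] keeps the support of the approximation in [-l, l]. *)
Definition tent l e x := ramp e (l - e - e - ramp e x - ramp e (- x)).
Definition tent' l e x := ramp' e (l - e - e - ramp e x - ramp e (- x)) *
  (ramp' e (- x) - ramp' e x).

Lemma C1_with_tent l e : C1_with (tent l e) (tent' l e).
Proof.
have HN : C1_with (fun x : R => - x) (fun=> - 1) := C1_withN C1_with_id.
have H := C1_withD (C1_withD (C1_with_cst (l - e - e)) (C1_withN (C1_with_ramp e)))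
  (C1_withN (C1_with_comp (C1_with_ramp e) HN)).
apply: eq_C1_with (C1_with_comp (C1_with_ramp e) H) => x.
by rewrite /tent' add0r mulrN1 opprK [- _ + _]addrC.
Qed.

(** Each of the two ramps may fall short of the positive part by [e]; the two [e] subtracted from
    [l] make up for it, as the positive parts of [x] and [- x] add up to the absolute value. *)
Lemma tent_inner_le l e x : 0 < e ->
  l - e - e - ramp e x - ramp e (- x) <= l - `|x|.
Proof.
move=> e0; have /andP[p _] := ramp_bound x e0.
have /andP[q _] := ramp_bound (- x) e0.
have [x0|x0] := leP 0 x.
  rewrite ger0_norm//; move: p q; rewrite (pos_partP x0) (@pos_partN (- x)) ?oppr_le0//.
  lra.
rewrite ltr0_norm//; move: p q; rewrite (pos_partN (ltW x0)) (@pos_partP (- x)); lra.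
Qed.

Lemma tent_support l e x : 0 < e -> l <= `|x| -> tent l e x = 0 /\ tent' l e x = 0.
Proof.
move=> e0 lx; have H : l - e - e - ramp e x - ramp e (- x) <= 0.
  by rewrite (le_trans (tent_inner_le _ _ e0))// subr_le0.
by rewrite /tent /tent' ramp_le0// ramp'_le0// mul0r.
Qed.

Lemma tent_bound l e x : 0 < e -> 0 <= l -> `|tent l e x| <= l.
Proof.
move=> e0 l0; set y := l - e - e - ramp e x - ramp e (- x).
have yl : y <= l by rewrite (le_trans (tent_inner_le _ _ e0))// gerBl.
rewrite /tent -/y; have [y0|y0] := leP y 0; first by rewrite ramp_le0// normr0.
have /andP[_] := ramp_bound y e0; rewrite (pos_partP (ltW y0)) => H.
rewrite ger0_norm; first exact: le_trans H yl.
apply: mulr_ge0; first by rewrite invr_ge0 mulr_ge0// ltW.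
rewrite subr_ge0 /pos_sqr ler_sqr ?nnegrE ?pos_part_ge0//.
by have := pos_partE y; have := pos_partE (y - e); move=> [] [-> ?] [] [-> ?]; lra.
Qed.

Lemma tent'_bound l e x : 0 < e -> `|tent' l e x| <= 1.
Proof.
move=> e0; rewrite normrM; set y := l - e - e - ramp e x - ramp e (- x).
have /andP[y0 y1] := ramp'_bound y e0.
have /andP[p0 p1] := ramp'_bound x e0.
have /andP[q0 q1] := ramp'_bound (- x) e0.
rewrite -[leRHS]mulr1 ler_pM// ler_norml; apply/andP; split; lra.
Qed.

(** Of the margin [3 * e], two are subtracted from [l] inside the tent and one lets the outer ramp
    reach slope 1. *)
Lemma tent'_pos l e x : 0 < e -> e <= x -> x + 3 * e <= l -> tent' l e x = -1.
Proof.
move=> e0 ex xl; have x0 : 0 <= x by exact: le_trans (ltW e0) ex.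
have /andP[_] := ramp_bound x e0; rewrite (pos_partP x0) => rx.
have xN : - x <= 0 by rewrite oppr_le0.
rewrite /tent' (ramp_le0 e0 xN) (ramp'_le0 e0 xN) (ramp'_ge e0 ex) ramp'_ge//; lra.
Qed.

Lemma tent'N l e x : tent' l e (- x) = - tent' l e x.
Proof. rewrite /tent'.
have -> : l - e - e - ramp e (- x) - ramp e (- - x) =
  l - e - e - ramp e x - ramp e (- x) by rewrite opprK; ring.
by rewrite opprK -[ramp' e (- x) - _]opprB mulrN opprK.
Qed.

Lemma cvg_tent' l x : (fun n : nat => tent' l n.+1%:R^-1 x) @ \oo -->
  (if `|x| < l then - Num.sg x else 0).
Proof.
have pos y : 0 < y -> y < l -> (fun n : nat => tent' l n.+1%:R^-1 y) @ \oo --> (- 1 : R).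
  move=> y0 yl; apply: (@cvg_trans _ ((fun=> -1) @ \oo)); last exact: cvg_cst.
  apply: near_eq_cvg; near=> n; apply/esym/tent'_pos; first by rewrite invr_gt0.
    near: n; have /cvgrPdist_le/(_ _ y0) := @cvg_harmonic R; apply: filterS => n.
    by rewrite sub0r normrN ger0_norm ?invr_ge0.
  rewrite -lerBrDl -ler_pdivlMl//; near: n.
  have ly : 0 < 3^-1 * (l - y) by rewrite mulr_gt0// subr_gt0.
  have /cvgrPdist_le/(_ _ ly) := @cvg_harmonic R; apply: filterS => n.
  by rewrite sub0r normrN ger0_norm ?invr_ge0.
case: ifPn => [xl|]; last first.
  rewrite -leNgt => lx; rewrite (_ : (fun n => _) = fun=> 0); first exact: cvg_cst.
  by apply/funext => n; have [] := @tent_support l n.+1%:R^-1 x _ lx; rewrite ?invr_gt0.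
have [x0|x0|x0] := ltgtP x 0.
- rewrite ltr0_sg// (_ : (fun n => _) = fun n => - tent' l n.+1%:R^-1 (- x)).
    by apply: cvgN; apply: pos; [rewrite oppr_gt0|rewrite -ltr0_norm].
  by apply/funext => n; rewrite tent'N opprK.
- by rewrite gtr0_sg//; apply: pos => //; rewrite -(gtr0_norm x0).
- rewrite x0 sgr0 oppr0 (_ : (fun n => _) = fun=> 0); first exact: cvg_cst.
  by apply/funext => n; rewrite /tent' oppr0 subrr mulr0.
Unshelve. all: by end_near. Qed.

(** Approximates the indicator of the open interval from inside: for [a <= b] the factor of [n%:R]
    is positive exactly there, so the values tend to 1 inside while they stay 0 outside. *)
Definition plateau (a b : R) (n : nat) x : R :=
  1 - (1 + n%:R * pos_sqr ((x - a) * (b - x)))^-1.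

Lemma plateau_den_gt0 a b n x : 0 < 1 + n%:R * pos_sqr ((x - a) * (b - x)).
Proof. by rewrite ltr_wpDr// mulr_ge0// sqr_ge0. Qed.

Lemma C1_with_plateau a b n : exists f', C1_with (plateau a b n) f'.
Proof.
have Ha : C1_with (fun x => x - a) (fun=> 1 + 0).
  exact: C1_withD C1_with_id (C1_with_cst _).
have Hb : C1_with (fun x => b - x) (fun=> 0 + - 1).
  by apply: C1_withD (C1_with_cst _) (C1_withN C1_with_id).
have H := C1_withD (C1_with_cst 1) (C1_withM (C1_with_cst n%:R)
  (C1_with_comp C1_with_pos_sqr (C1_withM Ha Hb))).
eexists; apply: C1_withD (C1_with_cst 1) (C1_withN (C1_withV _ H)).
by move=> x; rewrite gt_eqF// plateau_den_gt0.
Qed.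

Lemma plateau_bound a b n x : 0 <= plateau a b n x <= 1.
Proof.
have H := plateau_den_gt0 a b n x.
rewrite /plateau subr_ge0 gerBl invr_ge0 (ltW H) andbT invf_le1//.
by rewrite lerDl mulr_ge0// sqr_ge0.
Qed.

Lemma plateau_support a b n x : a <= b -> ~~ (a < x < b) -> plateau a b n x = 0.
Proof.
move=> ab; rewrite negb_and -!leNgt => xab.
rewrite /plateau /pos_sqr pos_partN ?expr0n ?mulr0 ?addr0 ?invr1 ?subrr//.
by case/orP: xab => ?; [apply: mulr_le0_ge0|apply: mulr_ge0_le0]; lra.
Qed.

Lemma cvg_plateau a b x : a <= b ->
  (fun n => plateau a b n x) @ \oo --> ((a < x < b)%R%:R : R).
Proof.
move=> ab; case: (boolP (a < x < b)) => xab; last first.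
  rewrite (_ : (fun n => _) = fun=> 0); first exact: cvg_cst.
  by apply/funext => n; rewrite plateau_support.
rewrite /plateau; set s := pos_sqr _.
have s0 : 0 < s.
  rewrite /s /pos_sqr pos_partP ?exprn_gt0//; first by nra.
  by case/andP: xab => ? ?; nra.
rewrite -[X in _ --> X]subr0; apply: cvgB; first exact: cvg_cst.
apply/cvgrPdist_le => e e0; near=> n.
have ns0 : 0 <= n%:R * s := mulr_ge0 (ler0n _ _) (ltW s0).
have D0 : 0 < 1 + n%:R * s by rewrite ltr_wpDr.
rewrite sub0r normrN ger0_norm ?invr_ge0 ?(ltW D0)//.
rewrite invf_ple ?posrE//.
have : e^-1 / s <= n%:R by near: n; exact: nbhs_infty_ger.
rewrite ler_pdivrMr// => /le_trans; apply. by rewrite lerDr ler01.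
Unshelve. all: by end_near. Qed.

End smooth_profiles.

(** * Fields with one component, a sum of products of profiles *)

Section product_fields.
Context (R : realType) (d : nat).
Implicit Types (x : 'rV[R]_d) (i j : 'I_d).

Lemma is_derive_prod_coord (psi psi' : 'I_d -> R -> R) i x :
  (forall l, C1_with (psi l) (psi' l)) ->
  is_derive x (delta_mx 0 i) (fun x => \prod_l psi l (x 0 l))
    (psi' i (x 0 i) * \prod_(l | l != i) psi l (x 0 l)).
Proof.
move=> psiC; have [dpsi _] := psiC i.
have H : (fun h : R => h^-1 *: (((fun x => \prod_l psi l (x 0 l)) \o shift x)
    (h *: delta_mx 0 i) - \prod_l psi l (x 0 l))) @ 0^' -->
    psi' i (x 0 i) * \prod_(l | l != i) psi l (x 0 l).
  have [di <-] := dpsi (x 0 i).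
  rewrite (_ : (fun h => _) = fun h : R => h^-1 *: ((psi i \o shift (x 0 i)) (h *: 1)
      - psi i (x 0 i)) * \prod_(l | l != i) psi l (x 0 l)).
    by apply: cvgM; [exact: di|exact: cvg_cst].
  apply/funext => h /=; rewrite -[h *: 1]/(h * 1) mulr1.
  rewrite -[X in _ = X * _]/(h^-1 * _) -mulrA -[LHS]/(h^-1 * _); congr (_ * _).
  rewrite !(bigD1 (P := predT) i)//= mulrBl !mxE !eqxx mulr1; congr (_ * _ - _).
  by apply: eq_bigr => l /negbTE li; rewrite !mxE li andbF mulr0 add0r.
split; first by apply/cvg_ex; eexists; exact: H.
exact: cvg_lim H.
Qed.

Lemma continuous_prod_coord (psi : 'I_d -> R -> R) (P : pred 'I_d) :
  (forall l, continuous (psi l)) ->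
  continuous (fun x : 'rV[R]_d => \prod_(l | P l) psi l (x 0 l)).
Proof.
move=> cpsi; elim: (index_enum _) => [|l s IH].
  under eq_fun do rewrite big_nil; exact: cst_continuous.
under eq_fun do rewrite big_cons.
case: (P l) => // x.
apply: (@cvgM _ _ _ (nbhs_filter x)); last exact: IH.
by apply: continuous_comp; [exact: coord_continuous|exact: cpsi].
Qed.

Lemma product_field_C1 (I : Type) (s : seq I) (c : I -> R)
    (psi psi' : I -> 'I_d -> R -> R) j :
  (forall q l, C1_with (psi q l) (psi' q l)) ->
  let v x : 'rV[R]_d :=
    (\sum_(q <- s) c q * \prod_l psi q l (x 0 l)) *: delta_mx 0 j in
  C1 v /\ forall x, divergence v x =
    \sum_(q <- s) c q * (psi' q j (x 0 j) * \prod_(l | l != j) psi q l (x 0 l)).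
Proof.
move=> psiC v.
have dv i x : is_derive x (delta_mx 0 i)
    (fun x : 'rV[R]_d => \sum_(q <- s) c q * \prod_l psi q l (x 0 l))
    (\sum_(q <- s) c q * (psi' q i (x 0 i) * \prod_(l | l != i) psi q l (x 0 l))).
  elim: s {v} => [|q s IH].
    under eq_fun do rewrite big_nil.
    by rewrite big_nil; exact: is_derive_cst.
  under eq_fun do rewrite big_cons.
  rewrite big_cons; apply: is_deriveD.
  exact: is_deriveZ (is_derive_prod_coord _ _ _).
have dv' i x : is_derive x (delta_mx 0 i) v
   ((\sum_(q <- s) c q * (psi' q i (x 0 i) * \prod_(l | l != i) psi q l (x 0 l)))
     *: delta_mx 0 j).
  have [d1 e1] := dv i x.
  have dvi : derivable v x (delta_mx 0 i).
    apply/derivable_mxP => k l; rewrite (_ : (fun x => _) =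
      (fun x => (\sum_(q <- s) c q * \prod_l psi q l (x 0 l)) * delta_mx 0 j k l)).
      by apply: derivableM; [exact: d1|exact: derivable_cst].
    by apply/funext => y; rewrite mxE.
  split => //; rewrite derive_mx//; apply/matrixP => k l; rewrite !mxE.
  rewrite (_ : (fun x => _) =
      (fun x => delta_mx 0 j k l *: (\sum_(q <- s) c q * \prod_l psi q l (x 0 l)))).
    by rewrite deriveZ// e1 mulrC !mxE.
  by apply/funext => y; rewrite mxE mulrC.
split.
  move=> i; split => [x|]; first by have [] := dv' i x.
  rewrite (_ : 'D_(delta_mx 0 i) v = fun x => (\sum_(q <- s) c q *
    (psi' q i (x 0 i) * \prod_(l | l != i) psi q l (x 0 l))) *: delta_mx 0 j).
    move=> x; apply: (@cvgZl _ 'rV[R]_d _ _ (nbhs_filter x)).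
    apply: (cvg_sum_seq (nbhs_filter x)) => q.
    apply: (@cvgM _ _ _ (nbhs_filter x)); first exact: (@cst_continuous 'rV[R]_d R _ x).
    apply: (@cvgM _ _ _ (nbhs_filter x)).
      by apply: continuous_comp; [exact: coord_continuous|have [_] := psiC q i; apply].
    apply: continuous_prod_coord => l; exact: C1_with_continuous (psiC q l).
  by apply/funext => x; have [] := dv' i x.
move=> x; rewrite /divergence (bigD1 j)//= [X in _ + X]big1 ?addr0.
  by have [_ ->] := dv' j x; rewrite !mxE !eqxx mulr1.
by move=> i ij; have [_ ->] := dv' i x; rewrite !mxE (negbTE ij) mulr0.
Qed.

Lemma enorm_delta (a : R) j : enorm (a *: delta_mx 0 j : 'rV[R]_d) = `|a|.
Proof.
rewrite /enorm (bigD1 j)//= big1 ?addr0 => [|i ij].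
  by rewrite !mxE !eqxx mulr1 sqrtr_sqr.
by rewrite !mxE (negbTE ij) mulr0 expr0n.
Qed.

Lemma compactly_supported_boxes (I : Type) (s : seq I) (a b : I -> 'rV[R]_d)
    (v : 'rV[R]_d -> 'rV[R]_d) :
  (forall x, \sum_(q <- s) \1_(open_box (a q) (b q)) x = 0 :> R -> v x = 0) ->
  compactly_supported v.
Proof.
move=> v0; have vs x : v x != 0 -> \sum_(q <- s) \1_(open_box (a q) (b q)) x != 0 :> R.
  by apply: contra_neq => /v0.
pose M := \sum_(q <- s) (`|a q| + `|b q|).
have cK : compact [set x : 'rV[R]_d | forall i, `[- M, M]%classic (x 0 i)].
  by apply: (@rV_compact _ _ (fun=> `[- M, M]%classic)) => _; exact: segment_compact.
have clK := compact_closed (@norm_hausdorff _ _) cK.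
apply: subclosed_compact cK _; first exact: closed_closure.
rewrite [X in _ `<=` X](closure_id _).1//; apply: closure_subset => x /= /vs.
rewrite /M; elim: s {vs clK v0 M} => [|q s IH]; first by rewrite big_nil eqxx.
rewrite big_cons big_cons; set M := \sum_(q <- s) (`|a q| + `|b q|).
have M0 : 0 <= M by apply: sumr_ge0 => ? _; rewrite addr_ge0.
have ab0 : 0 <= `|a q| + `|b q| by rewrite addr_ge0.
have [xq|xq] := pselect (open_box (a q) (b q) x).
  move=> _ i; rewrite in_itv/=; have /andP[ax xb] := xq i.
  have := normr_coord_le (a q) i; have := normr_coord_le (b q) i.
  have := ler_norm (b q 0 i); have := ler_norm (- a q 0 i); rewrite normrN.
  have := normr_ge0 (a q); have := normr_ge0 (b q).
  by move=> *; apply/andP; split; lra.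
rewrite indicE memNset// add0r => /IH H i; have := H i; rewrite -/M !in_itv/=.
by move=> /andP[? ?]; apply/andP; split; lra.
Qed.

End product_fields.

Section box_boundary.
Context (R : realType) (d : nat).
Implicit Types (a b : 'rV[R]_d).

(** The boundary lies in the faces, which are boxes with one side of length 0. *)
Lemma leb_box_boundary a b : leb R d (box a b `\` open_box a b) = 0%E.
Proof.
pose F i : set (Rd R d) :=
  box a (set_coord b i (a 0 i)) `|` box (set_coord a i (b 0 i)) b.
have F0 i : leb R d (F i) = 0%E.
  rewrite measureU0; try exact: measurable_box.
    by apply: (@leb_box_degenerate _ _ _ _ i); rewrite mxE eqxx.
  by apply: (@leb_box_degenerate _ _ _ _ i); rewrite mxE eqxx.
have mF i : measurable (F i) by apply: measurableU; exact: measurable_box.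
have FU (s : seq 'I_d) : measurable (\big[setU/set0]_(i <- s) F i) /\
    leb R d (\big[setU/set0]_(i <- s) F i) = 0%E.
  elim: s => [|i s [mU U0]]; first by rewrite big_nil measure0.
  rewrite big_cons; split; first exact: measurableU.
  rewrite -[RHS](F0 i). exact: (measureU0 (mF i) mU U0).
have [mU U0] := FU (enum 'I_d).
apply/eqP; rewrite -measure_le0 -U0; apply: le_measure; rewrite ?inE//.
  by apply: measurableD; [exact: measurable_box|exact: measurable_open_box].
move=> x [abx /existsNP[i /negP]]; rewrite negb_and -!leNgt => h.
rewrite -bigcup_seq; exists i; first by rewrite /= mem_enum.
case/orP: h => h; [left|right] => l; rewrite mxE; case: eqP => // ->.
- by have /andP[-> _] := abx i.
- by have /andP[_ ->] := abx i; rewrite h.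
Qed.

Lemma Rintegral_open_box a b (u : Rd R d -> R) :
  (leb R d).-integrable setT (EFin \o u) ->
  \int[leb R d]_(x in open_box a b) u x = \int[leb R d]_(x in box a b) u x.
Proof.
move=> iu; have mo := @measurable_open_box R d a b.
have mD : measurable (box a b `\` open_box a b : set (Rd R d)).
  by apply: measurableD; [exact: measurable_box|].
have E : box a b = open_box a b `|` (box a b `\` open_box a b).
  apply/seteqP; split => x; last first.
    by case=> [abx i|[]//]; have /andP[/ltW-> /ltW->] := abx i.
  by move=> abx; have [?|?] := pselect (open_box a b x); [left|right].
rewrite [in RHS]E Rintegral_setU_null//.
- rewrite [X in _ + X](Rintegral_null mD (leb_box_boundary a b)) ?addr0//.
  by apply/measurable_EFinP; apply: (measurable_int (leb R d));
    apply: integrableS iu.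
- by apply: integrableS iu => //; exact: measurableU.
- by rewrite setDE setICA -setDE setDv setI0 measure0.
Qed.

End box_boundary.

Section pair_estimate.
Context (R : realType) (d : nat).

(** Testing the variation against (smooth approximations of) the field
    [\sum_q c q * tent (x_j) * \prod_(i != j) 1_(x_i) e_j], whose divergence is
    [c q] on the lower halves of the boxes and [- c q] on the upper halves. *)
Let pair_estimate_le (I : Type) (s : seq I) (a b : I -> 'rV[R]_d) (j : 'I_d)
    (c : I -> R) (S l : R) (u : Rd R d -> R)
    (mid := fun q => (a q 0 j + b q 0 j) / 2) :
  (leb R d).-integrable setT (EFin \o u) -> (variation u < +oo)%E ->
  0 < S -> 0 < l ->
  (forall q i, a q 0 i < b q 0 i) -> (forall q, b q 0 j - a q 0 j <= 2 * l) ->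
  (forall q, `|c q| <= S) ->
  (forall x, \sum_(q <- s) \1_(open_box (a q) (b q)) x <= 1 :> R) ->
  \sum_(q <- s) c q *
    (\int[leb R d]_(x in box (a q) (set_coord (b q) j (mid q))) u x -
     \int[leb R d]_(x in box (set_coord (a q) j (mid q)) (b q)) u x)
  <= S * l * fine (variation u).
Proof.
move=> iu uoo S0 l0 ab bal cS disj.
pose hw q := (b q 0 j - a q 0 j) / 2.
have hw0 q : 0 < hw q by rewrite divr_gt0// subr_gt0.
have hwl q : hw q <= l by rewrite ler_pdivrMr// mulrC.
(* The profiles of the field: a tent in the direction [j], plateaus in the others. The divergence
   differentiates in the direction [j] alone, so only the derivative of the tent has to be
   explicit. *)
have H n : exists psi, exists psi' : I -> 'I_d -> R -> R,
    (forall q i, C1_with (psi q i) (psi' q i)) /\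
    (forall q i, psi q i = if i == j then fun t => tent (hw q) n.+1%:R^-1 (t - mid q)
       else plateau (a q 0 i) (b q 0 i) n) /\
    (forall q, psi' q j = fun t => tent' (hw q) n.+1%:R^-1 (t - mid q)).
  suff /choice[psi' Hp] : forall p : I * 'I_d, exists f' : R -> R,
      C1_with (if p.2 == j then fun t => tent (hw p.1) n.+1%:R^-1 (t - mid p.1)
       else plateau (a p.1 0 p.2) (b p.1 0 p.2) n) f' /\
      (p.2 = j -> f' = fun t => tent' (hw p.1) n.+1%:R^-1 (t - mid p.1)).
    exists (fun q i => if i == j then fun t => tent (hw q) n.+1%:R^-1 (t - mid q)
       else plateau (a q 0 i) (b q 0 i) n), (fun q i => psi' (q, i)).
    split=> [q i|]; first by have [] := Hp (q, i).
    by split => // q; have [_] := Hp (q, j); apply.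
  move=> [q i] /=; have [->|ij] := eqVneq i j.
    eexists; split; last by move=> _; reflexivity.
    have Ht : C1_with (fun t => t - mid q) (fun=> 1 + 0).
      exact: C1_withD (C1_with_id _) (C1_with_cst _).
    apply: eq_C1_with (C1_with_comp (C1_with_tent (hw q) n.+1%:R^-1) Ht) => t.
    by rewrite addr0 mulr1.
  have [f' fC] := C1_with_plateau (a q 0 i) (b q 0 i) n.
  by exists f'; split => // ij'; rewrite ij' eqxx in ij.
have out q n (x : 'rV[R]_d) : ~ open_box (a q) (b q) x ->
    (tent (hw q) n.+1%:R^-1 (x 0 j - mid q) = 0 /\
     tent' (hw q) n.+1%:R^-1 (x 0 j - mid q) = 0) \/
    exists2 i, i != j & plateau (a q 0 i) (b q 0 i) n (x 0 i) = 0.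
  move=> /existsNP[i /negP abx]; have [ij|ij] := eqVneq i j; last first.
    by right; exists i => //; exact: plateau_support (ltW (ab q i)) abx.
  left; apply: tent_support; first by rewrite invr_gt0.
  move: abx; rewrite ij negb_and -!leNgt /hw /mid.
  have := ab q j => abj; case/orP => xab.
    rewrite ler0_norm; lra.
  rewrite ger0_norm; lra.
pose w q n (x : 'rV[R]_d) := tent' (hw q) n.+1%:R^-1 (x 0 j - mid q) *
   \prod_(i | i != j) plateau (a q 0 i) (b q 0 i) n (x 0 i).
have step n : \int[leb R d]_x (u x * \sum_(q <- s) c q * w q n x) <=
    S * l * fine (variation u).
  have [psi [psi' [psiC [psiE psi'E]]]] := H n.
  have prodE q (x : 'rV[R]_d) : \prod_i psi q i (x 0 i) =
      tent (hw q) n.+1%:R^-1 (x 0 j - mid q) *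
      \prod_(i | i != j) plateau (a q 0 i) (b q 0 i) n (x 0 i).
    rewrite (bigD1 j)//= psiE eqxx; congr (_ * _).
    by apply: eq_bigr => i /negbTE ij; rewrite psiE ij.
  have prod0 q (x : 'rV[R]_d) : ~ open_box (a q) (b q) x -> \prod_i psi q i (x 0 i) = 0.
    move=> /(out _ n); rewrite prodE => -[[-> _]|[i ij pi0]]; first by rewrite mul0r.
    by rewrite [X in _ * X](bigD1 i)//= pi0 mul0r mulr0.
  have prodl q (x : 'rV[R]_d) : `|\prod_i psi q i (x 0 i)| <= l * \1_(open_box (a q) (b q)) x.
    have [xq|xq] := pselect (open_box (a q) (b q) x); last first.
      by rewrite prod0// normr0 mulr_ge0// ltW.
    rewrite indicE mem_set// mulr1 prodE normrM -[leRHS]mulr1 ler_pM//.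
      apply: le_trans (hwl q); apply: tent_bound; first by rewrite invr_gt0.
      exact: ltW.
    have pl i := plateau_bound (a q 0 i) (b q 0 i) n (x 0 i).
    by rewrite ger0_norm ?prodr_ge0 ?prodr_ile1// => i _; have /andP[] := pl i.
  (* Coefficients are at most [S], tents at most their half-width and so at most [l], plateaus at
     most 1. The sum of indicators is then at most 1 by [disj]. *)
  have sl (x : 'rV[R]_d) : `|\sum_(q <- s) c q * \prod_l psi q l (x 0 l)| <=
      S * l * \sum_(q <- s) \1_(open_box (a q) (b q)) x.
    rewrite (le_trans (ler_norm_sum _ _ _))// mulr_sumr; apply: ler_sum => q _.
    by rewrite normrM -mulrA ler_pM.
  have [vC1 vdiv] := product_field_C1 s c j psiC.
  rewrite (@eq_Rintegral _ _ _ _ _ (fun x => u x * divergence (fun x : 'rV[R]_d =>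
    (\sum_(q <- s) c q * \prod_l psi q l (x 0 l)) *: delta_mx 0 j) x)); last first.
    move=> x _; rewrite vdiv; congr (_ * _); apply: eq_bigr => q _; congr (_ * _).
    rewrite psi'E; congr (_ * _).
    by apply: eq_bigr => i /negbTE ij; rewrite psiE ij.
  apply: variation_test => //.
  - by rewrite mulr_gt0.
  - apply: (@compactly_supported_boxes _ _ I s a b) => x sum0.
    suff -> : \sum_(q <- s) c q * \prod_l psi q l (x 0 l) = 0 by rewrite scale0r.
    by apply/eqP; rewrite -normr_le0 (le_trans (sl x))// sum0 mulr0.
  - move=> x; rewrite enorm_delta (le_trans (sl x))// ler_piMr//.
    by rewrite mulr_ge0// ltW.
pose lw q : set (Rd R d) := open_box (a q) (set_coord (b q) j (mid q)).
pose up q : set (Rd R d) := open_box (set_coord (a q) j (mid q)) (b q).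
have wlim q (x : 'rV[R]_d) : (fun n => w q n x) @ \oo --> (\1_(lw q) x - \1_(up q) x : R).
  rewrite (_ : _ - _ = (if `|x 0 j - mid q| < hw q then - Num.sg (x 0 j - mid q)
    else 0) * \prod_(i | i != j) (a q 0 i < x 0 i < b q 0 i)%R%:R).
    apply: cvgM; first exact: cvg_tent'.
    by apply: cvg_prod_seq => i; apply: cvg_plateau; exact: ltW.
  rewrite !indicE.
  have [Hin|/existsNP[i /not_implyP[ij /negP xi]]] :=
      pselect (forall i, i != j -> a q 0 i < x 0 i < b q 0 i); last first.
    rewrite [X in _ * X](bigD1 i)//= (negbTE xi) mul0r mulr0.
    rewrite !memNset ?subrr// => /(_ i); rewrite mxE (negbTE ij).
      by rewrite (negbTE xi).
    by rewrite (negbTE xi).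
  rewrite big1 ?mulr1 => [|i ij]; last by rewrite Hin.
  have lwE : (x \in lw q) = (a q 0 j < x 0 j < mid q).
    apply/idP/idP => [/set_mem/(_ j)|h]; first by rewrite mxE eqxx.
    by apply/mem_set => i; rewrite mxE; have [->//|ij] := eqVneq i j; exact: Hin.
  have upE : (x \in up q) = (mid q < x 0 j < b q 0 j).
    apply/idP/idP => [/set_mem/(_ j)|h]; first by rewrite mxE eqxx.
    by apply/mem_set => i; rewrite mxE; have [->//|ij] := eqVneq i j; exact: Hin.
  rewrite lwE upE; have abj := ab q j; have hwE : hw q = mid q - a q 0 j.
    by rewrite /hw /mid; field.
  have hwE' : hw q = b q 0 j - mid q by rewrite /hw /mid; field.
  have [xm|xm|xm] := ltgtP (x 0 j) (mid q).
  - rewrite andbT ltr0_norm ?subr_lt0// ltr0_sg ?subr_lt0// opprK.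
    rewrite opprB hwE ltrD2l ltrN2 subr0.
    by case: ifP.
  - rewrite andbF sub0r gtr0_norm ?subr_gt0// gtr0_sg ?subr_gt0// hwE' ltrD2r.
    by case: ifP => //=; rewrite oppr0.
  - by rewrite andbF xm !subrr normr0 hw0 sgr0 oppr0.
have wb q n (x : 'rV[R]_d) : `|w q n x| <= 1.
  rewrite normrM -[leRHS]mulr1 ler_pM//; first by apply: tent'_bound; rewrite invr_gt0.
  have pl i := plateau_bound (a q 0 i) (b q 0 i) n (x 0 i).
  by rewrite ger0_norm ?prodr_ge0 ?prodr_ile1// => i _; have /andP[] := pl i.
have ilim : (fun n => \int[leb R d]_x (u x * \sum_(q <- s) c q * w q n x)) @ \oo -->
    \int[leb R d]_x (u x * \sum_(q <- s) c q * (\1_(lw q) x - \1_(up q) x)).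
  (* [u] is only known to be integrable, so it stays in the dominating function; the factors [w q n]
     are bounded by 1 uniformly in [n]. *)
  apply: (cvg_Rintegral_dominated (g := fun x => `|u x| * \sum_(q <- s) S)).
  - exact: measurableT.
  - move=> n; apply: measurable_funM.
      by apply/measurable_EFinP; exact: measurable_int iu.
    apply: continuous_measurable_Rd => x; apply: (cvg_sum_seq (nbhs_filter x)) => q.
    apply: (@cvgM _ _ _ (nbhs_filter x)); first exact: (@cst_continuous 'rV[R]_d R _ x).
    apply: (@cvgM _ _ _ (nbhs_filter x)).
      apply: (@continuous_comp _ _ _ (fun y : 'rV[R]_d => y 0 j - mid q)).
        apply: (@cvgB _ R^o _ _ (nbhs_filter x)); first exact: coord_continuous.
        exact: (@cst_continuous 'rV[R]_d R _ x).
      by have [_] := C1_with_tent (hw q) n.+1%:R^-1; apply.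
    apply: (@continuous_prod_coord _ _ (fun i => plateau (a q 0 i) (b q 0 i) n)
      (fun i => i != j)) => i.
    by have [f' fC] := C1_with_plateau (a q 0 i) (b q 0 i) n; exact: C1_with_continuous fC.
  - move=> x _; apply: cvgM; first exact: cvg_cst.
    apply: cvg_sum_seq => q; apply: cvgM; [exact: cvg_cst|exact: wlim].
  - have := integrableZl measurableT (\sum_(q <- s) S) (integrable_abse iu).
    by apply: eq_integrable => // x _ /=; rewrite EFinM muleC.
  - move=> n x _; rewrite normrM ler_wpM2l// (le_trans (ler_norm_sum _ _ _))//.
    by apply: ler_sum => q _; rewrite normrM -[leRHS]mulr1 ler_pM.
have -> : \sum_(q <- s) c q *
    (\int[leb R d]_(x in box (a q) (set_coord (b q) j (mid q))) u x -
     \int[leb R d]_(x in box (set_coord (a q) j (mid q)) (b q)) u x) =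
    \int[leb R d]_x (u x * \sum_(q <- s) c q * (\1_(lw q) x - \1_(up q) x)).
  have iuA (A : set (Rd R d)) : measurable A ->
      (leb R d).-integrable setT (EFin \o (fun x => u x * \1_A x)).
    move=> mA; have := (integrable_mkcond _ mA).1 (integrableS measurableT mA (@subsetT _ _) iu).
    apply: eq_integrable => // x _ /=; rewrite /patch indicE.
    by case: (x \in A); rewrite /= ?mulr1 ?mulr0.
  have mlw q : measurable (lw q) by exact: measurable_open_box.
  have mup q : measurable (up q) by exact: measurable_open_box.
  have iul q : (leb R d).-integrable setT
      (EFin \o (fun x => u x * \1_(lw q) x - u x * \1_(up q) x)).
    have := integrableB measurableT (iuA _ (mlw q)) (iuA _ (mup q)).
    by apply: eq_integrable.
  elim: s {disj step ilim} => [|q s IH].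
    rewrite big_nil; under eq_Rintegral do rewrite big_nil mulr0.
    by rewrite Rintegral_cst// mul0r.
  rewrite big_cons IH.
  rewrite [RHS](@eq_Rintegral _ _ _ _ setT ((fun x => c q * (u x * \1_(lw q) x - u x * \1_(up q) x))
    \+ (fun x => u x * \sum_(q <- s) c q * (\1_(lw q) x - \1_(up q) x)))); last first.
    by move=> x _ /=; rewrite big_cons; ring.
  rewrite RintegralD//; last 2 first.
  - have := integrableZl measurableT (c q) (iul q).
    by apply: eq_integrable => // x _ /=; rewrite EFinM.
  - elim: s {IH} => [|q' s IH].
      by under eq_fun do rewrite big_nil mulr0; exact: integrable0.
    have := integrableD measurableT (integrableZl measurableT (c q') (iul q')) IH.
    apply: eq_integrable => // x _ /=; rewrite big_cons -EFinM -EFinD; congr EFin.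
    by ring.
  congr (_ + _); rewrite RintegralZl//; congr (_ * _).
  by rewrite RintegralB ?iuA// !Rintegral_indicM !Rintegral_open_box.
by apply: cvgr_to_le ilim _; apply: nearW => n; exact: step.
Qed.

(** Changing the sign of [c] gives the absolute value, and replacing [S] by [S + e] with [e] tending
    to 0 admits [S = 0]. *)
Lemma pair_estimate (I : Type) (s : seq I) (a b : I -> 'rV[R]_d) (j : 'I_d)
    (c : I -> R) (S l : R) (u : Rd R d -> R)
    (mid := fun q => (a q 0 j + b q 0 j) / 2) :
  (leb R d).-integrable setT (EFin \o u) -> (variation u < +oo)%E ->
  0 < l ->
  (forall q i, a q 0 i < b q 0 i) -> (forall q, b q 0 j - a q 0 j <= 2 * l) ->
  0 <= S -> (forall q, `|c q| <= S) ->
  (forall x, \sum_(q <- s) \1_(open_box (a q) (b q)) x <= 1 :> R) ->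
  `|\sum_(q <- s) c q *
    (\int[leb R d]_(x in box (a q) (set_coord (b q) j (mid q))) u x -
     \int[leb R d]_(x in box (set_coord (a q) j (mid q)) (b q)) u x)|
  <= S * l * fine (variation u).
Proof.
move=> iu uoo l0 ab bal S0 cS disj.
have V0 : 0 <= fine (variation u) by exact: fine_ge0 (variation_ge0 u).
have H e : 0 < e -> `|\sum_(q <- s) c q *
    (\int[leb R d]_(x in box (a q) (set_coord (b q) j (mid q))) u x -
     \int[leb R d]_(x in box (set_coord (a q) j (mid q)) (b q)) u x)|
    <= (S + e) * l * fine (variation u).
  move=> e0; have Se : 0 < S + e by rewrite ltr_wpDl.
  have cSe q : `|c q| <= S + e by rewrite (le_trans (cS q))// lerDl ltW.
  rewrite ler_norml; apply/andP; split; last first.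
    exact: pair_estimate_le.
  rewrite lerNl -sumrN.
  under eq_bigr do rewrite -mulNr.
  by apply: pair_estimate_le => // q; rewrite normrN.
(* The excess is chosen as a multiple of the inverse of this product, so its vanishing is treated
   apart. *)
have [lV0|lV0] := eqVneq (l * fine (variation u)) 0.
  by have := H 1 ltr01; rewrite -!mulrA lV0 !mulr0.
apply/ler_addgt0Pr => e e0.
have lV : 0 < l * fine (variation u) by rewrite lt_def lV0 mulr_ge0// ltW.
apply: le_trans (H (e / (l * fine (variation u))) _) _; first by rewrite divr_gt0.
by rewrite -!mulrA mulrDl divfK.
Qed.

End pair_estimate.

(** Indexing by positions in [s] restricts the hypotheses to the members of [s]; on the tree, bounds
    hold only for words of a given length. *)
Lemma pair_estimate_mem (R : realType) (d : nat) (I : eqType) (s : seq I)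
    (a b : I -> 'rV[R]_d) (j : 'I_d) (c : I -> R) (S l : R) (u : Rd R d -> R)
    (mid := fun q => (a q 0 j + b q 0 j) / 2) :
  (leb R d).-integrable setT (EFin \o u) -> (variation u < +oo)%E -> 0 < l ->
  {in s, forall q i, a q 0 i < b q 0 i} ->
  {in s, forall q, b q 0 j - a q 0 j <= 2 * l} ->
  0 <= S -> {in s, forall q, `|c q| <= S} ->
  (forall x, \sum_(q <- s) \1_(open_box (a q) (b q)) x <= 1 :> R) ->
  `|\sum_(q <- s) c q *
    (\int[leb R d]_(x in box (a q) (set_coord (b q) j (mid q))) u x -
     \int[leb R d]_(x in box (set_coord (a q) j (mid q)) (b q)) u x)|
  <= S * l * fine (variation u).
Proof.
move=> iu uoo l0 ab bal S0 cS disj; rewrite big_tnth.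
apply: (@pair_estimate _ _ _ _ (fun i => a (tnth (in_tuple s) i))
  (fun i => b (tnth (in_tuple s) i)) _ (fun i => c (tnth (in_tuple s) i))) => //.
- by move=> q i; apply: ab; exact: mem_tnth.
- by move=> q; apply: bal; exact: mem_tnth.
- by move=> q; apply: cS; exact: mem_tnth.
- by move=> x; have := disj x; rewrite big_tnth.
Qed.

(** * Integrals over cells, and bounded step functions in the dual of BV *)

Section cell_integrals.
Context (R : realType) (d : nat).
Hypothesis d_gt0 : (0 < d)%N.
Implicit Types (w : seq bool) (m n : nat).

Definition cell_integral (u : Rd R d -> R) w : R :=
  \int[leb R d]_(x in cell d_gt0 w) u x.

Lemma cell_integral_split u w : (leb R d).-integrable setT (EFin \o u) ->
  cell_integral u w = cell_integral u (false :: w) + cell_integral u (true :: w).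
Proof.
move=> iu; rewrite /cell_integral (cell_split R d_gt0 w) Rintegral_setU_null//.
- exact: measurable_cell.
- exact: measurable_cell.
- apply: integrableS iu => //; rewrite -cell_split; exact: measurable_cell.
- exact: cell_split_null.
Qed.

Section bounds.
Variable u : Rd R d -> R.
Hypotheses (iu : (leb R d).-integrable setT (EFin \o u))
  (uoo : (variation u < +oo)%E)
  (u0 : {ae leb R d, forall x, ~ cube R d x -> u x = 0}).
Let V : R := fine (variation u).
Let U := cell_integral u.

Lemma cell_pair_estimate m (c : seq bool -> R) S : 0 <= S ->
  {in words m, forall w, `|c w| <= S} ->
  `|\sum_(w <- words m) c w * (U (false :: w) - U (true :: w))| <=
    S * 2^-1 ^+ (m %/ d) * V.
Proof.
move=> S0 cS; pose j := split_dir d_gt0 m.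
have l0 : 0 < 2^-1 ^+ (m %/ d) :> R by rewrite exprn_gt0// invr_gt0.
rewrite big_seq (eq_bigr (fun w => c w *
  (\int[leb R d]_(x in box (cell_lo R d_gt0 w) (set_coord (cell_hi R d_gt0 w) j
    ((cell_lo R d_gt0 w 0 j + cell_hi R d_gt0 w 0 j) / 2))) u x -
   \int[leb R d]_(x in box (set_coord (cell_lo R d_gt0 w) j
    ((cell_lo R d_gt0 w 0 j + cell_hi R d_gt0 w 0 j) / 2)) (cell_hi R d_gt0 w)) u x))).
  rewrite -big_seq; apply: pair_estimate_mem => //.
  - by move=> w _ i; exact: cell_lo_hi.
  - move=> w wm; rewrite cell_side (size_words wm).
    apply: (@le_trans _ _ (2^-1 ^+ (m %/ d))).
      by rewrite ler_wiXn2l ?leq_halvings// ?invr_ge0// invf_le1// ler1n.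
    by rewrite ler_peMl ?ler1n// ltW.
  - exact: sum_open_cell_le1.
move=> w wm; rewrite /U /cell_integral /cell cell_lo0 cell_hi0 cell_lo1 cell_hi1.
by rewrite /cell_mid (size_words wm).
Qed.

(** Pair the cube with its translate by 1 in the direction [j]. There [u] vanishes almost
    everywhere, so the difference of the two integrals is the whole integral; the tent has height
    1. *)
Lemma cell_integral_nil : `|U [::]| <= V.
Proof.
pose j := split_dir d_gt0 0.
pose b : 'rV[R]_d := set_coord (const_mx 1) j 2.
have bj : ((0 : 'rV[R]_d) 0 j + b 0 j) / 2 = 1 by rewrite !mxE eqxx; field.
have bE : set_coord b j 1 = const_mx 1.
  by apply/rowP => i; rewrite !mxE; case: eqP.
have := @pair_estimate R d unit [:: tt] (fun=> 0) (fun=> b) j (fun=> 1) 1 1 u iu uoo.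
rewrite !big_seq1 !mul1r bj bE normr1.
have mup := @measurable_box R d (set_coord 0 j 1) b.
have up0 : \int[leb R d]_(x in box (set_coord 0 j 1) b) u x = 0.
  rewrite /Rintegral (@ae_eq_integral _ _ _ _ _ (cst 0%E) (EFin \o u)).
  - by rewrite integral0.
  - exact: mup.
  - apply: (measurable_int (leb R d)); exact: integrableS iu.
  - exact: measurable_cst.
  have N : (leb R d).-negligible (box 0 (set_coord b j 1) `&` box (set_coord 0 j 1) b).
    apply/negligibleP; last exact: box_split_null.
    by apply: measurableI; exact: measurable_box.
  apply: negligibleS (negligibleU u0 N) => x /= /not_implyP[upx ux].
  have [cx|ncx] := pselect (cube R d x); last by left => /(_ ncx) ux0; rewrite ux0 in ux.
  by right; rewrite bE.
rewrite up0 subr0 /U /cell_integral cell_nil; apply => //.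
- by move=> _ i; rewrite !mxE; case: eqP.
- by rewrite !mxE eqxx subr0 mulr1.
- by move=> x; rewrite big_seq1 indicE lern1 leq_b1.
Qed.

(** A step function of level [m] with values bounded by [S], tested against
    [u]: the conditional expectations along the tree are controlled one halving
    at a time. *)
Lemma cell_sum_bound m (c : seq bool -> R) S : 0 <= S ->
  {in words m, forall w, `|c w| <= S} ->
  `|\sum_(w <- words m) c w * U w| <=
    (1 + \sum_(k < m) 2^-1 ^+ (k %/ d)) * S * V.
Proof.
elim: m c => [|m IH] c S0 cS.
  rewrite big_seq1 big_ord0 addr0 mul1r normrM ler_pM// ?cS ?inE//.
  exact: cell_integral_nil.
(* Mean and half-difference on the two children: the mean multiplies the integral over the parent
   and goes to the induction, the half-difference multiplies the difference of the integrals over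
   the halves. *)
pose c0 w := (c (false :: w) + c (true :: w)) / 2.
pose c1 w := (c (false :: w) - c (true :: w)) / 2.
have cm b w : w \in words m -> `|c (b :: w)| <= S.
  move=> wm; apply: cS; rewrite /= mem_cat.
  by apply/orP; case: b; [right|left]; exact: map_f.
have -> : \sum_(w <- words m.+1) c w * U w = \sum_(w <- words m) c0 w * U w +
    \sum_(w <- words m) c1 w * (U (false :: w) - U (true :: w)).
  rewrite big_words -big_split; apply: eq_bigr => w _ /=.
  rewrite /c0 /c1 /U (cell_integral_split w iu).
  move: (cell_integral _ (false :: w)) (cell_integral _ (true :: w)) => x y.
  by field.
rewrite (le_trans (ler_normD _ _))// big_ord_recr/= addrA !mulrDl lerD//.
  rewrite -!mulrDl; apply: IH => // w wm; rewrite normrM (@ger0_norm _ 2^-1)//.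
  rewrite ler_pdivrMr// (le_trans (ler_normD _ _))// mulr_natr mulr2n.
  by rewrite lerD// cm.
rewrite [_ * S]mulrC; apply: cell_pair_estimate => // w wm.
rewrite normrM (@ger0_norm _ 2^-1)// ler_pdivrMr// (le_trans (ler_normB _ _))//.
by rewrite mulr_natr mulr2n lerD// cm.
Qed.

End bounds.
End cell_integrals.

Lemma geometric_increments_cvg (R : realType) (s : nat -> R) (B q : R) :
  0 <= B -> 0 < q < 1 -> (forall m, `|s m.+1 - s m| <= B * q ^+ m) ->
  cvgn s /\ forall n, `|limn s - s n| <= B * q ^+ n / (1 - q).
Proof.
move=> B0 /andP[q0 q1] sB; have q1' : 0 < 1 - q by rewrite subr_gt0.
have tail n k : `|s (n + k)%N - s n| <= B * q ^+ n * (1 - q ^+ k) / (1 - q).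
  elim: k => [|k IH].
    by rewrite addn0 expr0 !subrr normr0 mulr0 mul0r.
  have -> : s (n + k.+1)%N - s n = (s (n + k).+1 - s (n + k)%N) + (s (n + k)%N - s n).
    by rewrite addnS addrA subrK.
  rewrite (le_trans (ler_normD _ _))// (le_trans (lerD (sB _) IH))//.
  rewrite le_eqVlt; apply/orP; left; apply/eqP.
  by rewrite exprD exprS; field; rewrite gt_eqF.
have tail' n k : `|s (n + k)%N - s n| <= B * q ^+ n / (1 - q).
  rewrite (le_trans (tail n k))// ler_pM2r ?invr_gt0// ler_piMr//.
    by rewrite mulr_ge0// exprn_ge0// ltW.
  by rewrite gerBl exprn_ge0// ltW.
have cs : cvgn s.
  have q1n : `|q| < 1 by rewrite ger0_norm ?ltW.
  have /cvgrPdist_lt cq : (fun n => B / (1 - q) * q ^+ n) @ \oo --> (0 : R).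
    rewrite -[X in _ --> X](mulr0 (B / (1 - q))).
    by apply: cvgM; [exact: cvg_cst|exact: cvg_expr].
  apply: R_complete; apply/cauchy_exP => e e0.
  have [N _ HN] := cq _ e0; exists (s N); exists N => // n /= Nn.
  rewrite -ball_normE/= -(subnKC Nn) distrC (le_lt_trans (tail' _ _))//.
  have := HN N (leqnn N); rewrite sub0r normrN ger0_norm; first by rewrite mulrAC.
  by rewrite mulr_ge0 ?exprn_ge0 ?divr_ge0 ?(ltW q0) ?(ltW q1').
split => // n.
have ln : (fun k => `|s k - s n|) @ \oo --> `|limn s - s n|.
  by apply: cvg_norm; apply: cvgB => //; exact: cvg_cst.
apply: (cvgr_to_le ln); exists n => // k /= nk.
by rewrite -(subnKC nk) tail'.
Qed.

(** A scale on which the sides of the cells of level [m] are comparable to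
    [tau ^ m]. *)
Section scales.
Context (R : realType) (d : nat).
Hypothesis d_gt0 : (0 < d)%N.

Lemma powR2_lt1 (e : R) : e < 0 -> 2 `^ e < 1 :> R.
Proof.
move=> e0; rewrite -(opprK e) powRN invf_lt1 ?powR_gt0//.
have : 1 `^ (- e) < 2 `^ (- e) :> R.
  by apply: gt0_ltr_powR; rewrite ?oppr_gt0// ?nnegrE ?ler0n ?ler01 ?ltr1n.
by rewrite powR1.
Qed.

Definition side_ratio : R := 2 `^ (- d%:R^-1).

Lemma side_ratio_lt1 : 0 < side_ratio < 1.
Proof.
by rewrite powR_gt0//= powR2_lt1// oppr_lt0 invr_gt0 ltr0n.
Qed.

Lemma side_ratioX : side_ratio ^+ d = 2^-1.
Proof.
rewrite -powR_mulrn ?powR_ge0// -powRrM mulNr mulVf ?pnatr_eq0 -?lt0n//.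
by rewrite powRN powRr1.
Qed.

(** The factor 2 pays for the integer division: the remainder is below [d], and [side_ratio ^+ d] is
    one half. *)
Lemma half_power_le m : 2^-1 ^+ (m %/ d) <= 2 * side_ratio ^+ m.
Proof.
have /andP[t0 t1] := side_ratio_lt1.
rewrite [in leRHS](divn_eq m d) exprD mulnC exprM side_ratioX mulrCA.
rewrite ler_peMr ?exprn_ge0// -ler_pdivrMl// mulr1 -side_ratioX.
by rewrite ler_wiXn2l ?(ltW t0) ?(ltW t1)// ltnW// ltn_pmod.
Qed.

Lemma sum_half_powers_le m :
  \sum_(k < m) 2^-1 ^+ (k %/ d) <= 2 / (1 - side_ratio).
Proof.
have /andP[t0 t1] := side_ratio_lt1.
apply: (@le_trans _ _ (\sum_(k < m) 2 * side_ratio ^+ k)).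
  by apply: ler_sum => k _; exact: half_power_le.
rewrite -mulr_sumr ler_pM2l// -[leRHS]mul1r ler_pdivlMr ?subr_gt0//.
by rewrite mulrC -opprB mulNr -subrX1 opprB gerBl exprn_ge0 ?(ltW t0).
Qed.

End scales.

(** * Discrete products and their increments *)

Section discrete_product.
Context (R : realType) (d : nat).
Hypothesis d_gt0 : (0 < d)%N.
Implicit Types (w : seq bool) (m : nat) (phi om : seq bool -> R).

(** Integral of [u] against the step function of level [m] with density
    [phi w * om w / |cell w|]. *)
Definition cell_pairing phi om (u : Rd R d -> R) m : R :=
  \sum_(w <- words m) phi w * om w * 2 ^+ m * cell_integral d_gt0 u w.

Definition tree_additive om := forall w, om w = om (false :: w) + om (true :: w).

(** The first term bounds the oscillation part: [cell_sum_bound], with a 2 from the normalisation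
    [2 ^+ m.+1]. The 4 bounds the martingale part: a 2 from the two values of [om] and a 2 from
    [half_power_le]. *)
Definition tree_cst : R := 2 * (1 + 2 / (1 - side_ratio R d)) + 4.

Lemma tree_cst_ge0 : 0 <= tree_cst.
Proof.
have /andP[_ t1] := side_ratio_lt1 R d_gt0.
by rewrite addr_ge0// mulr_ge0// addr_ge0// divr_ge0// subr_ge0 ltW.
Qed.

Section increments.
Variables (phi om : seq bool -> R) (A F L eta sigma : R).
Hypotheses (A0 : 0 <= A) (F0 : 0 <= F) (L0 : 0 <= L).
Hypotheses (eta0 : 0 < eta <= 1) (sigma_ge : side_ratio R d <= sigma).
Hypotheses (om_add : tree_additive om)
  (om_le : forall w, `|om w| <= A * eta ^+ size w)
  (phi_le : forall w, `|phi w| <= F)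
  (phi_osc : forall b w, `|phi (b :: w) - phi w| <= L * sigma ^+ size w).
Variable u : Rd R d -> R.
Hypotheses (iu : (leb R d).-integrable setT (EFin \o u))
  (uoo : (variation u < +oo)%E)
  (u0 : {ae leb R d, forall x, ~ cube R d x -> u x = 0}).

(** The increment splits into the oscillation of [phi], controlled in sup norm,
    and [phi] times a martingale difference of [om], controlled by the variation. *)
Lemma cell_pairing_increment m :
  `|cell_pairing phi om u m.+1 - cell_pairing phi om u m| <=
  tree_cst * A * (F + L) * fine (variation u) * (2 * eta * sigma) ^+ m.
Proof.
have /andP[t0 t1] := side_ratio_lt1 R d_gt0.
have /andP[e0 e1] := eta0.
have s0 : 0 < sigma by exact: lt_le_trans sigma_ge.
have V0 : 0 <= fine (variation u) by exact: fine_ge0 (variation_ge0 u).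
set U := cell_integral d_gt0 u; set V := fine (variation u) in V0 *.
(* [behead w] is the parent cell. By additivity, [2 ^+ m.+1 * om] on a child minus [2 ^+ m * om] on
   the parent is plus or minus [2 ^+ m * (om (false :: w) - om (true :: w))], which yields [c']. *)
pose c w := (phi w - phi (behead w)) * om w * 2 ^+ m.+1.
pose c' w := phi w * (om (false :: w) - om (true :: w)) * 2 ^+ m.
have -> : cell_pairing phi om u m.+1 - cell_pairing phi om u m =
    \sum_(w <- words m.+1) c w * U w +
    \sum_(w <- words m) c' w * (U (false :: w) - U (true :: w)).
  rewrite /cell_pairing !big_words -sumrB -big_split; apply: eq_bigr => w _ /=.
  rewrite /c /c' /U /= (om_add w) (cell_integral_split d_gt0 w iu) exprS.
  move: (cell_integral _ _ (false :: w)) (cell_integral _ _ (true :: w)) => x y.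
  by ring.
have Q0 : 0 <= (2 * eta * sigma) ^+ m by rewrite exprn_ge0 ?mulr_ge0 ?ltW.
have QE : 2 ^+ m * eta ^+ m * sigma ^+ m = (2 * eta * sigma) ^+ m by rewrite !exprMn.
have H1 : `|\sum_(w <- words m.+1) c w * U w| <=
    (1 + 2 / (1 - side_ratio R d)) * (2 * L * A * (2 * eta * sigma) ^+ m) * V.
  apply: le_trans (cell_sum_bound d_gt0 iu uoo u0
    (S := 2 * L * A * (2 * eta * sigma) ^+ m) _ _) _.
  - by rewrite !mulr_ge0.
  - move=> w wm; have := size_words wm; case: w {wm} => // b w [wm].
    rewrite /c /= !normrM (@ger0_norm _ (2 ^+ m.+1)) ?exprn_ge0//.
    rewrite -QE exprS.
    apply: (@le_trans _ _ (L * sigma ^+ m * (A * eta ^+ m) * (2 * 2 ^+ m))).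
      rewrite ler_wpM2r ?mulr_ge0 ?exprn_ge0// ler_pM//.
        by rewrite -wm phi_osc.
      rewrite (le_trans (om_le _))// ler_wpM2l//= wm exprS ler_piMl//.
      by rewrite exprn_ge0// ltW.
    by rewrite le_eqVlt; apply/orP; left; apply/eqP; ring.
  rewrite ler_wpM2r// ler_wpM2r ?mulr_ge0// lerD2l.
  exact: sum_half_powers_le.
have H2 : `|\sum_(w <- words m) c' w * (U (false :: w) - U (true :: w))| <=
    4 * F * A * (2 * eta * sigma) ^+ m * V.
  apply: le_trans (cell_pair_estimate d_gt0 iu uoo (S := 2 * F * A * (2 * eta) ^+ m) _ _) _.
  - by rewrite !mulr_ge0 ?exprn_ge0 ?mulr_ge0// ltW.
  - move=> w wm; have sw := size_words wm.
    rewrite /c' !normrM (@ger0_norm _ (2 ^+ m)) ?exprn_ge0//.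
    apply: (@le_trans _ _ (F * (2 * (A * eta ^+ m)) * 2 ^+ m)).
      rewrite ler_wpM2r ?exprn_ge0// ler_pM//.
      rewrite (le_trans (ler_normB _ _))// mulr_natl mulr2n.
      by rewrite lerD// (le_trans (om_le _))// ler_wpM2l//= sw exprS ler_piMl//
        exprn_ge0// ltW.
    by rewrite exprMn le_eqVlt; apply/orP; left; apply/eqP; ring.
  rewrite ler_wpM2r// -mulrA.
  apply: (@le_trans _ _ (2 * F * A * ((2 * eta) ^+ m * (2 * sigma ^+ m)))).
    rewrite [2 * F * (A * _)]mulrA -[leLHS]mulrA.
    apply: ler_wpM2l; first by rewrite !mulr_ge0.
    apply: ler_wpM2l; first by rewrite exprn_ge0// mulr_ge0// ltW.
    rewrite (le_trans (half_power_le _ d_gt0 m))// ler_wpM2l//.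
    by rewrite lerXn2r// nnegrE ltW.
  by rewrite !exprMn le_eqVlt; apply/orP; left; apply/eqP; ring.
rewrite (le_trans (ler_normD _ _))// (le_trans (lerD H1 H2))//.
rewrite /tree_cst; set K := 1 + _; set Q := _ ^+ m.
have K0 : 0 <= K by rewrite addr_ge0// divr_ge0// subr_ge0 ltW.
have H3 : 0 <= A * Q * V by rewrite !mulr_ge0.
rewrite -subr_ge0.
have -> : (2 * K + 4) * A * (F + L) * V * Q -
    (K * (2 * L * A * Q) * V + 4 * F * A * Q * V) =
  (2 * K * F + 4 * L) * (A * Q * V) by ring.
by rewrite mulr_ge0// addr_ge0 ?mulr_ge0.
Qed.

Hypothesis q_lt1 : 2 * eta * sigma < 1.

Definition pairing_rate : R := tree_cst * A * (F + L) / (1 - 2 * eta * sigma).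

Lemma cell_pairing_cvg :
  cvgn (cell_pairing phi om u) /\
  forall n, `|limn (cell_pairing phi om u) - cell_pairing phi om u n| <=
    pairing_rate * (2 * eta * sigma) ^+ n * fine (variation u).
Proof.
have /andP[t0 t1] := side_ratio_lt1 R d_gt0.
have /andP[e0 e1] := eta0.
have s0 : 0 < sigma by exact: lt_le_trans sigma_ge.
have V0 : 0 <= fine (variation u) by exact: fine_ge0 (variation_ge0 u).
have [||c H] := geometric_increments_cvg (s := cell_pairing phi om u) (q := 2 * eta * sigma)
    (B := tree_cst * A * (F + L) * fine (variation u)) _ _ cell_pairing_increment.
- by rewrite !mulr_ge0 ?tree_cst_ge0 ?addr_ge0.
- by rewrite q_lt1 andbT !mulr_gt0.
split => // n; rewrite (le_trans (H n))// le_eqVlt; apply/orP; left; apply/eqP.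
by rewrite /pairing_rate; ring.
Qed.

End increments.
End discrete_product.

Lemma RintegralD_seq (disp : measure_display) (T : measurableType disp)
    (R : realType) (mu : {measure set T -> \bar R}) (D : set T) (I : Type)
    (s : seq I) (f : I -> T -> R) :
  measurable D -> (forall i, mu.-integrable D (EFin \o f i)) ->
  mu.-integrable D (EFin \o (fun x => \sum_(i <- s) f i x)) /\
  \int[mu]_(x in D) (\sum_(i <- s) f i x) = \sum_(i <- s) \int[mu]_(x in D) f i x.
Proof.
move=> mD fi; elim: s => [|i s [IHi IH]].
  split; first by under eq_fun do rewrite big_nil; exact: integrable0.
  under eq_Rintegral do rewrite big_nil.
  by rewrite big_nil /Rintegral integral0.
split.
  have := integrableD mD (fi i) IHi.
  by apply: eq_integrable => // x _ /=; rewrite big_cons EFinD.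
under eq_Rintegral do rewrite big_cons.
by rewrite big_cons RintegralD// IH.
Qed.

(** * Perimeters of boxes, and functions of bounded variation *)

Section perimeters.
Context (R : realType) (d : nat).
Implicit Types (A : set (Rd R d)) (u v : Rd R d -> R).

Lemma leb_cube_lty : (leb R d (cube R d) < +oo)%E.
Proof. by rewrite leb_cube ltry. Qed.

Lemma integrable_partial (v : 'rV[R]_d -> 'rV[R]_d) j A :
  C1 v -> compactly_supported v -> measurable A -> (leb R d A < +oo)%E ->
  (leb R d).-integrable A
    (EFin \o ('D_(delta_mx 0 j) (fun x => v x 0 j) : Rd R d -> R)).
Proof.
move=> vC1 sv mA Aoo; have [M HM] := partials_bounded vC1 sv.
apply: (measurable_bounded_integrable mA Aoo).
  by apply: measurable_funTS; apply: continuous_measurable_Rd; exact: continuous_partial.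
exists M; split; first exact: num_real.
by move=> y My x _; exact: le_trans (HM _ _ _) (ltW My).
Qed.

Lemma integral_indic_divergence (v : 'rV[R]_d -> 'rV[R]_d) A :
  C1 v -> compactly_supported v -> measurable A -> (leb R d A < +oo)%E ->
  \int[leb R d]_x (\1_A x * divergence v x) =
  \sum_j \int[leb R d]_(x in A) 'D_(delta_mx 0 j) (fun x => v x 0 j) x.
Proof.
move=> vC1 sv mA Aoo; under eq_Rintegral do rewrite mulrC.
rewrite Rintegral_indicM.
have [_ <-] := RintegralD_seq (index_enum 'I_d) mA
  (fun j => integrable_partial j vC1 sv mA Aoo).
by apply: eq_Rintegral => x _; rewrite (divergenceE vC1).
Qed.

Lemma integrable_indic_lty A : measurable A -> (leb R d A < +oo)%E ->
  (leb R d).-integrable setT (EFin \o (\1_A : Rd R d -> R)).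
Proof.
move=> mA Aoo; apply/integrableP; split; first exact/measurable_EFinP.
rewrite (eq_integral (EFin \o \1_A)); last first.
  by move=> x _; rewrite gee0_abs// lee_fin.
by rewrite integral_indic// setIT.
Qed.

(** In each direction the divergence integrates to the flux through two opposite faces, and a field
    of length at most 1 sends at most the area through each. *)
Lemma perimeter_box (a b : 'rV[R]_d) : (forall i, a 0 i < b 0 i) ->
  (perimeter (box a b) <=
   (\sum_j 2 * \prod_(i | i != j) (b 0 i - a 0 i))%:E)%E.
Proof.
move=> ab; have mb := @measurable_box R d a b; have boo := leb_box_lty a b.
apply: variation_le; first exact: integrable_indic_lty.
move=> v vC1 sv v1; rewrite integral_indic_divergence//.
apply: ler_sum => j _; apply: (cvgr_to_le (box_flux vC1 sv v1 ab)).
apply: nearW => n; rewrite (le_trans (ler_norm _))// (le_trans (ler_normB _ _))//.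
by rewrite mulr_natl mulr2n lerD//; apply: slab_flux_le => // i; exact: ltW.
Qed.

Lemma bounded_sub_cube A : A `<=` cube R d -> bounded_set (A : set 'rV[R]_d).
Proof.
move=> Ac; exists 1; split; first exact: num_real.
move=> y y1 x /Ac cx /=; rewrite [leLHS]/Num.Def.normr/= mx_normrE.
apply: bigmax_le => [|[i j] _]; first by rewrite ltW// (lt_trans ltr01).
rewrite ord1 /=; have /andP[] := cx j; rewrite !mxE => ? ?.
by rewrite ger0_norm// (le_trans _ (ltW y1)).
Qed.

Definition boxBV (a b : 'rV[R]_d) (ab : forall i, a 0 i < b 0 i)
    (sub : box a b `<=` cube R d) : cubeBV R d :=
  CubeBV (And3 (bounded_sub_cube sub) (@measurable_box R d a b)
    (le_lt_trans (perimeter_box ab) (ltry _))) sub.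

Lemma BV_set_lty (B : cubeBV R d) : (leb R d B < +oo)%E.
Proof.
apply: le_lt_trans leb_cube_lty; apply: le_measure; rewrite ?inE.
- by have [] := cubeBV_BV B.
- exact: measurable_box.
- exact: cubeBV_sub.
Qed.

Lemma measurable_cubeBV (B : cubeBV R d) : measurable (B : set (Rd R d)).
Proof. by have [] := cubeBV_BV B. Qed.

Lemma BV_function_indic (B : cubeBV R d) : BV_function (\1_B : Rd R d -> R).
Proof.
split.
- by apply: integrable_indic_lty; [exact: measurable_cubeBV|exact: BV_set_lty].
- by have [] := cubeBV_BV B.
- apply: aeW => x ncx; rewrite indicE memNset// => Bx.
  by apply: ncx; exact: cubeBV_sub Bx.
Qed.

Lemma BV_function_comb (a : R) u v : BV_function u -> BV_function v ->
  BV_function (a *: u + v).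
Proof.
move=> [iu uoo u0] [iv voo v0]; split.
- have := integrableD measurableT (integrableZl measurableT a iu) iv.
  by apply: eq_integrable.
- by apply: le_lt_trans (variation_comb a iu uoo iv voo) _; rewrite ltry.
- apply: negligibleS (negligibleU u0 v0) => x /= /not_implyP[ncx uv].
  have [ux0|ux0] := eqVneq (u x) 0; last by left => /(_ ncx) /eqP; rewrite (negbTE ux0).
  have [vx0|vx0] := eqVneq (v x) 0; last by right => /(_ ncx) /eqP; rewrite (negbTE vx0).
  by exfalso; apply: uv; rewrite -[LHS]/(a * u x + v x) ux0 vx0 mulr0 addr0.
Qed.

Lemma fine_variation_comb (a : R) u v : BV_function u -> BV_function v ->
  fine (variation (a *: u + v)) <= `|a| * fine (variation u) + fine (variation v).
Proof.
move=> bu bv; have [_ oo _] := BV_function_comb a bu bv.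
have [iu uoo _] := bu; have [iv voo _] := bv.
rewrite -lee_fin fineK; first exact: variation_comb.
by rewrite ge0_fin_numE// variation_ge0.
Qed.

Lemma BV_function0 : BV_function (0 : Rd R d -> R).
Proof.
split; last exact: aeW.
- by rewrite (_ : EFin \o _ = cst 0%E)//; exact: integrable0.
- apply: (@le_lt_trans _ _ 0%E) => //; apply: variation_le.
    by rewrite (_ : EFin \o _ = cst 0%E)//; exact: integrable0.
  move=> v _ _ _; under eq_Rintegral do rewrite mul0r.
  by rewrite /Rintegral integral0.
Qed.

End perimeters.

(** * Dyadic figures *)

Section grid.
Context (R : realType) (d n : nat).
Implicit Types (k : 'I_d -> nat) (i j : 'I_d).

Definition grid_lo k : 'rV[R]_d := \row_i ((k i)%:R / 2 ^+ n).
Definition grid_hi k : 'rV[R]_d := \row_i ((k i).+1%:R / 2 ^+ n).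
Definition grid_box k : set (Rd R d) := box (grid_lo k) (grid_hi k).

Local Notation index := {ffun 'I_d -> 'I_(2 ^ n)}.
(** These are the cells of level [n * d], indexed by coordinates instead of words so that neighbours
    in a given direction are easy to name. *)
Definition grid_cell (k : index) : set (Rd R d) := grid_box (fun i => k i).

Lemma grid_lo_hi k i : grid_lo k 0 i < grid_hi k 0 i.
Proof. by rewrite !mxE ltr_pM2r ?invr_gt0// ltr_nat. Qed.

Lemma grid_side k i : grid_hi k 0 i - grid_lo k 0 i = 2^-1 ^+ n.
Proof. by rewrite !mxE -mulrBl -natrB// subSnn mul1r exprVn. Qed.

Lemma dyadic_grid_cell (k : index) : dyadic_cube (grid_cell k).
Proof. by exists n, (fun i => k i); split => // i; exact: ltn_ord. Qed.

Lemma sub_grid_cell_cube (k : index) : grid_cell k `<=` cube R d.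
Proof.
move=> x kx i; have /andP[lx xh] := kx i; rewrite !mxE; apply/andP; split.
  by apply: le_trans lx; rewrite mxE divr_ge0// ltW.
apply: le_trans xh _; rewrite mxE ler_pdivrMr// mul1r -natrX ler_nat.
exact: ltn_ord.
Qed.

Lemma measurable_grid_cell (k : index) : measurable (grid_cell k).
Proof. exact: measurable_box. Qed.

Lemma grid_cell_lty (k : index) : (leb R d (grid_cell k) < +oo)%E.
Proof. exact: leb_box_lty. Qed.

Lemma grid_cover x : cube R d x -> exists k : index, grid_cell k x.
Proof.
move=> cx; have H i : exists m : 'I_(2 ^ n),
    m%:R / 2 ^+ n <= x 0 i <= m.+1%:R / 2 ^+ n.
  have /andP[x0 x1] := cx i; rewrite !mxE in x0 x1.
  (* On the face [x 0 i = 1] truncation would give the index [2 ^ n], which is out of range; the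
     last cell contains the point. *)
  have [x1'|x1'] := ltP (x 0 i) 1; last first.
    have e0 : (0 < 2 ^ n)%N by rewrite expn_gt0.
    have lt : ((2 ^ n).-1 < 2 ^ n)%N by rewrite prednK.
    exists (Ordinal lt); rewrite /= prednK// natrX divff ?gt_eqF// x1 andbT.
    by rewrite ler_pdivrMr// (le_trans _ (_ : 1 * 2 ^+ n <= _)) ?ler_pM2r//
      mul1r -natrX ler_nat leq_pred.
  have y0 : 0 <= x 0 i * 2 ^+ n by rewrite mulr_ge0// ltW.
  have := truncn_itv y0; set m := Num.truncn _ => /andP[t0 t1].
  have lt : (m < 2 ^ n)%N.
    rewrite -(ltr_nat R); apply: (le_lt_trans t0).
    by rewrite natrX -[ltRHS]mul1r ltr_pM2r.
  by exists (Ordinal lt); rewrite /= ler_pdivrMr// t0 ler_pdivlMr// ltW.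
exists [ffun i => sval (cid (H i))] => i; rewrite !mxE ffunE.
by case: cid.
Qed.

Lemma grid_cell_overlap (k k' : index) : k != k' ->
  leb R d (grid_cell k `&` grid_cell k') = 0%E.
Proof.
move=> kk'; have [i ki] : exists i, k i != k' i.
  apply/existsP; rewrite -negb_forall; apply: contra kk' => /forallP H.
  by apply/eqP/ffunP => i; exact/eqP.
wlog lt : k k' {kk'} ki / (k i < k' i)%N.
  move=> H; have [lt|lt|/val_inj e] := ltngtP (k i) (k' i); first exact: H.
    by rewrite setIC; apply: H => //; rewrite eq_sym.
  by rewrite e eqxx in ki.
apply/eqP; rewrite -measure_le0 -(@leb_box_degenerate R d
    (grid_lo (fun i => k' i)) (grid_hi (fun i => k i)) i).
  apply: le_measure; rewrite ?inE.
  - by apply: measurableI; exact: measurable_box.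
  - exact: measurable_box.
  - by move=> x [kx k'x] l; have /andP[_ ->] := kx l; have /andP[-> _] := k'x l.
by rewrite !mxE ler_pM2r ?invr_gt0// ler_nat.
Qed.

Definition figure (s : seq index) : set (Rd R d) :=
  \big[setU/set0]_(k <- s) grid_cell k.

Lemma figureP (s : seq index) x : figure s x <-> exists2 k, k \in s & grid_cell k x.
Proof. by rewrite /figure -bigcup_seq; split=> [[k ks kx]|[k ks kx]]; exists k. Qed.

Lemma measurable_figure (s : seq index) : measurable (figure s).
Proof. by apply: bigsetU_measurable => k _; exact: measurable_grid_cell. Qed.

Lemma sub_figure_cube (s : seq index) : figure s `<=` cube R d.
Proof. by move=> x /figureP[k _ kx]; exact: sub_grid_cell_cube kx. Qed.

Lemma figure_lty (s : seq index) : (leb R d (figure s) < +oo)%E.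
Proof.
apply: le_lt_trans (leb_cube_lty R d); apply: le_measure; rewrite ?inE.
- exact: measurable_figure.
- exact: measurable_box.
- exact: sub_figure_cube.
Qed.

Lemma figure_overlap (k : index) (s : seq index) : k \notin s ->
  leb R d (grid_cell k `&` figure s) = 0%E.
Proof.
elim: s => [|k' s IH]; first by rewrite /figure big_nil setI0 measure0.
rewrite inE negb_or => /andP[kk' ks].
rewrite /figure big_cons setIUr; apply: null_set_setU.
- by apply: measurableI; exact: measurable_grid_cell.
- by apply: measurableI; [exact: measurable_grid_cell|exact: measurable_figure].
- exact: grid_cell_overlap.
- exact: IH.
Qed.

Lemma Rintegral_figure (s : seq index) (g : Rd R d -> R) : uniq s ->
  (leb R d).-integrable (cube R d) (EFin \o g) ->
  \int[leb R d]_(x in figure s) g x = \sum_(k <- s) \int[leb R d]_(x in grid_cell k) g x.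
Proof.
move=> us ig; elim: s us => [_|k s IH /= /andP[ks us]].
  by rewrite /figure !big_nil Rintegral_set0.
rewrite {1}/figure big_cons -/(figure s) Rintegral_setU_null ?IH//.
- by rewrite big_cons.
- exact: measurable_grid_cell.
- exact: measurable_figure.
- apply: integrableS ig.
  + exact: measurable_box.
  + by apply: measurableU; [exact: measurable_grid_cell|exact: measurable_figure].
  + by rewrite subUset; split; [exact: sub_grid_cell_cube|exact: sub_figure_cube].
- exact: figure_overlap.
Qed.

Lemma figure_enum : figure (enum index) = cube R d.
Proof.
apply/seteqP; split; first exact: sub_figure_cube.
by move=> x /grid_cover[k kx]; apply/figureP; exists k => //; rewrite mem_enum.
Qed.

Hypothesis d_gt0 : (0 < d)%N.

Lemma leb_grid_cell (k : index) : leb R d (grid_cell k) = (2^-1 ^+ (n * d))%:E.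
Proof.
have [w wn kw] := cell_of_index R d_gt0 (fun i => ltn_ord (k i)).
by rewrite -wn -(leb_cell R d_gt0 w) -kw.
Qed.

End grid.

Section figure_perimeter.
Context (R : realType) (d n : nat).
Local Notation index := {ffun 'I_d -> 'I_(2 ^ n)}.
Implicit Types (k : index) (j : 'I_d) (s : seq index).

(** Neighbour in the direction [j], wrapping around on the last layer. *)
Definition next_cell j k : index := [ffun i => if i == j then ordS (k i) else k i].

Definition last_layer j k : bool := (k j).+1 == (2 ^ n)%N.

Definition shift_index j (k : 'I_d -> nat) : 'I_d -> nat :=
  fun i => if i == j then (k i).+1 else k i.

Definition face_area j : R := \prod_(i < d | i != j) 2^-1 ^+ n.

Lemma face_area_gt0 j : 0 < face_area j.
Proof. by apply: prodr_gt0 => i _; rewrite exprn_gt0// invr_gt0. Qed.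

Lemma next_cell_inj j : injective (next_cell j).
Proof.
move=> k k' /ffunP H; apply/ffunP => i; have := H i; rewrite !ffunE.
by case: eqP => // _; exact: (can_inj (@ordSK _)).
Qed.

Lemma next_cellE j k : ~~ last_layer j k ->
  shift_index j (fun i => k i) = fun i => next_cell j k i.
Proof.
move=> kl; apply/funext => i; rewrite /shift_index ffunE; case: eqP => // ->.
rewrite /= modn_small// ltn_neqAle ltn_ord andbT; exact: kl.
Qed.

(** The faces of the last layer tile a face of the unit cube. The count is obtained by distributing
    a product of sums, one per coordinate; the sum for [j] has a single nonzero term. *)
Lemma last_layer_area j : face_area j * \sum_k (last_layer j k)%:R = 1.
Proof.
pose F i (m : 'I_(2 ^ n)) : R := if i == j then (m.+1 == (2 ^ n)%N)%:R else 2^-1 ^+ n.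
rewrite mulr_sumr (eq_bigr (fun k : index => \prod_i F i (k i))); last first.
  move=> k _; rewrite (bigD1 j)//= /F eqxx mulrC; congr (_ * _).
  by apply: eq_bigr => i /negbTE ij; rewrite ij.
rewrite -bigA_distr_bigA (bigD1 j)//= [X in _ * X]big1 ?mulr1; last first.
  move=> i ij; rewrite /F (negbTE ij) sumr_const card_ord -[_ *+ (2 ^ n)]mulr_natr natrX.
  by rewrite -exprMn mulVf ?pnatr_eq0// expr1n.
have e0 : (0 < 2 ^ n)%N by rewrite expn_gt0.
have lt : ((2 ^ n).-1 < 2 ^ n)%N by rewrite prednK.
rewrite (bigD1 (Ordinal lt))//= /F eqxx prednK// eqxx big1 ?addr0// => m; rewrite -val_eqE/= => mn.
  suff /negbTE -> : m.+1 != (2 ^ n)%N by [].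
by apply: contra mn => /eqP e; apply/eqP/succn_inj; rewrite prednK.
Qed.

Definition jumps s j : R :=
  \sum_k (~~ last_layer j k && ((k \in s) != (next_cell j k \in s)))%:R.

(** Reindexing the second sum by the cyclic permutation [next_cell j] collects both contributions of
    a face. An inner face survives only where membership in [s] changes; the last layer, whose
    successor wraps to the first, is bounded by two faces per cell. *)
Lemma summation_by_parts (phi : ('I_d -> nat) -> R) j s (M : R) :
  uniq s -> 0 <= M -> (forall q : 'I_d -> nat, `|phi q| <= M) ->
  \sum_(k <- s) (phi (shift_index j (fun i => k i)) - phi (fun i => k i)) <=
  M * (jumps s j + 2 * \sum_k (last_layer j k)%:R).
Proof.
move=> us M0 phiM; pose chi k : R := (k \in s)%:R.
rewrite (big_uniq _ us)/= big_mkcond/=.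
rewrite (eq_bigr (fun k : index => chi k * phi (shift_index j (fun i => k i)) -
    chi k * phi (fun i => k i))); last first.
  by move=> k _; rewrite /chi; case: (k \in s); rewrite ?mul1r ?mul0r ?subrr.
rewrite sumrB [X in _ - X](reindex_inj (@next_cell_inj j))/= -sumrB.
rewrite /jumps mulr_sumr -big_split/= mulr_sumr; apply: ler_sum => k _.
have [kl|kl] := boolP (last_layer j k); rewrite /=; last first.
  rewrite mulr0 addr0 (next_cellE kl) -mulrBl (le_trans (ler_norm _))// normrM mulrC.
  rewrite ler_pM//; rewrite /chi; case: (k \in s); case: (_ \in s) => /=;
    by rewrite ?subrr ?subr0 ?sub0r ?normrN ?normr1 ?normr0.
rewrite add0r mulr1 (le_trans (ler_norm _))// (le_trans (ler_normB _ _))//.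
have c1 k' : `|chi k'| <= 1 by rewrite /chi ger0_norm// lern1 leq_b1.
rewrite mulr_natr mulr2n !normrM lerD// -[leRHS]mul1r ler_pM//.
Qed.

Lemma figure_perimeter s : uniq s ->
  (perimeter (@figure R d n s) <= (\sum_j (face_area j * jumps s j + 2))%:E)%E.
Proof.
move=> us; have mF := @measurable_figure R d n s.
have Foo := @figure_lty R d n s.
apply: variation_le; first exact: integrable_indic_lty.
move=> v vC1 sv v1; rewrite integral_indic_divergence//.
apply: ler_sum => j _; rewrite Rintegral_figure//; last first.
  apply: integrable_partial => //; [exact: measurable_box|exact: leb_cube_lty].
have lim : (fun m => \sum_(k <- s)
    (slab_flux v j m (grid_lo R n (fun i => k i)) (grid_hi R n (fun i => k i))
       (grid_hi R n (fun i => k i) 0 j) -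
     slab_flux v j m (grid_lo R n (fun i => k i)) (grid_hi R n (fun i => k i))
       (grid_lo R n (fun i => k i) 0 j))) @ \oo -->
    \sum_(k <- s) \int[leb R d]_(x in grid_cell k)
      'D_(delta_mx 0 j) (fun x => v x 0 j) x.
  apply: cvg_sum_seq => k; apply: box_flux => // i; exact: grid_lo_hi.
apply: (cvgr_to_le lim); apply: nearW => m.
pose phi (k : 'I_d -> nat) := slab_flux v j m (grid_lo R n k) (grid_hi R n k)
  (grid_lo R n k 0 j).
(* The slab depends on the corners only off the coordinate [j], so the upper face of a cell is the
   lower face of its neighbour. *)
have phiE k : slab_flux v j m (grid_lo R n (fun i => k i)) (grid_hi R n (fun i => k i))
    (grid_hi R n (fun i => k i) 0 j) = phi (shift_index j (fun i => k i)).
  rewrite /phi /slab_flux; congr (_ * _).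
  have -> : grid_lo R n (shift_index j (fun i => k i)) 0 j =
      grid_hi R n (fun i => k i) 0 j by rewrite !mxE /shift_index eqxx.
  have e1 c : set_coord (grid_lo R n (shift_index j (fun i => k i))) j c =
      set_coord (grid_lo R n (fun i => k i)) j c.
    by apply/rowP => i; rewrite !mxE /shift_index; case: eqP.
  have e2 c : set_coord (grid_hi R n (shift_index j (fun i => k i))) j c =
      set_coord (grid_hi R n (fun i => k i)) j c.
    by apply/rowP => i; rewrite !mxE /shift_index; case: eqP.
  by rewrite e1 e2.
under eq_bigr do rewrite phiE.
apply: le_trans (summation_by_parts (phi := phi) j us (ltW (face_area_gt0 j)) _) _.
  move=> k; rewrite (le_trans (slab_flux_le _ _ _ _ _ _ _))//.
  - by move=> i; rewrite ltW// grid_lo_hi.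
  - by under eq_bigr do rewrite grid_side.
by rewrite mulrDr lerD2l mulrCA last_layer_area mulr1.
Qed.

Definition figureBV s (us : uniq s) : cubeBV R d :=
  CubeBV (And3 (bounded_sub_cube (@sub_figure_cube R d n s)) (@measurable_figure R d n s)
    (le_lt_trans (figure_perimeter us) (ltry _))) (@sub_figure_cube R d n s).

End figure_perimeter.

(** Coarea argument: integrate the number of separated pairs over the
    thresholds in [1/4, 3/4]. *)
Lemma separating_threshold (R : realType) (I : Type) (s : seq I) (x y ar : I -> R) :
  (forall i, 0 <= ar i) ->
  exists2 t : R, 4^-1 <= t <= 3 / 4 &
    \sum_(i <- s) ar i * ((t < x i) != (t < y i))%:R <=
    2 * (\sum_(i <- s) ar i * `|x i - y i|) + 1.
Proof.
move=> ar0; set M := \sum_(i <- s) ar i * `|x i - y i|.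
have M0 : 0 <= M by apply: sumr_ge0 => i _; rewrite mulr_ge0.
(* Otherwise the sum exceeds [2 * M + 1] at every threshold of an interval of length 1/2, so its
   integral is at least [M + 1/2], while pair by pair that integral is at most [M]. *)
apply: contrapT => H.
pose mu := @lebesgue_measure R.
pose D : set (measurableTypeR R) := `[4^-1, (3 / 4)]%classic.
(* Half-open, so that [t] lies in it exactly when the strict comparisons [t < x i] and [t < y i]
   disagree. *)
pose J i : set (measurableTypeR R) := [set` Interval
  (BLeft (Num.min (x i) (y i))) (BLeft (Num.max (x i) (y i)))].
have mD : measurable D by exact: measurable_itv.
have mJ i : measurable (J i) by exact: measurable_itv.
have JE i (t : R) : \1_(J i) t = ((t < x i) != (t < y i))%:R :> R.
  rewrite indicE; congr (_ %:R); rewrite mem_setE in_itv/= ge_min lt_max !leNgt.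
  by case: (t < x i); case: (t < y i).
have muD : mu D = (1 / 2)%:E.
  rewrite /mu /D lebesgue_measure_itv/= lte_fin ifT; last by lra.
  by rewrite -EFinD; congr EFin; field.
have Doo : (mu D < +oo)%E by rewrite muD ltry.
have intJ i : mu.-integrable D (EFin \o (fun t => ar i * \1_(J i) t)).
  apply: measurable_bounded_integrable => //.
    by apply: measurable_funM => //; apply: measurable_indic; apply: mJ.
  exists (ar i); split; first exact: num_real.
  move=> z arz t _ /=; rewrite normrM (ger0_norm (ar0 i)) (le_trans _ (ltW arz))//.
  by rewrite ler_piMr// indicE ger0_norm// lern1 leq_b1.
have [iS SE] := RintegralD_seq s mD intJ.
have up : \int[mu]_(t in D) (\sum_(i <- s) ar i * \1_(J i) t) <= M.
  rewrite SE; apply: ler_sum => i _.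
  rewrite RintegralZl//; last first.
    apply: measurable_bounded_integrable => //.
    exists 1; split; first exact: num_real.
    move=> z z1 t _ /=; rewrite (le_trans _ (ltW z1))//.
    by rewrite indicE ger0_norm// lern1 leq_b1.
  rewrite ler_wpM2l// /Rintegral integral_indic//.
  have mJE : mu (J i) = `|x i - y i|%:E.
    rewrite /mu /J lebesgue_measure_itv/= lte_fin.
    have [xy|xy|->] := ltgtP (x i) (y i).
    - by rewrite xy ltr0_norm ?subr_lt0// opprB.
    - by rewrite xy gtr0_norm ?subr_gt0.
    - by rewrite ltxx subrr normr0.
  have le : (mu (J i `&` D) <= `|x i - y i|%:E)%E.
    by rewrite -mJE; apply: le_measure; rewrite ?inE//; exact: measurableI.
  by rewrite -lee_fin fineK// ge0_fin_numE// (le_lt_trans le)// ltry.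
have low : (2 * M + 1) * (1 / 2) <= \int[mu]_(t in D) (\sum_(i <- s) ar i * \1_(J i) t).
  rewrite -[1 / 2]/(fine (1 / 2)%:E) -muD -Rintegral_cst//.
  apply: le_Rintegral => //.
    apply: measurable_bounded_integrable => //.
    exists (2 * M + 1); split; first exact: num_real.
    by move=> z Mz t _ /=; rewrite ger0_norm ?(ltW Mz)// addr_ge0// mulr_ge0.
  move=> t Dt; rewrite leNgt; apply/negP => lt; apply: H; exists t.
    by move: Dt; rewrite /D/= in_itv.
  by under eq_bigr do rewrite -JE; exact: ltW.
have := le_trans low up; lra.
Qed.

(** * Differences over neighbouring grid cells *)

Section grid_pairs.
Context (R : realType) (d n : nat).
Local Notation index := {ffun 'I_d -> 'I_(2 ^ n)}.
Variable u : Rd R d -> R.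
Hypotheses (iu : (leb R d).-integrable setT (EFin \o u))
  (uoo : (variation u < +oo)%E).

Let U (k : index) : R := \int[leb R d]_(x in grid_cell k) u x.

(** Two neighbouring cells form a box halved by their common face, but consecutive such boxes
    overlap. Fixing the parity of [k j] makes the boxes disjoint, and the signs of the differences
    serve as coefficients. *)
Let parity_pairs_estimate (j : 'I_d) (r : bool) :
  \sum_(k <- enum index | ~~ last_layer j k && (odd (k j) == r))
    `|U k - U (next_cell j k)| <= 2^-1 ^+ n * fine (variation u).
Proof.
have N0 : 0 < 2 ^+ n :> R by rewrite exprn_gt0.
pose P (k : index) := ~~ last_layer j k && (odd (k j) == r).
pose up (k : index) := shift_index j (fun i => k i).
pose a (k : index) := grid_lo R n (fun i => k i).
pose b (k : index) := grid_hi R n (up k).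
have midE k : (a k 0 j + b k 0 j) / 2 = (k j).+1%:R / 2 ^+ n.
  by rewrite !mxE /up /shift_index eqxx -[(k j).+2%:R]natr1 -[(k j).+1%:R]natr1;
    field; rewrite ?expf_neq0 ?pnatr_eq0.
have lowE k : box (a k) (set_coord (b k) j ((k j).+1%:R / 2 ^+ n)) = grid_cell k.
  congr box; apply/rowP => i; rewrite !mxE /up /shift_index.
  by case: eqP => // ->.
have upE k : P k -> box (set_coord (a k) j ((k j).+1%:R / 2 ^+ n)) (b k) =
    grid_cell (next_cell j k).
  move=> /andP[kl _]; rewrite /grid_cell -(next_cellE kl); congr box.
  by apply/rowP => i; rewrite !mxE /shift_index; case: eqP => // ->.
rewrite -big_filter -[leRHS]mul1r mulrA.
apply: le_trans (pair_estimate_mem (s := [seq k <- enum index | P k]) (a := a) (b := b)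
  (j := j) (c := fun k => Num.sg (U k - U (next_cell j k))) (S := 1) (l := 2^-1 ^+ n)
  iu uoo _ _ _ _ _ _).
- rewrite (le_trans _ (ler_norm _))// le_eqVlt; apply/orP; left; apply/eqP.
  rewrite big_filter [in RHS]big_filter; apply: eq_bigr => k Pk.
  by rewrite midE lowE upE// -normrEsg.
- by rewrite exprn_gt0// invr_gt0.
- move=> k _ i; rewrite !mxE /up /shift_index; case: eqP => _;
    by rewrite ltr_pM2r ?invr_gt0// ltr_nat.
- move=> k _; rewrite !mxE /up /shift_index eqxx -[(k j).+2%:R]natr1 -[(k j).+1%:R]natr1 exprVn.
  by rewrite le_eqVlt; apply/orP; left; apply/eqP; field; rewrite ?expf_neq0 ?pnatr_eq0.
- by [].
- by move=> k _; rewrite normr_sg lern1 leq_b1.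
move=> x; set s := [seq k <- enum index | P k].
have us : uniq s by rewrite filter_uniq// enum_uniq.
(* Off [j] a common interior point forces equal indices; along [j] the boxes are two cells long, so
   the indices differ by at most 1, and equal parity makes them equal. *)
have uq k k' : k \in s -> k' \in s -> open_box (a k) (b k) x ->
    open_box (a k') (b k') x -> k = k'.
  rewrite !mem_filter => /andP[/andP[_ /eqP kr] _] /andP[/andP[_ /eqP k'r] _] kx k'x.
  apply/ffunP => i; have := k'x i; have := kx i; rewrite !mxE /up /shift_index.
  rewrite !ltr_pdivrMr// !ltr_pdivlMr// => /andP[h1 h2] /andP[h3 h4].
  have := lt_trans h1 h4; have := lt_trans h3 h2; rewrite !ltr_nat.
  move=> l1 l2; apply/val_inj => /=; move: l1 l2; case: eqP => [ij|_].
    by rewrite -ij in kr k'r; move: kr k'r; clear; lia.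
  by clear; lia.
have [/hasP[k ks kx]|/hasPn H] := boolP (has (fun k => x \in open_box (a k) (b k)) s).
  rewrite (bigD1_seq k)//= big1_seq ?addr0 ?indicE ?lern1 ?leq_b1//.
  move=> k' /andP[kk' k's]; rewrite indicE; case: (boolP (x \in _)) => // k'x.
  by move: kk'; rewrite (uq k' k)// ?eqxx//; exact: set_mem.
rewrite big1_seq// => k /andP[_ ks]; rewrite indicE; have := H k ks.
by case: (x \in _).
Qed.

Lemma grid_pairs_estimate (j : 'I_d) :
  \sum_(k : index | ~~ last_layer j k) `|U k - U (next_cell j k)| <=
    2 * 2^-1 ^+ n * fine (variation u).
Proof.
rewrite (bigID (fun k : index => odd (k j)))/= -mulrA mulr_natl mulr2n.
have := lerD (parity_pairs_estimate j true) (parity_pairs_estimate j false).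
rewrite !big_enum_cond/=; congr (_ + _ <= _); apply: eq_bigl => k.
  by rewrite ?inE eqb_id.
by rewrite ?inE eqbF_neg.
Qed.

End grid_pairs.

(** * Approximation of measurable sets by figures *)

Section grid_approximation.
Context (R : realType) (d : nat).
Implicit Types (A B E : set (Rd R d)).

Let vol A : R := fine (leb R d A).

Let volP A : (leb R d A < +oo)%E -> (vol A)%:E = leb R d A.
Proof. by move=> Aoo; rewrite fineK// ge0_fin_numE. Qed.

Lemma volume_ge0 A : 0 <= fine (leb R d A).
Proof. exact: fine_ge0. Qed.

Lemma le_volume A B : measurable A -> measurable B -> (leb R d B < +oo)%E ->
  A `<=` B -> fine (leb R d A) <= fine (leb R d B).
Proof.
move=> mA mB Boo AB; have le : (leb R d A <= leb R d B)%E.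
  by apply: le_measure; rewrite ?inE.
by rewrite -lee_fin !fineK// ge0_fin_numE// (le_lt_trans le).
Qed.

Lemma volumeU_le A B : measurable A -> measurable B ->
  (leb R d A < +oo)%E -> (leb R d B < +oo)%E ->
  fine (leb R d (A `|` B)) <= fine (leb R d A) + fine (leb R d B).
Proof.
move=> mA mB Aoo Boo; have le : (leb R d (A `|` B) <= leb R d A + leb R d B)%E.
  exact: measureU2.
have ABoo : (leb R d A + leb R d B < +oo)%E by rewrite lte_add_pinfty.
by rewrite -lee_fin EFinD !fineK// ge0_fin_numE// (le_lt_trans le).
Qed.

(** How far [A] is, in measure, from the union of the cells of generation [n]
    of which it fills at least half. *)
Definition grid_err n A : R :=
  \sum_(k : {ffun 'I_d -> 'I_(2 ^ n)})
    Num.min (vol (grid_cell k `&` A)) (vol (grid_cell k `\` A)).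

Lemma grid_err_ge0 n A : 0 <= grid_err n A.
Proof. by apply: sumr_ge0 => k _; rewrite le_min !volume_ge0. Qed.

Lemma grid_errC n A : grid_err n (~` A) = grid_err n A.
Proof. by apply: eq_bigr => k _; rewrite minC setDE setCK -setDE. Qed.

Let sub_cell_lty n (k : {ffun 'I_d -> 'I_(2 ^ n)}) A :
  measurable A -> A `<=` grid_cell k -> (leb R d A < +oo)%E.
Proof.
move=> mA Ak; apply: le_lt_trans (grid_cell_lty R k); apply: le_measure; rewrite ?inE//.
exact: measurable_grid_cell.
Qed.

Lemma grid_errU n A B : measurable A -> measurable B ->
  grid_err n (A `|` B) <= grid_err n A + grid_err n B.
Proof.
move=> mA mB; rewrite /grid_err -big_split/=; apply: ler_sum => k _.
have mk := @measurable_grid_cell R d n k.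
have [mkA mkB] : measurable (grid_cell k `&` A) /\ measurable (grid_cell k `&` B).
  by split; exact: measurableI.
have [mkA' mkB'] : measurable (grid_cell k `\` A) /\ measurable (grid_cell k `\` B).
  by split; exact: measurableD.
have mAB : measurable (A `|` B) by exact: measurableU.
have h1 : vol (grid_cell k `&` (A `|` B)) <=
    vol (grid_cell k `&` A) + vol (grid_cell k `&` B).
  by rewrite setIUr; apply: volumeU_le => //; apply: (@sub_cell_lty n k) => //; exact: subIsetl.
have h2 : vol (grid_cell k `\` (A `|` B)) <= vol (grid_cell k `\` A).
  apply: le_volume => //; first exact: measurableD.
    by apply: (@sub_cell_lty n k) => //; exact: subDsetl.
  by apply: setDS; exact: subsetUl.
have h3 : vol (grid_cell k `\` (A `|` B)) <= vol (grid_cell k `\` B).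
  apply: le_volume => //; first exact: measurableD.
    by apply: (@sub_cell_lty n k) => //; exact: subDsetl.
  by apply: setDS; exact: subsetUr.
have := volume_ge0 (grid_cell k `&` A); have := volume_ge0 (grid_cell k `&` B).
have := volume_ge0 (grid_cell k `\` A); have := volume_ge0 (grid_cell k `\` B).
rewrite -!/(vol _).
case: (leP (vol (grid_cell k `&` (A `|` B))) _); case: (leP (vol (grid_cell k `&` A)) _);
  by case: (leP (vol (grid_cell k `&` B)) _) => *; lra.
Qed.

Lemma volume_grid n E : measurable E ->
  \sum_(k : {ffun 'I_d -> 'I_(2 ^ n)}) fine (leb R d (grid_cell k `&` E)) =
  fine (leb R d (cube R d `&` E)).
Proof.
move=> mE; have H A : measurable A -> fine (leb R d (A `&` E)) =
    \int[leb R d]_(x in A) \1_E x.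
  by move=> mA; rewrite /Rintegral integral_indic// setIC.
rewrite H; last exact: measurable_box.
rewrite -(figure_enum R d n) Rintegral_figure ?enum_uniq//.
  by rewrite big_enum; apply: eq_bigr => k _; rewrite H//; exact: measurable_grid_cell.
apply: measurable_bounded_integrable; rewrite ?leb_cube_lty//; first exact: measurable_box.
exists 1; split; first exact: num_real.
by move=> y y1 x _; rewrite /= indicE ger0_norm// (le_trans _ (ltW y1))// lern1 leq_b1.
Qed.

Lemma grid_err_near n A B : measurable A -> measurable B ->
  grid_err n A <= grid_err n B + fine (leb R d (cube R d `&` (A `+` B))).
Proof.
move=> mA mB; have mAB : measurable (A `+` B).
  by rewrite /setY; apply: measurableU; exact: measurableD.
rewrite -(volume_grid n mAB) /grid_err -big_split/=; apply: ler_sum => k _.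
have mk := @measurable_grid_cell R d n k.
have h1 : vol (grid_cell k `&` A) <=
    vol (grid_cell k `&` B) + vol (grid_cell k `&` (A `+` B)).
  apply: le_trans (volumeU_le _ _ _ _).
  - apply: le_volume; try exact: measurableI.
    + by apply: measurableU; exact: measurableI.
    + apply: (@sub_cell_lty n k); first by apply: measurableU; exact: measurableI.
      by rewrite subUset; split; exact: subIsetl.
    + move=> x [kx Ax]; have [Bx|Bx] := pselect (B x); [by left|right; split => //].
      by left.
  - exact: measurableI.
  - exact: measurableI.
  - by apply: (@sub_cell_lty n k); [exact: measurableI|exact: subIsetl].
  - by apply: (@sub_cell_lty n k); [exact: measurableI|exact: subIsetl].
have h2 : vol (grid_cell k `\` A) <=
    vol (grid_cell k `\` B) + vol (grid_cell k `&` (A `+` B)).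
  have mkB : measurable (grid_cell k `\` B) by exact: measurableD.
  have mkAB : measurable (grid_cell k `&` (A `+` B)) by exact: measurableI.
  apply: le_trans (volumeU_le _ _ _ _) => //.
  - apply: le_volume; [exact: measurableD|exact: measurableU| |].
      apply: (@sub_cell_lty n k); first exact: measurableU.
      by rewrite subUset; split; [exact: subDsetl|exact: subIsetl].
    move=> x [kx Ax]; have [Bx|Bx] := pselect (B x); [right; split => //|by left].
    by right.
  - by apply: (@sub_cell_lty n k) => //; exact: subDsetl.
  - by apply: (@sub_cell_lty n k) => //; exact: subIsetl.
case: (leP (vol (grid_cell k `&` A)) _); case: (leP (vol (grid_cell k `&` B)) _);
  by move: h1 h2; rewrite -!/(vol _) => *; lra.
Qed.

(** Only the cells meeting the plane contribute, and they lie in a slab of thickness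
    [2 * 2^-1 ^+ n]. The two inclusions leave the plane itself free, which covers open and closed
    half-spaces. *)
Lemma grid_err_halfspace n (j : 'I_d) (c : R) A : measurable A ->
  (forall x : 'rV[R]_d, x 0 j < c -> A x) ->
  (forall x : 'rV[R]_d, A x -> x 0 j <= c) ->
  grid_err n A <= 2 * 2^-1 ^+ n.
Proof.
move=> mA cA Ac.
pose a : 'rV[R]_d := set_coord 0 j (c - 2^-1 ^+ n).
pose b : 'rV[R]_d := set_coord (const_mx 1) j (c + 2^-1 ^+ n).
have e0 : 0 < 2^-1 ^+ n :> R by rewrite exprn_gt0// invr_gt0.
have mab := @measurable_box R d a b.
apply: (@le_trans _ _ (vol (cube R d `&` box a b))).
  rewrite /vol -(volume_grid n mab); apply: ler_sum => k _.
  have mk := @measurable_grid_cell R d n k.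
  have [kc|kc] := ltP (grid_hi R n (fun i => k i) 0 j) c.
    rewrite (_ : grid_cell k `\` A = set0).
      by rewrite ge_min /vol measure0 volume_ge0 orbT.
    apply/seteqP; split => x //= [kx]; apply; have /andP[_] := kx j.
    by move=> /le_lt_trans /(_ kc); exact: cA.
  have [kc'|kc'] := ltP c (grid_lo R n (fun i => k i) 0 j).
    rewrite (_ : grid_cell k `&` A = set0).
      by rewrite ge_min /vol measure0 volume_ge0.
    apply/seteqP; split => x //= [kx /Ac]; rewrite leNgt => /negP; apply.
    by have /andP[+ _] := kx j; exact: lt_le_trans.
  rewrite ge_min; apply/orP; left; apply: le_volume.
  - exact: measurableI.
  - exact: measurableI.
  - by apply: (@sub_cell_lty n k); [exact: measurableI|exact: subIsetl].
  - move=> x [kx _]; split => // i; rewrite !mxE; case: eqP => [->|_].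
      have /andP[] := kx j; have := grid_side R n (fun i => k i) j.
      by move=> *; apply/andP; split; lra.
    by have := sub_grid_cell_cube kx i; rewrite !mxE.
have Coo : (leb R d (box a b) < +oo)%E by exact: leb_box_lty.
apply: (@le_trans _ _ (vol (box a b))).
  by apply: le_volume => //; apply: measurableI => //; exact: measurable_box.
rewrite -lee_fin volP// (le_trans (leb_box_le a b))// lee_fin box_volumeE; last first.
  by move=> i; rewrite !mxE; case: eqP => // _; lra.
rewrite (bigD1 j)//= big1 ?mulr1 => [|i ij]; last by rewrite !mxE (negbTE ij) subr0.
by rewrite !mxE eqxx; lra.
Qed.

End grid_approximation.

Section grid_approximation_cvg.
Context (R : realType) (d : nat).
Implicit Types (A B E : set (Rd R d)).

Definition grid_approximable A :=
  measurable A /\ (fun n => grid_err n A) @ \oo --> (0 : R).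

Lemma cvg_half_power (c : R) : (fun n => c * 2^-1 ^+ n) @ \oo --> (0 : R).
Proof.
rewrite -[X in _ --> X](mulr0 c); apply: cvgM; first exact: cvg_cst.
by apply: cvg_expr; rewrite ger0_norm// invf_lt1// ltr1n.
Qed.

Let squeeze A (f : nat -> R) : measurable A -> (forall n, grid_err n A <= f n) ->
  f @ \oo --> (0 : R) -> grid_approximable A.
Proof.
move=> mA Af f0; split => //; apply: (squeeze_cvgr _ (cvg_cst 0) f0).
by apply: nearW => n; rewrite grid_err_ge0 Af.
Qed.

Lemma grid_approximableC A : grid_approximable A -> grid_approximable (~` A).
Proof.
move=> [mA A0]; split; first exact: measurableC.
by under eq_fun do rewrite grid_errC.
Qed.

Lemma grid_approximableU A B : grid_approximable A -> grid_approximable B ->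
  grid_approximable (A `|` B).
Proof.
move=> [mA A0] [mB B0]; apply: (@squeeze _ (fun n => grid_err n A + grid_err n B)).
- exact: measurableU.
- by move=> n; exact: grid_errU.
- by rewrite -[X in _ --> X]addr0; apply: cvgD.
Qed.

Lemma grid_approximableI A B : grid_approximable A -> grid_approximable B ->
  grid_approximable (A `&` B).
Proof.
move=> A0 B0; rewrite -[_ `&` _]setCK setCI; apply: grid_approximableC.
by apply: grid_approximableU; exact: grid_approximableC.
Qed.

Lemma grid_approximable0 : grid_approximable set0.
Proof.
apply: (@squeeze _ (fun=> 0)) => //; last exact: cvg_cst.
move=> n; apply: sumr_le0 => k _.
by rewrite ge_min setI0 measure0/= lexx.
Qed.

Lemma grid_approximable_box (a b : 'rV[R]_d) : grid_approximable (box a b).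
Proof.
rewrite box_setI; elim/big_rec: _ => [|i A _ HA].
  by rewrite -setC0; apply: grid_approximableC; exact: grid_approximable0.
apply: grid_approximableI => //; apply: grid_approximableI; last apply: grid_approximableC.
- apply: (squeeze _ _ (cvg_half_power 2)) => [|n]; first exact: measurable_halfspace.
  by apply: (@grid_err_halfspace _ _ _ i (b 0 i)) => [|x /ltW|x //]; first exact: measurable_halfspace.
- apply: (squeeze _ _ (cvg_half_power 2)) => [|n]; first exact: measurable_halfspace_lt.
  by apply: (@grid_err_halfspace _ _ _ i (a 0 i)) => [|x|x /ltW //]; first exact: measurable_halfspace_lt.
Qed.

(** Take a cover by boxes that is optimal up to [e / 2], then finitely many of them that exhaust its
    union up to [e / 2]; the symmetric difference lies in the two excesses. *)
Lemma box_union_near B (e : R) : measurable B -> B `<=` cube R d -> 0 < e ->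
  exists2 A, grid_approximable A &
    fine (leb R d (cube R d `&` (B `+` A))) <= e.
Proof.
move=> mB Bc e0.
have e2 : 0 < e / 2 by rewrite divr_gt0.
have Boo : (leb R d B < +oo)%E.
  by apply: le_lt_trans (leb_cube_lty R d); apply: le_measure; rewrite ?inE//;
    exact: measurable_box.
have Bfin : leb R d B \is a fin_num by rewrite ge0_fin_numE.
have [_ [D [a [b [BD ->]]]] lt] := lb_ereal_inf_adherent e2 Bfin.
pose P k : set (Rd R d) := if k \in D then box (a k) (b k) else set0.
have mP k : measurable (P k) by rewrite /P; case: ifP => // _; exact: measurable_box.
have Ple : (\sum_(k <oo) leb R d (P k) <= leb R d B + (e / 2)%:E)%E.
  apply: le_trans (ltW lt); rewrite -(set_mem_set D) -nneseries_esum; last first.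
    by move=> k _; rewrite lee_fin box_volume_ge0.
  rewrite [leRHS]eseries_mkcond; apply: lee_nneseries => // k _; rewrite /P.
  by case: ifP => _; [exact: leb_box_le|rewrite measure0].
have BP : B `<=` \bigcup_k P k.
  by move=> x /BD[k Dk abx]; exists k => //; rewrite /P mem_set.
have Wle : (leb R d (\bigcup_k P k) <= leb R d B + (e / 2)%:E)%E.
  apply: le_trans Ple; exact: outer_measure_sigma_subadditive.
pose W := \bigcup_k P k.
have mW : measurable W by exact: bigcupT_measurable.
have Woo : (leb R d W < +oo)%E.
  by apply: le_lt_trans Wle _; rewrite lte_add_pinfty// ltry.
have Wfin : leb R d W \is a fin_num by rewrite ge0_fin_numE.
pose A K : set (Rd R d) := \big[setU/set0]_(k < K.+1) P k.
have mA K : measurable (A K) by exact: bigsetU_measurable.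
have AW K : A K `<=` W by rewrite /A -bigcup_mkord => x [k _ Pk]; exists k.
have Aapx K : grid_approximable (A K).
  rewrite /A; elim/big_rec: _ => [|k E _ HE]; first exact: grid_approximable0.
  apply: grid_approximableU => //; rewrite /P; case: ifP => _.
    exact: grid_approximable_box.
  exact: grid_approximable0.
have Alim : leb R d (A K) @[K --> \oo] --> leb R d W.
  rewrite /W -bigcup_bigsetU_bigcup; apply: nondecreasing_cvg_mu => //.
    by rewrite bigcup_bigsetU_bigcup.
  move=> m n mn; apply/subsetPset; rewrite /A -!bigcup_mkord => x [k /= km Pk].
  by exists k => //=; exact: leq_trans km _.
have /fine_cvgP[_ /cvgrPdist_le/(_ _ e2)] : leb R d (A K) @[K --> \oo] --> (fine (leb R d W))%:E.
  by rewrite fineK.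
move=> [K _ /(_ K (leqnn K))] /= AK.
exists (A K); first exact: Aapx.
have Afin : leb R d (A K) \is a fin_num.
  rewrite ge0_fin_numE//; apply: le_lt_trans Woo.
  by apply: le_measure; rewrite ?inE.
have AleW : fine (leb R d (A K)) <= fine (leb R d W) by exact: le_volume.
have dWA : (leb R d (W `\` A K) <= (e / 2)%:E)%E.
  have -> : leb R d (W `\` A K) = (leb R d W - leb R d (A K))%E.
    by rewrite measureD// setIidr.
  rewrite -(fineK Wfin) -(fineK Afin) -EFinB lee_fin.
  by apply: le_trans AK; exact: ler_norm.
have dWB : (leb R d (W `\` B) <= (e / 2)%:E)%E.
  have -> : leb R d (W `\` B) = (leb R d W - leb R d B)%E.
    by rewrite measureD// setIidr.
  rewrite -(fineK Wfin) -(fineK Bfin) -EFinB lee_fin lerBlDl.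
  by rewrite -lee_fin EFinD !fineK.
have mWA : measurable (W `\` A K) by exact: measurableD.
have mWB : measurable (W `\` B) by exact: measurableD.
have mBA : measurable (B `+` A K) by apply: measurableU; exact: measurableD.
have le : (leb R d (cube R d `&` (B `+` A K)) <= e%:E)%E.
  apply: (@le_trans _ _ (leb R d ((W `\` A K) `|` (W `\` B)))).
    apply: le_measure; rewrite ?inE.
    - by apply: measurableI => //; exact: measurable_box.
    - exact: measurableU.
    - move=> x [_ [[Bx Ax]|[Ax Bx]]]; [left|right]; split => //; first exact: BP.
      exact: AW Ax.
  apply: le_trans (measureU2 _ _ _) _ => //.
  by rewrite [e in leRHS]splitr EFinD leeD.
rewrite -lee_fin fineK// ge0_fin_numE//.
by apply: le_lt_trans le _; rewrite ltry.
Qed.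

Lemma grid_err_cvg B : measurable B -> B `<=` cube R d ->
  (fun n => grid_err n B) @ \oo --> (0 : R).
Proof.
move=> mB Bc; apply/cvgrPdist_le => e e0.
have e2 : 0 < e / 2 by rewrite divr_gt0.
have [A [mA A0] BA] := box_union_near mB Bc e2.
near=> n; rewrite sub0r normrN ger0_norm ?grid_err_ge0//.
rewrite (le_trans (grid_err_near n mB mA))// [leRHS]splitr lerD//.
near: n; have /cvgrPdist_le/(_ _ e2) := A0; apply: filterS => n.
by rewrite sub0r normrN ger0_norm ?grid_err_ge0.
Unshelve. all: by end_near. Qed.

End grid_approximation_cvg.

(** * Charges are determined by dyadic cubes *)

Section dyadic_determination.
Context (R : realType) (d : nat).
Hypothesis d_gt0 : (0 < d)%N.

Lemma charge_set0 (nu : cubeBV R d -> R) (B : cubeBV R d) :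
  is_bv_charge nu -> B = set0 :> set (Rd R d) -> nu B = 0.
Proof.
move=> [add _] B0; have : nu B = nu B + nu B.
  by apply: add; rewrite B0 ?setI0 ?setU0// measure0.
by lra.
Qed.

Lemma charge_figure0 (nu : cubeBV R d -> R) n
    (s : seq {ffun 'I_d -> 'I_(2 ^ n)}) (us : uniq s) : is_bv_charge nu ->
  (forall K : cubeBV R d, dyadic_cube K -> nu K = 0) -> nu (figureBV R us) = 0.
Proof.
move=> nuC nu0; have [add _] := nuC.
elim: s us => [|k s IH] us.
  by apply: charge_set0 => //=; rewrite /figure big_nil.
have [ks us'] := andP (us : (k \notin s) && uniq s).
pose K := boxBV (fun i => @grid_lo_hi R d n (fun i => k i) i) (@sub_grid_cell_cube R d n k).
rewrite (add K (figureBV R us')) ?IH ?addr0//=.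
- by apply: nu0; exact: dyadic_grid_cell.
- exact: figure_overlap.
- by rewrite /figure big_cons.
Qed.

Section level_set.
Variables (B : cubeBV R d) (n : nat).
Local Notation index := {ffun 'I_d -> 'I_(2 ^ n)}.
Let v : R := 2^-1 ^+ (n * d).
Let p (k : index) : R := fine (leb R d (grid_cell k `&` B)) / v.

Let v0 : 0 < v. Proof. by rewrite exprn_gt0// invr_gt0. Qed.

(** One threshold serves all directions: [separating_threshold] is applied to all pairs of
    neighbours at once, weighted by face areas. In [4 * d%:R], a 2 comes from the coarea inequality,
    a 2 from the two parities, and [d] from the directions. *)
Lemma level_set_perimeter : exists2 t : R, 4^-1 <= t <= 3 / 4 &
  \sum_j face_area R n j * jumps R [seq k <- enum index | t < p k] j <=
    4 * d%:R * fine (perimeter B) + 1.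
Proof.
have [iB Boo _] := BV_function_indic B.
pose s : seq ('I_d * index) :=
  [seq q <- enum {: 'I_d * index} | ~~ last_layer q.1 q.2].
have ar0 (q : 'I_d * index) : 0 <= face_area R n q.1 by exact/ltW/face_area_gt0.
have [t t14 H] := separating_threshold s (fun q => p q.2)
  (fun q => p (next_cell q.1 q.2)) ar0.
have sE (F : 'I_d -> index -> R) : \sum_(q <- s) F q.1 q.2 =
    \sum_j \sum_(k | ~~ last_layer j k) F j k.
  rewrite big_filter big_enum_cond/=.
  by rewrite (pair_big_dep xpredT (fun j k => ~~ last_layer j k) F).
rewrite (sE (fun j k => face_area R n j * ((t < p k) != (t < p (next_cell j k)))%:R)) in H.
rewrite (sE (fun j k => face_area R n j * `|p k - p (next_cell j k)|)) in H.
exists t => //; apply: le_trans (le_trans _ H) _.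
  rewrite le_eqVlt; apply/orP; left; apply/eqP.
  apply: eq_bigr => j _; rewrite /jumps mulr_sumr [RHS]big_mkcond; apply: eq_bigr => k _.
  have memS q : (q \in [seq k <- enum index | t < p k]) = (t < p q).
    by rewrite mem_filter mem_enum andbT.
  by rewrite !memS; case: (last_layer j k); rewrite /= ?mulr0.
rewrite lerD2r.
have -> : 4 * d%:R * fine (perimeter B) = 2 * (\sum_(j < d) 2 * fine (perimeter B)).
  by rewrite sumr_const card_ord -[_ *+ d]mulr_natr; ring.
rewrite ler_pM2l//; apply: ler_sum => j _.
have areaE : face_area R n j * 2^-1 ^+ n = v.
  rewrite /v exprM /face_area.
  have -> : (2^-1 ^+ n) ^+ d = \prod_(i < d) 2^-1 ^+ n :> R.
    by rewrite prodr_const card_ord.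
  by rewrite [in RHS](bigD1 j)//= mulrC.
have := grid_pairs_estimate n iB Boo j.
have UE (k : index) : \int[leb R d]_(x in grid_cell k) \1_B x = p k * v.
  rewrite /p divfK ?gt_eqF// /Rintegral integral_indic//.
  - by rewrite setIC.
  - exact: measurable_grid_cell.
  - exact: measurable_cubeBV.
under eq_bigr do rewrite !UE -mulrBl normrM (gtr0_norm v0).
rewrite -mulr_suml -mulr_sumr => h.
rewrite -(ler_pM2r v0) -mulrA (le_trans (ler_wpM2l (ltW (face_area_gt0 R n j)) h))//.
by rewrite -areaE le_eqVlt; apply/orP; left; apply/eqP; ring.
Qed.

(** The set [B] fills at least a quarter of a selected cell, so the part missed is at most three
    times the part filled; on a rejected cell the roles are exchanged. Hence the factor 3 against
    the minimum of the two. *)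
Lemma level_set_distance (t : R) : 4^-1 <= t <= 3 / 4 ->
  fine (leb R d (figure [seq k <- enum index | t < p k] `+` B)) <= 3 * grid_err n B.
Proof.
move=> /andP[t1 t2]; set s := [seq k <- enum index | t < p k].
have mB := measurable_cubeBV B.
have mF := @measurable_figure R d n s.
have mE : measurable (figure s `+` B) by apply: measurableU; exact: measurableD.
have -> : figure s `+` B = cube R d `&` (figure s `+` B).
  apply/esym/setIidr => x [[Fx _]|[Bx _]]; first exact: sub_figure_cube Fx.
  exact: cubeBV_sub Bx.
rewrite -(volume_grid n mE) /grid_err mulr_sumr; apply: ler_sum => k _.
have mk := @measurable_grid_cell R d n k.
have mkB : measurable (grid_cell k `&` B) by exact: measurableI.
have mkB' : measurable (grid_cell k `\` B) by exact: measurableD.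
have cellE A : measurable A -> A `<=` grid_cell k -> (leb R d A < +oo)%E.
  move=> mA Ak; apply: le_lt_trans (grid_cell_lty R k).
  by apply: le_measure; rewrite ?inE.
have oo1 : (leb R d (grid_cell k `&` B) < +oo)%E.
  by apply: cellE => //; exact: subIsetl.
have oo2 : (leb R d (grid_cell k `\` B) < +oo)%E.
  by apply: cellE => //; exact: subDsetl.
have volE : fine (leb R d (grid_cell k `&` B)) + fine (leb R d (grid_cell k `\` B)) = v.
  have E : leb R d (grid_cell k) =
      (leb R d (grid_cell k `\` B) + leb R d (grid_cell k `&` B))%E := measureDI _ mk mB.
  rewrite (leb_grid_cell R d_gt0 k) in E.
  rewrite /v -[RHS]/(fine (2^-1 ^+ (n * d))%:E) E fineD ?ge0_fin_numE//.
  by rewrite addrC.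
have pE : fine (leb R d (grid_cell k `&` B)) = p k * v by rewrite /p divfK ?gt_eqF.
have [tp|pt] := ltP t (p k).
  have ks : k \in s by rewrite mem_filter tp mem_enum.
  have le : fine (leb R d (grid_cell k `&` (figure s `+` B))) <=
      fine (leb R d (grid_cell k `\` B)).
    apply: le_volume => //; first exact: measurableI mk mE.
    move=> x [kx [[Fx Bx]//|[Bx Fx]]]; split => // _; apply: Fx.
    by apply/figureP; exists k.
  have v4 : fine (leb R d (grid_cell k `&` B)) >= 4^-1 * v.
    by rewrite pE ler_pM2r// (le_trans t1)// ltW.
  have := volume_ge0 (grid_cell k `\` B).
  by rewrite minEle; case: ifP => _; lra.
have ks : k \notin s by rewrite mem_filter negb_and -leNgt pt.
have le : fine (leb R d (grid_cell k `&` (figure s `+` B))) <=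
    fine (leb R d (grid_cell k `&` B)).
  have mkF : @measurable _ (Rd R d) (grid_cell k `&` figure s) by exact: measurableI mk mF.
  apply: (@le_trans _ _ (fine (leb R d (((grid_cell k : set (Rd R d)) `&` B) `|` (grid_cell k `&` figure s))))).
    apply: le_volume; [exact: measurableI mk mE|exact: measurableU| |].
      by apply: cellE; [exact: measurableU|rewrite subUset; split; exact: subIsetl].
    by move=> x [kx [[Fx Bx]|[Bx Fx]]]; [right|left].
  (* The cells of the figure meet the rejected closed cell [k] in a null set only. *)
  rewrite measureU0//; exact: figure_overlap.
have v4 : fine (leb R d (grid_cell k `&` B)) <= 3 / 4 * v.
  by rewrite pE ler_pM2r// (le_trans pt).
have := volume_ge0 (grid_cell k `&` B).
by rewrite minEle; case: ifP => _; lra.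
Qed.

End level_set.

(** Threshold the conditional expectation of the indicator of [B] on the cells
    of generation [n]: the coarea argument bounds the perimeters of these level
    sets, which [BV]-converge to [B]. *)
Lemma charge_eq0 (nu : cubeBV R d -> R) : is_bv_charge nu ->
  (forall K : cubeBV R d, dyadic_cube K -> nu K = 0) -> forall B, nu B = 0.
Proof.
move=> nuC nu0 B.
have /choice[t Ht] : forall n, exists t : R, 4^-1 <= t <= 3 / 4 /\
    \sum_j face_area R n j * jumps R [seq k <- enum {ffun 'I_d -> 'I_(2 ^ n)} |
      t < fine (leb R d (grid_cell k `&` B)) / 2^-1 ^+ (n * d)] j <=
    4 * d%:R * fine (perimeter B) + 1.
  by move=> n; have [t t1 t2] := level_set_perimeter B n; exists t.
pose S n := [seq k <- enum {ffun 'I_d -> 'I_(2 ^ n)} |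
  t n < fine (leb R d (grid_cell k `&` B)) / 2^-1 ^+ (n * d)].
have uS n : uniq (S n) by rewrite filter_uniq// enum_uniq.
pose F n := figureBV R (uS n).
have FB : BV_cvg F B.
  split.
    have FBoo n : (leb R d (F n `+` B) < +oo)%E.
      apply: le_lt_trans (leb_cube_lty R d); apply: le_measure; rewrite ?inE.
      - by apply: measurableU; apply: measurableD; exact: measurable_cubeBV.
      - exact: measurable_box.
      - by move=> x [[Fx _]|[Bx _]]; [exact: cubeBV_sub Fx|exact: cubeBV_sub Bx].
    apply: cvg_EFin; first by apply: nearW => n; rewrite ge0_fin_numE.
    have H := grid_err_cvg (measurable_cubeBV B) (@cubeBV_sub _ _ B).
    apply: (@squeeze_cvgr _ _ _ _ (fun=> 0) (fun n => 3 * grid_err n B)).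
    - by apply: nearW => n /=; rewrite volume_ge0 level_set_distance//; have [] := Ht n.
    - exact: cvg_cst.
    - by rewrite -[X in _ --> X](mulr0 3); apply: cvgM => //; exact: cvg_cst.
  apply: (@le_lt_trans _ _ (4 * d%:R * fine (perimeter B) + 1 + d%:R * 2)%:E).
    apply: ge_ereal_sup => _ [n _ <-]; apply: le_trans (figure_perimeter R (uS n)) _.
    rewrite lee_fin big_split/= sumr_const card_ord -[2 *+ d]mulr_natl lerD2r.
    by have [] := Ht n.
  by rewrite ltry.
have := nuC.2 F B FB; rewrite (_ : nu \o F = fun=> 0); last first.
  by apply/funext => n; exact: charge_figure0.
by move=> /(cvg_lim (@Rhausdorff R)) <-; rewrite lim_cst.
Qed.

End dyadic_determination.

(** * Construction of the product *)

Section cells_and_charges.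
Context (R : realType) (d : nat).
Hypothesis d_gt0 : (0 < d)%N.
Implicit Types (w : seq bool) (nu : cubeBV R d -> R) (f : cube R d -> R).

Definition cellBV w : cubeBV R d :=
  boxBV (@cell_lo_hi R d d_gt0 w) (@sub_cell_cube R d d_gt0 w).

Definition cell_charge nu w : R := nu (cellBV w).

Lemma cell_lo_cube w : cell_lo R d_gt0 w \in cube R d.
Proof.
apply/mem_set; apply: (@sub_cell_cube R d d_gt0 w) => i.
by rewrite lexx ltW// cell_lo_hi.
Qed.

Definition corner w : cube R d := SigSub (cell_lo_cube w).

Lemma corner_cell v w : cell d_gt0 w (val (corner (v ++ w))).
Proof.
apply: (@sub_cell_cat R d d_gt0 v w) => i /=.
by rewrite lexx ltW// cell_lo_hi.
Qed.

Lemma cell_charge_additive nu : is_bv_charge nu -> tree_additive (cell_charge nu).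
Proof.
by move=> [add _] w; apply: add; [exact: cell_split_null|exact: cell_split].
Qed.

Lemma tree_additive_words (om : seq bool -> R) n w : tree_additive om ->
  om w = \sum_(v <- words n) om (v ++ w).
Proof.
move=> omA; elim: n => [|n IH]; first by rewrite big_seq1.
by rewrite big_words IH; apply: eq_bigr => v _; rewrite omA.
Qed.

Lemma sum_words_cst n (c : R) : \sum_(v <- words n) c = 2 ^+ n * c.
Proof.
elim: n => [|n IH]; first by rewrite big_seq1 mul1r.
by rewrite big_words big_split/= IH exprS; ring.
Qed.

Lemma norm_sum_words_le n (F : seq bool -> R) c :
  (forall v, v \in words n -> `|F v| <= c) ->
  `|\sum_(v <- words n) F v| <= 2 ^+ n * c.
Proof.
move=> Fc; rewrite (le_trans (ler_norm_sum _ _ _))// -sum_words_cst.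
by rewrite big_seq [leRHS]big_seq; apply: ler_sum.
Qed.

Section exponents.
Variables (beta gamma : R).
Hypotheses (beta01 : 0 < beta < 1) (gamma01 : 0 < gamma < 1)
  (beta_gamma : d%:R < beta + d%:R * gamma).

(** This and [holder_ratio] are the factors per halving of the volume to the power [gamma] and of
    the scale of the sides to the power [beta]. *)
Definition volume_ratio : R := 2 `^ (- gamma).
Definition holder_ratio : R := 2 `^ (- (beta / d%:R)).
Local Notation eta := volume_ratio.
Local Notation sigma := holder_ratio.

Let d0 : 0 < d%:R :> R. Proof. by rewrite ltr0n. Qed.

Lemma volume_ratio01 : 0 < eta <= 1.
Proof.
have /andP[g0 g1] := gamma01.
by rewrite powR_gt0//= ltW// powR2_lt1// oppr_lt0.
Qed.

Lemma holder_ratio01 : 0 < sigma <= 1.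
Proof.
have /andP[b0 b1] := beta01.
by rewrite powR_gt0//= ltW// powR2_lt1// oppr_lt0 divr_gt0.
Qed.

Lemma side_holder_ratio : side_ratio R d <= sigma.
Proof.
have /andP[b0 b1] := beta01.
apply: ler_powR; first by rewrite ler1n.
by rewrite lerN2 ler_piMl ?invr_ge0 ?(ltW d0)// ltW.
Qed.

Lemma side_ratio_powR : side_ratio R d `^ beta = sigma.
Proof. by rewrite -powRrM mulNr mulrC. Qed.

(** The exponent of 2 is [1 - gamma - beta / d], which is negative by [beta_gamma] divided by
    [d]. *)
Lemma rate_lt1 : 2 * eta * sigma < 1.
Proof.
rewrite -[X in X * _ * _](@powRr1 _ 2)// -!powRD ?pnatr_eq0 ?implybT//.
apply: powR2_lt1; rewrite -(pmulr_llt0 _ d0) !mulrDl mul1r [- gamma * _]mulNr mulNr.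
rewrite divfK ?gt_eqF//; move: beta_gamma; rewrite [d%:R * _]mulrC => h.
by rewrite -addrA -opprD subr_lt0 addrC.
Qed.

Lemma powR_exprn (x e : R) m : 0 <= x -> (x ^+ m) `^ e = (x `^ e) ^+ m.
Proof.
move=> x0; elim: m => [|m IH]; first by rewrite !expr0 powR1.
by rewrite !exprS powRM ?exprn_ge0// IH.
Qed.

Lemma half_powR (e : R) m : (2^-1 ^+ m) `^ e = (2 `^ (- e)) ^+ m.
Proof. by rewrite powR_exprn ?invr_ge0// -powR_inv1// -powRrM mulN1r. Qed.

Lemma fine_leb_cell w : fine (leb R d (cell d_gt0 w)) = 2^-1 ^+ size w.
Proof. by rewrite leb_cell. Qed.

(** Charges act on records, not on sets, so equal sets have to be turned into equal records; their
    proof components agree by proof irrelevance. *)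
Lemma cubeBV_cell (K : cubeBV R d) w : K = cell d_gt0 w :> set _ -> K = cellBV w.
Proof.
case: K => K bK sK /= Kw; rewrite /cellBV /boxBV; move: bK sK; rewrite Kw => bK sK.
by congr CubeBV; exact: Prop_irrelevance.
Qed.

Lemma holder_norm_le nu (H : R) :
  (forall n w, size w = (n * d)%N -> `|cell_charge nu w| <= H * eta ^+ size w) ->
  (holder_norm gamma nu <= H%:E)%E.
Proof.
move=> nuH; apply: ge_ereal_sup => _ [K /dyadic_cubeP[n [w wn Kw]] <-].
rewrite (cubeBV_cell Kw) lee_fin fine_leb_cell half_powR ler_pdivrMr ?exprn_gt0 ?powR_gt0//.
exact: nuH wn.
Qed.

Section holder_charge.
Variable nu : cubeBV R d -> R.
Hypothesis nuH : nu \in holder_charge_pred gamma.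
Local Notation H := (fine (holder_norm gamma nu)).

Lemma holder_norm_fin : holder_norm gamma nu \is a fin_num.
Proof.
have /asboolP[_ noo] := nuH; rewrite ge0_fin_numE//.
apply: (@le_trans _ _ (`|nu (cellBV [::])| / fine (leb R d (cellBV [::])) `^ gamma)%:E).
  by rewrite lee_fin divr_ge0// powR_ge0.
apply: ereal_sup_ubound; exists (cellBV [::]) => //.
exact: (@dyadic_cell R d d_gt0 0).
Qed.

Lemma holder_norm_ge0 : 0 <= H.
Proof.
rewrite -lee_fin fineK ?holder_norm_fin//.
apply: (@le_trans _ _ (`|nu (cellBV [::])| / fine (leb R d (cellBV [::])) `^ gamma)%:E).
  by rewrite lee_fin divr_ge0// powR_ge0.
apply: ereal_sup_ubound; exists (cellBV [::]) => //.
exact: (@dyadic_cell R d d_gt0 0).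
Qed.

Lemma dyadic_charge_le n w : size w = (n * d)%N ->
  `|cell_charge nu w| <= H * eta ^+ size w.
Proof.
move=> wn; rewrite -half_powR -ler_pdivrMr ?powR_gt0 ?exprn_gt0 ?invr_gt0//.
rewrite -lee_fin fineK ?holder_norm_fin//; apply: ereal_sup_ubound.
exists (cellBV w); first exact: dyadic_cell wn.
by rewrite /= fine_leb_cell.
Qed.

(** [holder_norm] sees dyadic cubes only, that is the levels divisible by [d]. Any other cell splits
    into the dyadic cubes of a lower level, at most [d] halvings below, whence the factor
    [2 ^+ d]. *)
Lemma cell_charge_le w : `|cell_charge nu w| <= 2 ^+ d * H * eta ^+ size w.
Proof.
have /andP[e0 e1] := volume_ratio01; have H0 := holder_norm_ge0.
have /asboolP[nuC _] := nuH.
pose n := (size w %/ d).+1; pose k := (n * d - size w)%N.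
have kd : (k <= d)%N by rewrite leq_subLR mulSn addnC leq_add2r leq_divM.
rewrite (tree_additive_words k w (cell_charge_additive nuC)).
apply: le_trans (norm_sum_words_le (c := H * eta ^+ size w) _) _.
  move=> v vk; have vw : size (v ++ w) = (n * d)%N.
    by rewrite size_cat (size_words vk) subnK// ltnW// ltn_ceil.
  rewrite (le_trans (dyadic_charge_le vw))// ler_wpM2l// ler_wiXn2l// ?(ltW e0)//.
  by rewrite size_cat leq_addl.
rewrite mulrA ler_wpM2r ?exprn_ge0 ?(ltW e0)// ler_wpM2r// ler_weXn2l//.
by rewrite ler1n.
Qed.

End holder_charge.

Section holder_function.
Variable f : cube R d -> R.
Hypothesis fH : f \in holder_pred beta.
Local Notation L := (fine (lip beta f)).

(** A second point of the cube, which exists as [d] is positive: with it the supremum in [lip] runs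
    over a nonempty set and is nonnegative. *)
Let x1 : cube R d. Proof.
by exists (const_mx 1); apply/mem_set => i; rewrite !mxE ler01 lexx.
Defined.

Let x01 : corner [::] != x1.
Proof.
apply/eqP => /(congr1 (fun x : cube R d => (val x : 'rV[R]_d) 0 (Ordinal d_gt0))) /=.
by rewrite !mxE /= mul0r => /eqP; rewrite eq_sym oner_eq0.
Qed.

Lemma lip_ge0e : (0 <= lip beta f)%E.
Proof.
apply: (@le_trans _ _
  (`|f (corner [::]) - f x1| / enorm (val (corner [::]) - val x1) `^ beta)%:E).
  by rewrite lee_fin divr_ge0// powR_ge0.
by apply: ereal_sup_ubound; exists (corner [::], x1); first exact: x01.
Qed.

Lemma lip_fin : lip beta f \is a fin_num.
Proof. by rewrite ge0_fin_numE ?lip_ge0e//; exact/asboolP. Qed.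

Lemma lip_ge0 : 0 <= L. Proof. exact/fine_ge0/lip_ge0e. Qed.

Lemma enorm_gt0 (x : 'rV[R]_d) : x != 0 -> 0 < enorm x.
Proof.
move=> x0; rewrite sqrtr_gt0 lt_neqAle sumr_ge0 ?andbT => [|i _]; last exact: sqr_ge0.
rewrite eq_sym psumr_neq0 => [|i _]; last exact: sqr_ge0.
apply/hasP; have [i xi] : exists i, x 0 i != 0.
  apply/existsP; apply: contraNT x0; rewrite negb_exists => /forallP x0.
  by apply/eqP/rowP => i; rewrite mxE; apply/eqP; have := x0 i; rewrite negbK.
by exists i; rewrite ?mem_index_enum//= lt_neqAle sqr_ge0 eq_sym sqrf_eq0 xi.
Qed.

Lemma lip_le (x y : cube R d) s : enorm (val x - val y) <= s ->
  `|f x - f y| <= L * s `^ beta.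
Proof.
move=> xys; have /andP[b0 _] := beta01.
have s0 : 0 <= s by apply: le_trans xys; exact: sqrtr_ge0.
have [->|xy] := eqVneq x y.
  by rewrite subrr normr0 mulr_ge0 ?lip_ge0 ?powR_ge0.
have e0 : 0 < enorm (val x - val y).
  by apply: enorm_gt0; rewrite subr_eq0 (inj_eq val_inj).
apply: (@le_trans _ _ (L * enorm (val x - val y) `^ beta)); last first.
  rewrite ler_wpM2l ?lip_ge0// ge0_ler_powR ?nnegrE// ltW//.
rewrite -ler_pdivrMr ?powR_gt0// -lee_fin fineK ?lip_fin//.
by apply: ereal_sup_ubound; exists (x, y).
Qed.

Lemma enorm_le_sum (x : 'rV[R]_d) : enorm x <= \sum_i `|x 0 i|.
Proof.
have S0 : 0 <= \sum_i `|x 0 i| by exact: sumr_ge0.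
rewrite -[leRHS]ger0_norm// -sqrtr_sqr ler_sqrt ?sqr_ge0//.
rewrite [leRHS]expr2 mulr_suml; apply: ler_sum => i _.
rewrite -real_normK ?num_real// expr2 ler_wpM2l// (bigD1 i)//= lerDl.
exact: sumr_ge0.
Qed.

Lemma cell_diameter w (x y : 'rV[R]_d) : cell d_gt0 w x -> cell d_gt0 w y ->
  enorm (x - y) <= 2 * d%:R * side_ratio R d ^+ size w.
Proof.
move=> wx wy; apply: le_trans (enorm_le_sum _) _.
apply: (@le_trans _ _ (\sum_(i < d) 2 * side_ratio R d ^+ size w)); last first.
  by rewrite sumr_const card_ord -[_ *+ d]mulr_natl mulrA [d%:R * 2]mulrC.
apply: ler_sum => i _; apply: (le_trans _ (half_power_le R d_gt0 (size w))).
apply: (@le_trans _ _ (2^-1 ^+ halvings (size w) i)); last first.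
  by rewrite ler_wiXn2l ?leq_halvings// ?invr_ge0// invf_le1// ler1n.
rewrite -(@cell_side R d d_gt0) !mxE; have := wx i; have := wy i.
by rewrite !mxE => /andP[? ?] /andP[? ?]; rewrite ler_norml; lra.
Qed.

Lemma cell_oscillation w (x y : cube R d) :
  cell d_gt0 w (val x) -> cell d_gt0 w (val y) ->
  `|f x - f y| <= 2 * d%:R * L * sigma ^+ size w.
Proof.
move=> wx wy; have /andP[b0 b1] := beta01.
apply: le_trans (lip_le (cell_diameter wx wy)) _.
have t0 : 0 <= side_ratio R d by exact: powR_ge0.
have L0 := lip_ge0.
rewrite powRM ?exprn_ge0// ?mulr_ge0 ?ler0n//.
have -> : (side_ratio R d ^+ size w) `^ beta = sigma ^+ size w.
  by rewrite powR_exprn// side_ratio_powR.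
rewrite mulrA [2 * _ * L]mulrC ler_wpM2r ?exprn_ge0 ?powR_ge0// ler_wpM2l//.
apply: ler1_powR; last exact: ltW.
by rewrite -natrM ler1n muln_gt0.
Qed.

Lemma sup_norm_fin : sup_norm (cube R d) f \is a fin_num.
Proof.
rewrite ge0_fin_numE; last first.
  apply: (@le_trans _ _ `|f (corner [::])|%:E); first by rewrite lee_fin.
  by apply: ereal_sup_ubound; exists (corner [::]) => //=; exact/set_mem/cell_lo_cube.
apply: (@le_lt_trans _ _ (`|f (corner [::])| + 2 * d%:R * L)%:E); last by rewrite ltry.
apply: ge_ereal_sup => _ [x _ <-]; rewrite lee_fin.
have := @cell_oscillation [::] x (corner [::]).
rewrite cell_nil expr0 mulr1 => /(_ (set_mem (valP x)) (set_mem (valP _))) h.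
by rewrite -(subrK (f (corner [::])) (f x)) (le_trans (ler_normD _ _))// addrC lerD.
Qed.

Lemma sup_norm_ge (K : set 'rV[R]_d) (x : cube R d) : K (val x) ->
  (`|f x|%:E <= sup_norm K f)%E.
Proof. by move=> Kx; apply: ereal_sup_ubound; exists x. Qed.

Lemma sup_norm_le x : `|f x| <= fine (sup_norm (cube R d) f).
Proof.
by rewrite -lee_fin fineK ?sup_norm_fin// sup_norm_ge//; exact/set_mem/valP.
Qed.

End holder_function.
End exponents.
End cells_and_charges.

(** * The limit functional and the charge it defines *)

Section functional.
Context (R : realType) (d : nat).
Hypothesis d_gt0 : (0 < d)%N.
Implicit Types (w : seq bool) (u v : Rd R d -> R) (A B : set (Rd R d)).

(** First [m] is fixed to make the tail [e m] small, then [n] grows. Below, [m] is a level of the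
    tree and [n] the index of a sequence. *)
Lemma squeeze_approx (x : nat -> R) (y : nat -> nat -> R) (e : nat -> R) :
  (forall n, 0 <= x n) -> (forall m, y m @ \oo --> 0) -> e @ \oo --> 0 ->
  (forall m n, x n <= y m n + e m) -> x @ \oo --> 0.
Proof.
move=> x0 y0 e0 xye; apply/cvgrPdist_le => _ /posnumP[r].
have r2 : 0 < r%:num / 2 by [].
have /cvgrPdist_le/(_ _ r2)[m _ /(_ m (leqnn m))] := e0.
rewrite sub0r normrN /= => em.
have /cvgrPdist_le/(_ _ r2)[N _ HN] := y0 m.
exists N => // n Nn; have := HN n Nn; rewrite /= !sub0r !normrN => yn.
rewrite (ger0_norm (x0 n)) (le_trans (xye m n))// [leRHS]splitr lerD//.
  exact: le_trans (ler_norm _) yn.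
exact: le_trans (ler_norm _) em.
Qed.

Lemma cell_integral_comb (a : R) u v w :
  (leb R d).-integrable setT (EFin \o u) ->
  (leb R d).-integrable setT (EFin \o v) ->
  cell_integral d_gt0 (a *: u + v) w =
  a * cell_integral d_gt0 u w + cell_integral d_gt0 v w.
Proof.
move=> iu iv; have mw := @measurable_cell R d d_gt0 w.
have iu' := integrableS measurableT mw (subsetT _) iu.
have iv' := integrableS measurableT mw (subsetT _) iv.
rewrite /cell_integral -RintegralZl// -RintegralD//.
by have := integrableZl mw a iu'; exact: eq_integrable.
Qed.

Lemma cell_integral_indic A w : measurable A ->
  cell_integral d_gt0 \1_A w = fine (leb R d (cell d_gt0 w `&` A)).
Proof.
move=> mA; rewrite /cell_integral /Rintegral integral_indic// 1?setIC//.
exact: measurable_cell.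
Qed.

Lemma cell_lty w A : measurable A -> (leb R d (cell d_gt0 w `&` A) < +oo)%E.
Proof.
move=> mA; apply: (@le_lt_trans _ _ (leb R d (cell d_gt0 w))).
  apply: le_measure; rewrite ?inE//; last exact: measurable_cell.
  by apply: measurableI => //; exact: measurable_cell.
by rewrite leb_cell ltry.
Qed.

Lemma cell_integral_indicU (B1 B2 B : cubeBV R d) w :
  leb R d (B1 `&` B2) = 0%E -> B = B1 `|` B2 :> set (Rd R d) ->
  cell_integral d_gt0 \1_B w =
  cell_integral d_gt0 \1_B1 w + cell_integral d_gt0 \1_B2 w.
Proof.
move=> B12 BU; have [i1 _ _] := BV_function_indic (cellBV R d_gt0 w).
have comm A : cell_integral d_gt0 \1_A w =
    \int[leb R d]_(x in A) \1_(cell d_gt0 w) x.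
  rewrite -Rintegral_indicM /cell_integral -Rintegral_indicM.
  by apply: eq_Rintegral => x _; rewrite mulrC.
rewrite !comm BU Rintegral_setU_null//; try exact: measurable_cubeBV.
by apply: integrableS i1 => //; apply: measurableU; exact: measurable_cubeBV.
Qed.

Lemma cell_integral_indic_dist (B B' : cubeBV R d) w :
  `|cell_integral d_gt0 \1_B w - cell_integral d_gt0 \1_B' w| <=
  fine (leb R d (B `+` B')).
Proof.
have mw := @measurable_cell R d d_gt0 w.
have mB := measurable_cubeBV B; have mB' := measurable_cubeBV B'.
have mS : measurable ((B : set (Rd R d)) `+` B').
  by apply: measurableU; exact: measurableD.
have Soo : (leb R d (B `+` B') < +oo)%E.
  apply: le_lt_trans (leb_cube_lty R d); apply: le_measure; rewrite ?inE//.
    exact: measurable_box.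
  by move=> x [[Bx _]|[Bx _]]; exact: cubeBV_sub Bx.
have le (C C' : cubeBV R d) : C `+` C' = B `+` B' ->
    fine (leb R d (cell d_gt0 w `&` C)) <=
    fine (leb R d (cell d_gt0 w `&` C')) + fine (leb R d (B `+` B')).
  move=> CC'; have mC := measurable_cubeBV C; have mC' := measurable_cubeBV C'.
  have mI : measurable (cell d_gt0 w `&` C') by exact: measurableI.
  apply: le_trans (volumeU_le mI mS (cell_lty w mC') Soo).
  apply: le_volume; [exact: measurableI|exact: measurableU| |].
    have := measureU2 (leb R d) mI mS => /le_lt_trans; apply.
    by rewrite lte_add_pinfty// cell_lty.
  move=> x [wx Cx]; have [C'x|C'x] := pselect ((C' : set (Rd R d)) x); first by left.
  by right; rewrite -CC'; left.
rewrite !cell_integral_indic// ler_distl; apply/andP; split.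
  by rewrite lerBlDr le// setYC.
exact: le.
Qed.

Section pairing.
Variables phi om : seq bool -> R.

Lemma cell_pairing_comb (a : R) u v m :
  (leb R d).-integrable setT (EFin \o u) ->
  (leb R d).-integrable setT (EFin \o v) ->
  cell_pairing d_gt0 phi om (a *: u + v) m =
  a * cell_pairing d_gt0 phi om u m + cell_pairing d_gt0 phi om v m.
Proof.
move=> iu iv; rewrite /cell_pairing mulr_sumr -big_split; apply: eq_bigr => w _ /=.
rewrite cell_integral_comb//.
by move: (cell_integral _ u w) (cell_integral _ v w) => x y; ring.
Qed.

Lemma cell_pairing_indicU (B1 B2 B : cubeBV R d) m :
  leb R d (B1 `&` B2) = 0%E -> B = B1 `|` B2 :> set (Rd R d) ->
  cell_pairing d_gt0 phi om \1_B m =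
  cell_pairing d_gt0 phi om \1_B1 m + cell_pairing d_gt0 phi om \1_B2 m.
Proof.
move=> B12 BU; rewrite /cell_pairing -big_split; apply: eq_bigr => w _ /=.
by rewrite (cell_integral_indicU w B12 BU) mulrDr.
Qed.

Lemma cell_pairing_indic_dist (B B' : cubeBV R d) m :
  `|cell_pairing d_gt0 phi om \1_B m - cell_pairing d_gt0 phi om \1_B' m| <=
  (\sum_(w <- words m) `|phi w * om w * 2 ^+ m|) * fine (leb R d (B `+` B')).
Proof.
rewrite /cell_pairing -sumrB mulr_suml (le_trans (ler_norm_sum _ _ _))//.
apply: ler_sum => w _; rewrite -mulrBr normrM ler_wpM2l//.
exact: cell_integral_indic_dist.
Qed.

End pairing.

(** [limn] gives a default value on a divergent sequence; on [BV_function], [product_functional_cvg]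
    shows that it is a genuine limit. *)
Definition product_functional (phi om : seq bool -> R) u : R :=
  limn (cell_pairing d_gt0 phi om u).

Variables (eta sigma : R).
Hypotheses (eta0 : 0 < eta <= 1) (sigma_ge : side_ratio R d <= sigma)
  (q_lt1 : 2 * eta * sigma < 1).
Local Notation q := (2 * eta * sigma).

Let q01 : 0 < q < 1.
Proof.
have /andP[t0 _] := side_ratio_lt1 R d_gt0; have /andP[e0 _] := eta0.
by rewrite q_lt1 andbT !mulr_gt0// (lt_le_trans t0).
Qed.

Section product.
Variables (phi om : seq bool -> R) (A F L : R).
Hypotheses (A0 : 0 <= A) (F0 : 0 <= F) (L0 : 0 <= L).
Hypotheses (om_add : tree_additive om)
  (om_le : forall w, `|om w| <= A * eta ^+ size w)
  (phi_le : forall w, `|phi w| <= F)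
  (phi_osc : forall b w, `|phi (b :: w) - phi w| <= L * sigma ^+ size w).
Local Notation rate := (@pairing_rate R d A F L eta sigma).

Lemma pairing_rate_ge0 : 0 <= rate.
Proof.
have T0 := tree_cst_ge0 R d_gt0.
by rewrite /pairing_rate divr_ge0 ?subr_ge0 ?(ltW q_lt1)// !mulr_ge0 ?T0 ?addr_ge0.
Qed.

Lemma product_functional_cvg u : BV_function u ->
  cell_pairing d_gt0 phi om u @ \oo --> product_functional phi om u.
Proof.
by move=> [iu uoo u0];
  have [] := cell_pairing_cvg d_gt0 A0 F0 L0 eta0 sigma_ge om_add om_le phi_le phi_osc iu uoo u0 q_lt1.
Qed.

Lemma product_functional_approx u m : BV_function u ->
  `|product_functional phi om u - cell_pairing d_gt0 phi om u m| <=
  rate * q ^+ m * fine (variation u).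
Proof.
by move=> [iu uoo u0];
  have [] := cell_pairing_cvg d_gt0 A0 F0 L0 eta0 sigma_ge om_add om_le phi_le phi_osc iu uoo u0 q_lt1.
Qed.

Lemma product_functional_comb (a : R) u v : BV_function u -> BV_function v ->
  product_functional phi om (a *: u + v) =
  a * product_functional phi om u + product_functional phi om v.
Proof.
move=> bu bv; have bc := BV_function_comb a bu bv.
have [iu _ _] := bu; have [iv _ _] := bv.
apply: (cvg_unique (@Rhausdorff R) (product_functional_cvg bc)).
rewrite (funext (fun m => cell_pairing_comb phi om a m iu iv)).
apply: cvgD; last exact: product_functional_cvg.
by apply: cvgM; [exact: cvg_cst|exact: product_functional_cvg].
Qed.

Definition product_charge (B : cubeBV R d) : R := product_functional phi om \1_B.

Lemma pairing_error_cvg (V : R) : (fun m => rate * q ^+ m * V) @ \oo --> 0.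
Proof.
have /andP[q0 q1] := q01.
rewrite -[X in _ --> X](mul0r V); apply: cvgM; last exact: cvg_cst.
rewrite -[X in _ --> X](mulr0 rate); apply: cvgM; first exact: cvg_cst.
by apply: cvg_expr; rewrite ger0_norm// ltW.
Qed.

(** Additivity passes to the limit. For continuity, at a fixed level the pairing is Lipschitz in the
    measure of the symmetric difference, and the tail beyond that level is small uniformly along the
    sequence because perimeters are bounded. *)
Lemma product_charge_is_bv_charge : is_bv_charge product_charge.
Proof.
split=> [B1 B2 B B12 BU|B_ B [BB Boo]].
  have c (C : cubeBV R d) := product_functional_cvg (BV_function_indic C).
  apply: (cvg_unique (@Rhausdorff R) (c B)).
  rewrite (funext (fun m => cell_pairing_indicU phi om m B12 BU)).
  by apply: cvgD; exact: c.
have vfin (C : cubeBV R d) : variation (\1_C : Rd R d -> R) \is a fin_num.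
  by have [_ oo _] := BV_function_indic C; rewrite ge0_fin_numE ?variation_ge0.
have [P HP] : exists P : R, forall n, fine (variation (\1_(B_ n) : Rd R d -> R)) <= P.
  have S0 := ereal_sup_ubound; set S := ereal_sup _ in Boo.
  exists (fine S) => n.
  have le : (variation (\1_(B_ n) : Rd R d -> R) <= S)%E.
    by apply: S0; exists n.
  rewrite fine_le//; rewrite ge0_fin_numE//.
  exact: le_trans (variation_ge0 _) le.
set V := fine (variation (\1_B : Rd R d -> R)).
apply/subr_cvg0; apply: norm_cvg0; apply: (@squeeze_approx _ (fun m n =>
  (\sum_(w <- words m) `|phi w * om w * 2 ^+ m|) * fine (leb R d (B_ n `+` B)))
  (fun m => rate * q ^+ m * (P + V))) => // [m||m n].
- rewrite -[X in _ --> X](mulr0 (\sum_(w <- words m) `|phi w * om w * 2 ^+ m|)).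
  by apply: cvgM; [exact: cvg_cst|exact: (fine_cvg BB)].
- exact: pairing_error_cvg.
have D := cell_pairing_indic_dist phi om (B_ n) B m.
have E1 := product_functional_approx m (BV_function_indic (B_ n)).
have E2 := product_functional_approx m (BV_function_indic B).
have {}E1 : `|product_functional phi om \1_(B_ n) - cell_pairing d_gt0 phi om \1_(B_ n) m| <=
    rate * q ^+ m * P.
  rewrite (le_trans E1)// ler_wpM2l ?HP//.
  by have /andP[q0 _] := q01; rewrite mulr_ge0 ?exprn_ge0 ?pairing_rate_ge0// ltW.
rewrite mulrDr; move: D E1 E2; rewrite /product_charge /=.
set x := product_functional _ _ _; set y := product_functional _ _ _.
set x' := cell_pairing _ _ _ _ _; set y' := cell_pairing _ _ _ _ _.
move: (fine (leb R d _)) (rate * q ^+ m * P) (rate * q ^+ m * _) => D e1 e2.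
move: (\sum_(w <- _) _) => c h1 h2 h3.
have -> : x - y = (x' - y') + ((x - x') - (y - y')) by ring.
rewrite (le_trans (ler_normD _ _))// lerD// (le_trans (ler_normB _ _))// lerD//.
Qed.

End product.
End functional.

(** * The dual of BV and the strong norm *)

Section dual.
Context (R : realType) (d : nat).
Implicit Types (l : (Rd R d -> R) -> R) (u : Rd R d -> R).

Lemma dual_norm_le l (M : R) : 0 <= M ->
  (forall u, BV_function u -> `|l u| <= M * fine (variation u)) ->
  (dual_norm l <= M%:E)%E.
Proof.
move=> M0 lM; apply: ge_ereal_sup => _ [u [bu u1] <-]; rewrite lee_fin.
have [_ uoo _] := bu; rewrite (le_trans (lM u bu))// ler_piMr//.
by rewrite -lee_fin fineK// ge0_fin_numE// variation_ge0.
Qed.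

Lemma dual_norm_ge0 l : (0 <= dual_norm l)%E.
Proof.
apply: (@le_trans _ _ `|l 0|%:E); first by rewrite lee_fin.
apply: ereal_sup_ubound; exists 0 => //; split; first exact: BV_function0.
apply: (@le_trans _ _ 0%E); last by rewrite lee_fin.
apply: variation_le; first by have [] := @BV_function0 R d.
move=> v _ _ _; under eq_Rintegral do rewrite mul0r.
by rewrite /Rintegral integral0.
Qed.

(** The variation of [u] may be 0, so [u] is divided by an arbitrary [c] above it, and [c] then
    tends to the variation. *)
Lemma dual_le l u (M : R) : BV_dual l -> (dual_norm l <= M%:E)%E ->
  BV_function u -> `|l u| <= M * fine (variation u).
Proof.
move=> [ll _] lM bu; have M0 : 0 <= M.
  by rewrite -lee_fin (le_trans (dual_norm_ge0 l)).
have l0 : l 0 = 0.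
  have := ll 1 0 0 (@BV_function0 R d) (@BV_function0 R d).
  by rewrite scaler0 addr0 mul1r; lra.
have V0 : 0 <= fine (variation u) by exact: fine_ge0 (variation_ge0 u).
have H c : fine (variation u) < c -> `|l u| <= M * c.
  move=> Vc; have c0 : 0 < c by exact: le_lt_trans Vc.
  have bu' := BV_function_comb c^-1 bu (@BV_function0 R d).
  have [_ uoo _] := bu'.
  have : (`|l (c^-1 *: u + 0)|%:E <= M%:E)%E.
    apply: le_trans lM; apply: ereal_sup_ubound; exists (c^-1 *: u + 0) => //.
    split => //; rewrite -[leLHS]fineK ?ge0_fin_numE ?variation_ge0// lee_fin.
    apply: le_trans (fine_variation_comb c^-1 bu (@BV_function0 R d)) _.
    have -> : variation (0 : Rd R d -> R) = 0%E.
      apply/eqP; rewrite eq_le variation_ge0 andbT.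
      apply: variation_le; first by have [] := @BV_function0 R d.
      move=> v _ _ _; under eq_Rintegral do rewrite mul0r.
      by rewrite /Rintegral integral0.
    rewrite addr0 ger0_norm ?invr_ge0 ?(ltW c0)//.
    by rewrite ler_pdivrMl// mulr1 ltW.
  rewrite lee_fin ll//; last exact: BV_function0.
  rewrite l0 addr0 normrM (ger0_norm (x := c^-1)) ?invr_ge0 ?(ltW c0)//.
  by rewrite ler_pdivrMl// mulrC.
apply/ler_addgt0Pr => e e0; have M1 : 0 < M + 1 by rewrite ltr_wpDl.
have := H (fine (variation u) + e / (M + 1)).
rewrite ltrDl divr_gt0// => /(_ isT) /le_trans; apply.
rewrite mulrDr lerD2l mulrA ler_pdivrMr// mulrC ler_wpM2l ?(ltW e0)//.
by rewrite lerDl.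
Qed.

Lemma strong_norm_ge0 (nu : cubeBV R d -> R) : (0 <= strong_norm nu)%E.
Proof. by apply: le_ereal_inf_tmp => _ [l _ <-]; exact: dual_norm_ge0. Qed.

(** The value at [B] is that of a representing functional at the indicator, hence at most the dual
    norm times the perimeter of [B]. *)
Lemma strong_norm_cvg_eval (nu_ : nat -> cubeBV R d -> R) (B : cubeBV R d) :
  (fun p => strong_norm (nu_ p)) @ \oo --> 0%E -> nu_ ^~ B @ \oo --> 0.
Proof.
move=> nu0; have [_ _ _] := BV_function_indic B.
set V := fine (variation (\1_B : Rd R d -> R)).
have V0 : 0 <= V by exact: fine_ge0 (variation_ge0 _).
apply/cvgrPdist_le => e e0; have V1 : 0 < V + 1 by rewrite ltr_wpDl.
have eV : 0 < e / (V + 1) by rewrite divr_gt0.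
have /fine_cvgP[fin /cvgrPdist_lt/(_ _ eV) lim] := nu0.
apply: filterS2 fin lim => p fin lim.
have : (strong_norm (nu_ p) < (e / (V + 1))%:E)%E.
  rewrite -(fineK fin) lte_fin (le_lt_trans _ lim)// sub0r normrN.
  exact: ler_norm.
move=> /ereal_inf_lt[_ [l [lB _ nuE] <-] /ltW le]; rewrite sub0r normrN nuE.
apply: le_trans (dual_le lB le (BV_function_indic B)) _.
rewrite -/V mulrAC ler_pdivrMr// ler_wpM2l ?(ltW e0)//.
by rewrite lerDl.
Qed.

End dual.

(** * Step functions as elements of Lebesgue spaces *)

Section step_functions.
Context (R : realType) (d : nat).
Hypothesis d_gt0 : (0 < d)%N.
Implicit Types (c : seq bool -> R) (w : seq bool) (u : Rd R d -> R).

Definition step m c (x : Rd R d) : R :=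
  \sum_(w <- words m) c w * \1_(cell d_gt0 w) x.

Definition cube_step m c (x : cube R d) : R := step m c (val x).

Lemma valL_cube_step m c : 'valL_0 (cube_step m c) = step m c.
Proof.
apply/funext => x; have -> : cube_step m c = sigL (cube R d) (step m c) by [].
rewrite -[LHS]/((@valL_ _ _ 0 _ \o sigL (cube R d)) (step m c) x) sigLK.
rewrite /patch; case: ifPn => // xc.
rewrite /step big1// => w _; rewrite indicE memNset ?mulr0//.
by move=> wx; move/negP: xc; apply; apply/mem_set/(@sub_cell_cube R d d_gt0 w).
Qed.

Lemma step_bounded m c : exists2 M : R, 0 <= M & forall x, `|step m c x| <= M.
Proof.
exists (\sum_(w <- words m) `|c w|); first exact: sumr_ge0.
move=> x; rewrite (le_trans (ler_norm_sum _ _ _))//; apply: ler_sum => w _.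
by rewrite normrM ler_piMr// indicE ger0_norm ?ler0n// lern1 leq_b1.
Qed.

Lemma measurable_step m c : measurable_fun setT (step m c).
Proof.
apply: measurable_sum => w; apply: measurable_funM; first exact: measurable_cst.
by apply: measurable_indic; exact: measurable_cell.
Qed.

Lemma valL_out (g : cube R d -> R) x : x \notin cube R d -> ('valL_0 g : Rd R d -> R) x = 0.
Proof. by move=> xc; rewrite /valL_/= oinv_set_val insubN. Qed.

Lemma valL_in (g : cube R d -> R) (x : cube R d) : ('valL_0 g : Rd R d -> R) (val x) = g x.
Proof. exact: (congr1 (fun h : cube R d -> R => h x) (@valLK _ _ 0 (cube R d) g)). Qed.

Lemma Lp_bounded (p : R) (g : cube R d -> R) (M : R) : 0 < p ->
  measurable_fun setT ('valL_0 g : Rd R d -> R) ->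
  (forall x, `|('valL_0 g : Rd R d -> R) x| <= M) -> Lp p g.
Proof.
move=> p0 mg gM; rewrite /Lp inE/=; apply/andP; split; first exact/mem_set.
apply/mem_set; rewrite /= /finite_norm unlock /Lnorm.
apply: poweR_lty.
have M0 : 0 <= M by apply: le_trans (gM 0).
have mgp : measurable_fun setT (fun x => `|('valL_0 g : Rd R d -> R) x| `^ p).
  by apply: (measurableT_comp (measurable_powR p)); exact: measurableT_comp.
apply: (@le_lt_trans _ _ (\int[leb R d]_(x in cube R d) (cst (M `^ p)%:E x))%E); last first.
  rewrite integral_cst; last exact: measurable_box.
  by apply: lte_mul_pinfty => //; [rewrite lee_fin powR_ge0|exact: leb_cube_lty].
rewrite [leRHS]integral_mkcond; apply: ge0_le_integral => //.
- by move=> x ?; exact: poweR_ge0.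
- exact/measurable_EFinP.
- by apply/(measurable_restrictT _ (@measurable_box R d 0 (const_mx 1))); exact: measurable_cst.
- move=> x ?; rewrite /patch; case: ifPn => xc.
    rewrite /= lee_fin; apply: ge0_ler_powR; rewrite ?nnegrE;
      [exact: ltW|exact: normr_ge0|exact: M0|exact: gM].
  by have /= := valL_out g xc => ->; rewrite normr0 powR0 ?gt_eqF.
Qed.

End step_functions.

(** * Strong representations and distances between products *)

Section strong_estimate.
Context (R : realType) (d : nat).
Hypothesis d_gt0 : (0 < d)%N.
Implicit Types (c phi om : seq bool -> R) (w : seq bool) (u : Rd R d -> R).

Definition step_functional m c u : R :=
  \sum_(w <- words m) c w * cell_integral d_gt0 u w.

Lemma integrable_indicM u (A : set (Rd R d)) : measurable A ->
  (leb R d).-integrable setT (EFin \o u) ->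
  (leb R d).-integrable setT (EFin \o (fun x => u x * \1_A x)).
Proof.
move=> mA iu; have := integrableS measurableT mA (subsetT _) iu.
move=> /(integrable_mkcond _ mA); apply: eq_integrable => // x _.
rewrite /patch /= indicE; case: ifP => _; first by rewrite mulr1.
by rewrite mulr0.
Qed.

Lemma pairing_cube_step m c u : (leb R d).-integrable setT (EFin \o u) ->
  pairing (cube_step d_gt0 m c) u = step_functional m c u.
Proof.
move=> iu; have iuw w := integrable_indicM (@measurable_cell R d d_gt0 w) iu.
have icw w : (leb R d).-integrable setT
    (EFin \o (fun x => c w * (u x * \1_(cell d_gt0 w) x))).
  by have := integrableZl measurableT (c w) (iuw w); exact: eq_integrable.
rewrite /step_functional; transitivity (\int[leb R d]_x
    (\sum_(w <- words m) c w * (u x * \1_(cell d_gt0 w) x))).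
  apply: eq_Rintegral => x _; rewrite (valL_cube_step d_gt0 m c) /step mulr_suml.
  by apply: eq_bigr => w _; rewrite -mulrA [\1_ _ _ * _]mulrC.
have [_ ->] := RintegralD_seq (words m) measurableT icw.
apply: eq_bigr => w _; rewrite RintegralZl//; congr (_ * _).
exact: Rintegral_indicM.
Qed.

Let cst : R := 1 + 2 / (1 - side_ratio R d).

Lemma strong_cst_ge0 : 0 <= cst.
Proof.
have /andP[_ t1] := side_ratio_lt1 R d_gt0.
by rewrite addr_ge0// divr_ge0// subr_ge0 ltW.
Qed.

Lemma step_functional_le m c (S : R) u : 0 <= S ->
  {in words m, forall w, `|c w| <= S} -> BV_function u ->
  `|step_functional m c u| <= cst * S * fine (variation u).
Proof.
move=> S0 cS [iu uoo u0]; apply: le_trans (cell_sum_bound d_gt0 iu uoo u0 S0 cS) _.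
rewrite ler_wpM2r ?fine_ge0 ?variation_ge0// ler_wpM2r// lerD2l.
exact: sum_half_powers_le.
Qed.

(** Step functions are bounded, hence in L^d, and their functionals are pairings: approximating [l]
    by them in dual norm places it in the closure that defines strong charges. *)
Lemma strong_representation_approx (nu : cubeBV R d -> R)
    (l : (Rd R d -> R) -> R) (c_ : nat -> seq bool -> R) (e : nat -> R) :
  (forall (a : R) u v, BV_function u -> BV_function v ->
    l (a *: u + v) = a * l u + l v) ->
  (forall m u, BV_function u ->
    `|l u - step_functional m (c_ m) u| <= e m * fine (variation u)) ->
  e @ \oo --> 0 -> (forall B : cubeBV R d, nu B = l \1_B) ->
  strong_representation nu l.
Proof.
move=> ll le e0 nul; split => //.
  (* The dual norm of [l] is finite already by comparison with the approximation at level 0. *)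
  split=> //; pose S := \sum_(w <- words 0) `|c_ 0%N w|.
  have S0 : 0 <= S by exact: sumr_ge0.
  apply: (@le_lt_trans _ _ (cst * S + `|e 0%N|)%:E); last by rewrite ltry.
  apply: dual_norm_le => [|u bu].
    by rewrite addr_ge0// mulr_ge0// strong_cst_ge0.
  have V0 : 0 <= fine (variation u) by exact: fine_ge0 (variation_ge0 u).
  rewrite -[l u](subrK (step_functional 0 (c_ 0%N) u)) addrC.
  rewrite mulrDl (le_trans (ler_normD _ _))// lerD//.
    apply: step_functional_le => // w w0.
    by rewrite /S; move: w0; rewrite inE => /eqP ->; rewrite big_seq1.
  by rewrite (le_trans (le 0%N u bu))// ler_wpM2r// ler_norm.
move=> r r0; have r2 : 0 < r / 2 by rewrite divr_gt0.
have /cvgrPdist_lt/(_ _ r2)[m _ /(_ m (leqnn m))] := e0.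
rewrite sub0r normrN /= => em; exists (cube_step d_gt0 m (c_ m)).
  have [M _ gM] := step_bounded d_gt0 m (c_ m).
  have E := valL_cube_step d_gt0 m (c_ m).
  apply: (@Lp_bounded R d d%:R _ M); first by rewrite ltr0n.
    by rewrite E; exact: measurable_step.
  by move=> x; rewrite E.
apply: (@le_lt_trans _ _ (r / 2)%:E); last first.
  by rewrite lte_fin ltr_pdivrMr// ltr_pMr// ltr1n.
apply: dual_norm_le => [|u bu]; first exact: ltW.
have V0 : 0 <= fine (variation u) by exact: fine_ge0 (variation_ge0 u).
rewrite pairing_cube_step; last by have [] := bu.
rewrite (le_trans (le m u bu))// ler_wpM2r//.
exact: le_trans (ler_norm _) (ltW em).
Qed.

Section distance.
Variables (eta sigma : R).
Hypotheses (eta0 : 0 < eta <= 1) (sigma_ge : side_ratio R d <= sigma)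
  (q_lt1 : 2 * eta * sigma < 1).
Variables (A F L : R) (phi om phi' om' : seq bool -> R).
Hypotheses (A0 : 0 <= A) (F0 : 0 <= F) (L0 : 0 <= L).
Hypotheses (om_add : tree_additive om)
  (om_le : forall w, `|om w| <= A * eta ^+ size w)
  (phi_le : forall w, `|phi w| <= F)
  (phi_osc : forall b w, `|phi (b :: w) - phi w| <= L * sigma ^+ size w).
Hypotheses (om_add' : tree_additive om')
  (om_le' : forall w, `|om' w| <= A * eta ^+ size w)
  (phi_le' : forall w, `|phi' w| <= F)
  (phi_osc' : forall b w, `|phi' (b :: w) - phi' w| <= L * sigma ^+ size w).
Local Notation rate := (@pairing_rate R d A F L eta sigma).
Local Notation q := (2 * eta * sigma).

Let l u := product_functional d_gt0 phi om u - product_functional d_gt0 phi' om' u.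
Let c m w := phi w * om w * 2 ^+ m - phi' w * om' w * 2 ^+ m.

Lemma product_distance_approx m u : BV_function u ->
  `|l u - step_functional m (c m) u| <= 2 * rate * q ^+ m * fine (variation u).
Proof.
move=> bu.
have h := product_functional_approx d_gt0 eta0 sigma_ge q_lt1
  A0 F0 L0 om_add om_le phi_le phi_osc m bu.
have h' := product_functional_approx d_gt0 eta0 sigma_ge q_lt1
  A0 F0 L0 om_add' om_le' phi_le' phi_osc' m bu.
have -> : step_functional m (c m) u =
    cell_pairing d_gt0 phi om u m - cell_pairing d_gt0 phi' om' u m.
  by rewrite /step_functional -sumrB; apply: eq_bigr => w _; rewrite mulrBl.
rewrite /l opprB addrACA [X in `|_ + X|]addrC addrA addrAC -addrA.
move: h h'; set x := product_functional _ _ _ _; set y := product_functional _ _ _ _.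
set x' := cell_pairing _ _ _ _ _; set y' := cell_pairing _ _ _ _ _.
move: (fine _) => V h h'.
have -> : 2 * rate * q ^+ m * V = rate * q ^+ m * V + rate * q ^+ m * V by ring.
apply: le_trans (lerD h h'); rewrite (le_trans _ (ler_normB _ _))//.
by rewrite le_eqVlt; apply/orP; left; apply/eqP; congr `|_|; ring.
Qed.

Lemma product_distance_representation :
  strong_representation (fun B => product_charge d_gt0 phi om B -
    product_charge d_gt0 phi' om' B) l.
Proof.
apply: (strong_representation_approx (c_ := c) (e := fun m => 2 * rate * q ^+ m)).
- move=> a u v bu bv; rewrite /l.
  rewrite (product_functional_comb d_gt0 eta0 sigma_ge q_lt1 A0 F0 L0
    om_add om_le phi_le phi_osc a bu bv).
  rewrite (product_functional_comb d_gt0 eta0 sigma_ge q_lt1 A0 F0 L0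
    om_add' om_le' phi_le' phi_osc' a bu bv).
  by ring.
- exact: product_distance_approx.
- have -> : (fun m => 2 * rate * q ^+ m) = (fun m => rate * q ^+ m * 2).
    by apply/funext => m; ring.
  exact: (pairing_error_cvg d_gt0 eta0 sigma_ge q_lt1).
- by [].
Qed.

(** Cut at level [m]: the first term compares finitely many cell values, the second collects the two
    tails. Letting [m] be free is what turns convergence on each cell into strong convergence. *)
Lemma product_strong_dist m (S : R) : 0 <= S ->
  {in words m, forall w, `|phi w * om w - phi' w * om' w| * 2 ^+ m <= S} ->
  (strong_norm (fun B => (product_charge d_gt0 phi om B -
     product_charge d_gt0 phi' om' B)%R) <= (cst * S + 2 * rate * q ^+ m)%:E)%E.
Proof.
move=> S0 cS; apply: le_trans (ereal_inf_lbound _) _.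
  by exists l; [exact: product_distance_representation|reflexivity].
have R0 := pairing_rate_ge0 d_gt0 q_lt1 A0 F0 L0.
have /andP[e0 _] := eta0; have /andP[t0 _] := side_ratio_lt1 R d_gt0.
have Q0 : 0 <= q ^+ m.
  rewrite exprn_ge0// !mulr_ge0 ?(ltW e0)//; exact: le_trans (ltW t0) sigma_ge.
apply: dual_norm_le => [|u bu].
  by rewrite addr_ge0// mulr_ge0 ?strong_cst_ge0// mulr_ge0.
rewrite -[l u](subrK (step_functional m (c m) u)) addrC mulrDl.
rewrite (le_trans (ler_normD _ _))// lerD//; last exact: product_distance_approx.
apply: step_functional_le => // w wm; rewrite /c -mulrBl normrM.
by rewrite (ger0_norm (x := 2 ^+ m)) ?exprn_ge0// cS.
Qed.

End distance.
End strong_estimate.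

(** * Values of products on cells *)

Section cell_values.
Context (R : realType) (d : nat).
Hypothesis d_gt0 : (0 < d)%N.
Implicit Types (c phi om : seq bool -> R) (v w : seq bool).

Let mass w0 w : R := cell_integral d_gt0 \1_(cell d_gt0 w0) w.

Let massE w0 w : mass w0 w = fine (leb R d (cell d_gt0 w `&` cell d_gt0 w0)).
Proof. by rewrite /mass cell_integral_indic//; exact: measurable_cell. Qed.

Let mass_ge0 w0 w : 0 <= mass w0 w.
Proof. by rewrite massE volume_ge0. Qed.

Let mass_le w0 v w : mass w0 (v ++ w) <= mass w0 w.
Proof.
rewrite !massE; apply: le_volume.
- by apply: measurableI; exact: measurable_cell.
- by apply: measurableI; exact: measurable_cell.
- by apply: cell_lty; exact: measurable_cell.
- by apply: setSI; exact: sub_cell_cat.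
Qed.

Lemma cell_integral_cell_sub v w :
  cell_integral d_gt0 \1_(cell d_gt0 w) (v ++ w) =
  2^-1 ^+ size (v ++ w) :> R.
Proof.
by rewrite -/(mass _ _) massE (setIidl (@sub_cell_cat R d d_gt0 v w)) fine_leb_cell.
Qed.

(** The masses of [cell w] inside the cells of its level add up to its whole mass, which the cell
    [w] itself already accounts for; being nonnegative, the others vanish. *)
Lemma cell_integral_cell_out v w w' : size w' = size w -> w' != w ->
  cell_integral d_gt0 \1_(cell d_gt0 w) (v ++ w') = 0 :> R.
Proof.
move=> sw ww'; rewrite -/(mass _ _).
suff h : mass w w' <= 0.
  by apply/eqP; rewrite eq_le mass_ge0 andbT (le_trans (mass_le _ _ _)).
have tm : tree_additive (mass w).
  move=> w1; apply: cell_integral_split.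
  by have [] := BV_function_indic (cellBV R d_gt0 w).
have := tree_additive_words (size w) [::] tm.
rewrite (bigD1_seq w) ?words_uniq ?mem_words//= cats0.
have -> : mass w [::] = mass w w.
  rewrite !massE cell_nil setIid; congr (fine (leb _ _ _)).
  exact/setIidr/sub_cell_cube.
move=> /eqP; rewrite eq_sym -subr_eq0 addrAC subrr add0r => /eqP S0.
rewrite -S0 (eq_bigr (mass w)); last by move=> v' _; rewrite cats0.
rewrite (big_rem w')/= -?sw ?mem_words// ww' lerDl.
by apply: sumr_ge0.
Qed.

(** Tested on a cell at a finer level, the pairing is a Riemann-Stieltjes sum of [phi] against [om]
    over its subcells: the normalisation cancels their volume. *)
Lemma cell_pairing_cell phi om k w :
  cell_pairing d_gt0 phi om \1_(cell d_gt0 w) (k + size w) =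
  \sum_(v <- words k) phi (v ++ w) * om (v ++ w) :> R.
Proof.
rewrite /cell_pairing big_words_cat (bigD1_seq w) ?words_uniq ?mem_words//=.
rewrite [X in _ + X](_ : _ = 0) ?addr0; last first.
  rewrite big_seq_cond; apply: big1 => w' /andP[w'w ne]; apply: big1 => v _.
  by rewrite cell_integral_cell_out ?mulr0// (size_words w'w).
rewrite big_seq [RHS]big_seq; apply: eq_bigr => v vk.
rewrite cell_integral_cell_sub size_cat (size_words vk) -mulrA -exprMn.
by rewrite divff ?expr1n ?mulr1// pnatr_eq0.
Qed.

Lemma cell_pairing_cell_cvg phi om w (l : R) :
  cell_pairing d_gt0 phi om \1_(cellBV R d_gt0 w) @ \oo --> l ->
  (fun k => \sum_(v <- words k) phi (v ++ w) * om (v ++ w)) @ \oo --> l.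
Proof.
rewrite -(cvg_shiftn (size w)).
have -> : (fun k => \sum_(v <- words k) phi (v ++ w) * om (v ++ w)) =
  [sequence cell_pairing d_gt0 phi om \1_(cellBV R d_gt0 w)
    (k + size w)%N]_k by apply/funext => k; exact/esym/cell_pairing_cell.
by [].
Qed.

Section value.
Variables (eta sigma : R).
Hypotheses (eta0 : 0 < eta <= 1) (sigma_ge : side_ratio R d <= sigma)
  (q_lt1 : 2 * eta * sigma < 1).
Variables (A F L : R) (phi om : seq bool -> R).
Hypotheses (A0 : 0 <= A) (F0 : 0 <= F) (L0 : 0 <= L).
Hypotheses (om_add : tree_additive om)
  (om_le : forall w, `|om w| <= A * eta ^+ size w)
  (phi_le : forall w, `|phi w| <= F)
  (phi_osc : forall b w, `|phi (b :: w) - phi w| <= L * sigma ^+ size w).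

(** Telescope the Riemann sums from the one-term sum [phi w * om w]. As [om] is additive, refining
    changes only the values of [phi], so step [k] costs [2 ^+ k.+1] terms, each an oscillation of
    [phi] times a mass. *)
Lemma product_charge_cell w :
  `|product_charge d_gt0 phi om (cellBV R d_gt0 w) - phi w * om w| <=
  2 * L * A * (eta * sigma) ^+ size w / (1 - 2 * eta * sigma).
Proof.
have /andP[e0 e1] := eta0; have /andP[t0 _] := side_ratio_lt1 R d_gt0.
have s0 : 0 < sigma by exact: lt_le_trans sigma_ge.
pose s k := \sum_(v <- words k) phi (v ++ w) * om (v ++ w).
have sl : s @ \oo --> product_charge d_gt0 phi om (cellBV R d_gt0 w).
  apply: cell_pairing_cell_cvg; exact: (product_functional_cvg eta0 sigma_ge q_lt1
    A0 F0 L0 om_add om_le phi_le phi_osc (BV_function_indic (cellBV R d_gt0 w))).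
have sE k : s k.+1 - s k = \sum_(v <- words k)
    ((phi (false :: v ++ w) - phi (v ++ w)) * om (false :: v ++ w) +
     (phi (true :: v ++ w) - phi (v ++ w)) * om (true :: v ++ w)).
  rewrite /s big_words -sumrB; apply: eq_bigr => v _ /=.
  by rewrite (om_add (v ++ w)); ring.
have inc k : `|s k.+1 - s k| <= 2 * L * A * (eta * sigma) ^+ size w * (2 * eta * sigma) ^+ k.
  rewrite sE; apply: le_trans (norm_sum_words_le
    (c := 2 * (L * A * (eta * sigma) ^+ (k + size w))) _) _; last first.
    by rewrite exprD le_eqVlt; apply/orP; left; apply/eqP; rewrite !exprMn; ring.
  move=> v vk; have vw : size (v ++ w) = (k + size w)%N.
    by rewrite size_cat (size_words vk).
  have h b : `|(phi (b :: v ++ w) - phi (v ++ w)) * om (b :: v ++ w)| <=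
      L * A * (eta * sigma) ^+ (k + size w).
    rewrite normrM -vw; apply: (@le_trans _ _
      (L * sigma ^+ size (v ++ w) * (A * eta ^+ size (v ++ w)))).
      rewrite ler_pM// (le_trans (om_le _))// ler_wpM2l//= exprS ler_piMl//.
      by rewrite exprn_ge0// ltW.
    by rewrite exprMn le_eqVlt; apply/orP; left; apply/eqP; ring.
  by rewrite (le_trans (ler_normD _ _))// mulr_natl mulr2n lerD.
have [||_ /(_ 0%N)] := geometric_increments_cvg _ _ inc.
- by rewrite !mulr_ge0// exprn_ge0// mulr_ge0// ltW.
- by rewrite q_lt1 andbT !mulr_gt0.
by rewrite (cvg_lim (@Rhausdorff R) sl) expr0 mulr1 /s big_seq1.
Qed.

End value.
End cell_values.

Section continuity.
Context (R : realType) (d : nat).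
Hypothesis d_gt0 : (0 < d)%N.
Variables (eta sigma : R).
Hypotheses (eta0 : 0 < eta <= 1) (sigma_ge : side_ratio R d <= sigma)
  (q_lt1 : 2 * eta * sigma < 1).

(** Under uniform bounds, convergence on every single cell is enough: the tails are uniform in [p],
    and a fixed level has finitely many cells. *)
Lemma product_strong_cvg (phi_ om_ : nat -> seq bool -> R)
    (phi om : seq bool -> R) (A F L : R) :
  0 <= A -> 0 <= F -> 0 <= L ->
  (forall p, tree_additive (om_ p)) -> tree_additive om ->
  (forall p w, `|om_ p w| <= A * eta ^+ size w) ->
  (forall w, `|om w| <= A * eta ^+ size w) ->
  (forall p w, `|phi_ p w| <= F) -> (forall w, `|phi w| <= F) ->
  (forall p b w, `|phi_ p (b :: w) - phi_ p w| <= L * sigma ^+ size w) ->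
  (forall b w, `|phi (b :: w) - phi w| <= L * sigma ^+ size w) ->
  (forall w, phi_ ^~ w @ \oo --> phi w) -> (forall w, om_ ^~ w @ \oo --> om w) ->
  (fun p => strong_norm (fun B => (product_charge d_gt0 (phi_ p) (om_ p) B -
    product_charge d_gt0 phi om B)%R)) @ \oo --> 0%E.
Proof.
move=> A0 F0 L0 add_ add om_le_ om_le phi_le_ phi_le osc_ osc cphi com.
set s := fun p => strong_norm _.
pose S m p := \sum_(w <- words m) `|phi_ p w * om_ p w - phi w * om w| * 2 ^+ m.
have S0 m p : 0 <= S m p by apply: sumr_ge0 => w _; rewrite mulr_ge0// exprn_ge0.
pose C := 1 + 2 / (1 - side_ratio R d).
have le m p : (s p <= (C * S m p +
    2 * pairing_rate d A F L eta sigma * (2 * eta * sigma) ^+ m)%:E)%E.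
  apply: (product_strong_dist d_gt0 eta0 sigma_ge q_lt1) => // w wm.
  rewrite /S (bigD1_seq w) ?words_uniq//= lerDl.
  by apply: sumr_ge0 => v _; rewrite mulr_ge0// exprn_ge0.
have sfin p : s p \is a fin_num.
  rewrite ge0_fin_numE; last exact: strong_norm_ge0.
  by apply: le_lt_trans (le 0%N p) _; rewrite ltry.
apply: cvg_EFin; first exact: nearW.
apply: (@squeeze_approx _ _ (fun m p => C * S m p)
  (fun m => pairing_rate d A F L eta sigma * (2 * eta * sigma) ^+ m * 2)).
- by move=> p; exact/fine_ge0/strong_norm_ge0.
- move=> m; rewrite -[X in _ --> X](mulr0 C); apply: cvgM; first exact: cvg_cst.
  have -> : 0 = \sum_(w <- words m) (0 : R) by rewrite big1.
  apply: cvg_sum_seq => w; rewrite -[X in _ --> X](mul0r (2 ^+ m)).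
  apply: cvgM; last exact: cvg_cst.
  rewrite -(normr0 R) -(subrr (phi w * om w)); apply: cvg_norm.
  by apply: cvgB; [exact: cvgM|exact: cvg_cst].
- exact: (pairing_error_cvg d_gt0 eta0 sigma_ge q_lt1).
- move=> m p; rewrite -lee_fin fineK// (le_trans (le m p))// lee_fin lerD2l.
  by rewrite le_eqVlt; apply/orP; left; apply/eqP; ring.
Qed.

End continuity.

(** * Charges as products with the constant 1 *)

Section charge_algebra.
Context (R : realType) (d : nat).
Hypothesis d_gt0 : (0 < d)%N.
Implicit Types nu : cubeBV R d -> R.

Lemma is_bv_charge_sub nu nu' : is_bv_charge nu -> is_bv_charge nu' ->
  is_bv_charge (fun B => nu B - nu' B).
Proof.
move=> [add cts] [add' cts']; split=> [B1 B2 B B12 BU|B_ B BB].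
  by rewrite (add _ _ _ B12 BU) (add' _ _ _ B12 BU); ring.
by apply: cvgB; [exact: cts BB|exact: cts' BB].
Qed.

Lemma charge_ext nu nu' : is_bv_charge nu -> is_bv_charge nu' ->
  (forall w, cell_charge d_gt0 nu w = cell_charge d_gt0 nu' w) ->
  forall B, nu B = nu' B.
Proof.
move=> nuC nuC' nuE B; apply/eqP; rewrite -subr_eq0; apply/eqP.
apply: (charge_eq0 d_gt0 (is_bv_charge_sub nuC nuC')).
move=> K /(dyadic_cubeP d_gt0)[n [w _ /(cubeBV_cell (d_gt0 := d_gt0)) ->]].
by apply/eqP; rewrite subr_eq0; apply/eqP; exact: nuE.
Qed.

Variables (eta sigma : R).
Hypotheses (eta0 : 0 < eta <= 1) (sigma_ge : side_ratio R d <= sigma)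
  (q_lt1 : 2 * eta * sigma < 1).

(** A constant has oscillation [L = 0], so the error in [product_charge_cell] vanishes and the two
    charges agree on cells. The strong estimates for products thereby apply to [nu] itself. *)
Lemma product_charge1 nu (A : R) : 0 <= A -> is_bv_charge nu ->
  (forall w, `|cell_charge d_gt0 nu w| <= A * eta ^+ size w) ->
  product_charge d_gt0 (fun=> 1) (cell_charge d_gt0 nu) = nu.
Proof.
move=> A0 nuC nuA; have add := cell_charge_additive d_gt0 nuC.
have f1 (w : seq bool) : `|(1 : R)| <= 1 by rewrite normr1.
have osc (b : bool) (w : seq bool) : `|(1 : R) - 1| <= 0 * sigma ^+ size w.
  by rewrite subrr normr0 mul0r.
have pC := product_charge_is_bv_charge d_gt0 eta0 sigma_ge q_lt1 A0 ler01
  (lexx 0) add nuA f1 osc.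
apply/funext => B; apply: (charge_ext pC nuC) => w.
have := product_charge_cell d_gt0 eta0 sigma_ge q_lt1 A0 ler01
  (lexx 0) add nuA f1 osc w; rewrite /cell_charge.
by rewrite mulr0 !mul0r normr_le0 subr_eq0 mul1r => /eqP.
Qed.

End charge_algebra.

(** * Product of a Hölder function and a Hölder charge *)

Section holder_product.
Context (R : realType) (d : nat).
Hypothesis d_gt0 : (0 < d)%N.
Variables (beta gamma : R).
Hypotheses (beta01 : 0 < beta < 1) (gamma01 : 0 < gamma < 1)
  (beta_gamma : d%:R < beta + d%:R * gamma).
Implicit Types (f : cube R d -> R) (nu : cubeBV R d -> R).
Local Notation eta := (volume_ratio gamma).
Local Notation sigma := (holder_ratio d beta).
Local Notation q := (2 * eta * sigma).

Let eta0 := volume_ratio01 gamma01.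
Let sigma_ge := side_holder_ratio d_gt0 beta01.
Let q_lt1 := rate_lt1 d_gt0 beta_gamma.

Definition corner_value f w : R := f (corner R d_gt0 w).

Definition holder_product f nu : cubeBV R d -> R :=
  product_charge d_gt0 (corner_value f) (cell_charge d_gt0 nu).

Section bounds.
Variables (f : cube R d -> R) (nu : cubeBV R d -> R).
Hypotheses (fH : f \in holder_pred beta) (nuH : nu \in holder_charge_pred gamma).
Local Notation L := (fine (lip beta f)).
Local Notation F := (fine (sup_norm (cube R d) f)).
Local Notation H := (fine (holder_norm gamma nu)).

Lemma corner_value_le w : `|corner_value f w| <= F.
Proof. exact: (sup_norm_le d_gt0 beta01 fH). Qed.

Lemma corner_value_osc v w : `|corner_value f (v ++ w) - corner_value f w| <=
  2 * d%:R * L * sigma ^+ size w.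
Proof.
apply: (cell_oscillation (d_gt0 := d_gt0) beta01 fH).
- exact: (corner_cell R d_gt0 v).
- exact: (corner_cell R d_gt0 [::]).
Qed.

Lemma corner_osc_cst_ge0 : 0 <= 2 * d%:R * L.
Proof. by rewrite mulr_ge0 ?mulr_ge0 ?ler0n// (lip_ge0 d_gt0 beta f). Qed.

Lemma corner_sup_ge0 : 0 <= F.
Proof. exact: le_trans (normr_ge0 _) (corner_value_le [::]). Qed.

Lemma charge_cst_ge0 : 0 <= 2 ^+ d * H.
Proof. by rewrite mulr_ge0 ?exprn_ge0// (holder_norm_ge0 d_gt0 nuH). Qed.

Let nuC : is_bv_charge nu. Proof. by have /asboolP[] := nuH. Qed.

Lemma holder_product_cvg u : BV_function u ->
  cell_pairing d_gt0 (corner_value f) (cell_charge d_gt0 nu) u @ \oo -->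
  product_functional d_gt0 (corner_value f) (cell_charge d_gt0 nu) u.
Proof.
move=> bu; apply: (product_functional_cvg eta0 sigma_ge q_lt1
  charge_cst_ge0 corner_sup_ge0 corner_osc_cst_ge0) => //.
- exact: cell_charge_additive.
- exact: cell_charge_le.
- exact: corner_value_le.
- by move=> b w; exact: (corner_value_osc [:: b]).
Qed.

Lemma holder_product_is_bv_charge : is_bv_charge (holder_product f nu).
Proof.
apply: (product_charge_is_bv_charge d_gt0 eta0 sigma_ge q_lt1
  charge_cst_ge0 corner_sup_ge0 corner_osc_cst_ge0) => //.
- exact: cell_charge_additive.
- exact: cell_charge_le.
- exact: corner_value_le.
- by move=> b w; exact: (corner_value_osc [:: b]).
Qed.

(** The 1 bounds the main term [f] times [nu] at the corner. The rest is the constant of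
    [product_charge_cell] with oscillation [2 * d%:R * L] and mass [2 ^+ d * H]. *)
Definition holder_product_cst : R := 1 + 4 * d%:R * 2 ^+ d / (1 - q).

Lemma holder_product_cst_ge0 : 0 <= holder_product_cst.
Proof.
by rewrite addr_ge0// divr_ge0 ?subr_ge0 ?(ltW q_lt1)// mulr_ge0 ?exprn_ge0//
  mulr_ge0 ?ler0n.
Qed.

Lemma holder_product_cell n w : size w = (n * d)%N ->
  `|cell_charge d_gt0 (holder_product f nu) w| <= holder_product_cst *
    (`|corner_value f w| + sigma ^+ size w * L) * H * eta ^+ size w.
Proof.
move=> wn; have L0 : 0 <= L by exact: (lip_ge0 d_gt0 beta f).
have H0 := holder_norm_ge0 d_gt0 nuH.
have /andP[e0 _] := eta0; have /andP[s0 _] := holder_ratio01 d_gt0 beta01.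
have E0 : 0 <= eta ^+ size w by rewrite exprn_ge0// ltW.
have S0 : 0 <= sigma ^+ size w by rewrite exprn_ge0// ltW.
have h : `|cell_charge d_gt0 (holder_product f nu) w -
    corner_value f w * cell_charge d_gt0 nu w| <=
    2 * (2 * d%:R * L) * (2 ^+ d * H) * (eta * sigma) ^+ size w / (1 - q).
  apply: (product_charge_cell d_gt0 eta0 sigma_ge q_lt1
    charge_cst_ge0 corner_sup_ge0 corner_osc_cst_ge0) => //.
  - exact: cell_charge_additive.
  - exact: cell_charge_le.
  - exact: corner_value_le.
  - by move=> b v; exact: (corner_value_osc [:: b]).
have h' : `|corner_value f w * cell_charge d_gt0 nu w| <=
    `|corner_value f w| * (H * eta ^+ size w).
  by rewrite normrM ler_wpM2l// (dyadic_charge_le d_gt0 nuH wn).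
rewrite -[X in `|X|](subrK (corner_value f w * cell_charge d_gt0 nu w)).
apply: le_trans (ler_normD _ _) (le_trans (lerD h h') _).
rewrite exprMn; move: (eta ^+ size w) (sigma ^+ size w) E0 S0 => E S E0 S0.
move: `|corner_value f w| (normr_ge0 (corner_value f w)) => N N0.
pose K := 4 * d%:R * 2 ^+ d / (1 - q).
have K0 : 0 <= K.
  by rewrite divr_ge0 ?subr_ge0 ?(ltW q_lt1)// mulr_ge0 ?exprn_ge0// mulr_ge0 ?ler0n.
rewrite -subr_ge0 /holder_product_cst -/K.
have -> : 2 * (2 * d%:R * L) * (2 ^+ d * H) * (E * S) / (1 - q) = K * S * L * H * E.
  by rewrite /K; ring.
have -> : (1 + K) * (N + S * L) * H * E - (K * S * L * H * E + N * (H * E)) =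
  S * L * H * E + K * N * H * E by ring.
by clearbody K; rewrite addr_ge0// !mulr_ge0.
Qed.

Lemma holder_product_norm_le :
  (holder_norm gamma (holder_product f nu) <=
    (holder_product_cst * (F + L) * H)%:E)%E.
Proof.
have L0 : 0 <= L by exact: (lip_ge0 d_gt0 beta f).
have H0 := holder_norm_ge0 d_gt0 nuH; have /andP[e0 _] := eta0.
have /andP[s0 s1] := holder_ratio01 d_gt0 beta01.
apply: (holder_norm_le (d_gt0 := d_gt0)) => n w wn.
rewrite (le_trans (holder_product_cell wn))// ler_wpM2r ?exprn_ge0 ?(ltW e0)//.
rewrite ler_wpM2r// ler_wpM2l ?holder_product_cst_ge0// lerD//.
  exact: corner_value_le.
by rewrite ler_piMl// exprn_ile1// ltW.
Qed.

Lemma holder_product_mem : holder_product f nu \in holder_charge_pred gamma.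
Proof.
apply/asboolP; split; first exact: holder_product_is_bv_charge.
by apply: le_lt_trans holder_product_norm_le _; rewrite ltry.
Qed.

End bounds.

Lemma holder_product_combl (a : R) f g nu :
  f \in holder_pred beta -> g \in holder_pred beta ->
  nu \in holder_charge_pred gamma ->
  holder_product (a *: f + g) nu = a *: holder_product f nu + holder_product g nu.
Proof.
move=> fH gH nuH; apply/funext => B.
have fgH : (a *: f + g) \in holder_pred beta.
  by have [_ h] := @holder_submod_closed R d beta; exact: h.
have bB := BV_function_indic B.
apply: (cvg_unique (@Rhausdorff R) (holder_product_cvg fgH nuH bB)).
have -> : cell_pairing d_gt0 (corner_value (a *: f + g)) (cell_charge d_gt0 nu) \1_B =
    (fun m => a * cell_pairing d_gt0 (corner_value f) (cell_charge d_gt0 nu) \1_B m +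
    cell_pairing d_gt0 (corner_value g) (cell_charge d_gt0 nu) \1_B m).
  apply/funext => m; rewrite /cell_pairing mulr_sumr -big_split.
  apply: eq_bigr => w _ /=.
  have -> : corner_value (a *: f + g) w = a * corner_value f w + corner_value g w by [].
  by move: (cell_integral _ _ _) => x; ring.
apply: cvgD; last exact: holder_product_cvg.
by apply: cvgM; [exact: cvg_cst|exact: holder_product_cvg].
Qed.

Lemma holder_product_combr (a : R) f nu nu' :
  f \in holder_pred beta ->
  nu \in holder_charge_pred gamma -> nu' \in holder_charge_pred gamma ->
  holder_product f (a *: nu + nu') = a *: holder_product f nu + holder_product f nu'.
Proof.
move=> fH nuH nuH'; apply/funext => B.
have nuH2 : (a *: nu + nu') \in holder_charge_pred gamma.
  by have [_ h] := @holder_charge_submod_closed R d gamma; exact: h.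
have bB := BV_function_indic B.
apply: (cvg_unique (@Rhausdorff R) (holder_product_cvg fH nuH2 bB)).
have -> : cell_pairing d_gt0 (corner_value f) (cell_charge d_gt0 (a *: nu + nu')) \1_B =
    (fun m => a * cell_pairing d_gt0 (corner_value f) (cell_charge d_gt0 nu) \1_B m +
    cell_pairing d_gt0 (corner_value f) (cell_charge d_gt0 nu') \1_B m).
  apply/funext => m; rewrite /cell_pairing mulr_sumr -big_split.
  apply: eq_bigr => w _ /=.
  have -> : cell_charge d_gt0 (a *: nu + nu') w =
    a * cell_charge d_gt0 nu w + cell_charge d_gt0 nu' w by [].
  by move: (cell_integral _ _ _) => x; ring.
apply: cvgD; last exact: holder_product_cvg.
by apply: cvgM; [exact: cvg_cst|exact: holder_product_cvg].
Qed.

End holder_product.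

(** * Charges with step densities *)

Section step_charges.
Context (R : realType) (d : nat).
Hypothesis d_gt0 : (0 < d)%N.
Implicit Types (nu : cubeBV R d -> R) (w : seq bool).

(** The charge with the density constant on the cells of level [n] which gives
    them the mass of [nu]. *)
Definition step_charge nu n : cubeBV R d -> R :=
  fun B => cell_pairing d_gt0 (fun=> 1) (cell_charge d_gt0 nu) \1_B n.

Definition step_density nu n : cube R d -> R :=
  cube_step d_gt0 n (fun w => 1 * cell_charge d_gt0 nu w * 2 ^+ n).

Lemma step_chargeE nu n : step_charge nu n = density (step_density nu n).
Proof.
apply/funext => B; have [iB _ _] := BV_function_indic B.
rewrite /density -Rintegral_indicM; apply/esym.
exact: (pairing_cube_step d_gt0 n (fun w => 1 * cell_charge d_gt0 nu w * 2 ^+ n) iB).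
Qed.

Lemma Lp_step_density nu n (p : R) : 0 < p -> Lp p (step_density nu n).
Proof.
move=> p0; have [M _ HM] := step_bounded d_gt0 n
  (fun w => 1 * cell_charge d_gt0 nu w * 2 ^+ n).
have E := valL_cube_step d_gt0 n (fun w => 1 * cell_charge d_gt0 nu w * 2 ^+ n).
apply: (@Lp_bounded R d p (step_density nu n) M p0).
  by rewrite E; exact: measurable_step.
by move=> x; rewrite E.
Qed.

Lemma step_charge_is_bv_charge nu n : is_bv_charge (step_charge nu n).
Proof.
split=> [B1 B2 B B12 BU|B_ B [BB _]]; first exact: cell_pairing_indicU.
apply/subr_cvg0; apply: norm_cvg0.
apply: (@squeeze_cvgr _ _ _ _ (fun=> 0) (fun p =>
  (\sum_(w <- words n) `|1 * cell_charge d_gt0 nu w * 2 ^+ n|) *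
  fine (leb R d (B_ p `+` B)))).
- by apply: nearW => p; rewrite normr_ge0 /= cell_pairing_indic_dist.
- exact: cvg_cst.
- rewrite -[X in _ --> X](mulr0 (\sum_(w <- words n) `|1 * cell_charge d_gt0 nu w * 2 ^+ n|)).
  by apply: cvgM; [exact: cvg_cst|exact: (fine_cvg BB)].
Qed.

Lemma step_charge_coarse nu n w : is_bv_charge nu -> (size w <= n)%N ->
  cell_charge d_gt0 (step_charge nu n) w = cell_charge d_gt0 nu w.
Proof.
move=> nuC wn; rewrite [LHS](_ : _ =
  cell_pairing d_gt0 (fun=> 1) (cell_charge d_gt0 nu) \1_(cell d_gt0 w) n)//.
rewrite -(subnK wn) cell_pairing_cell.
rewrite [RHS](tree_additive_words (n - size w) w (cell_charge_additive d_gt0 nuC)).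
by apply: eq_bigr => v _; rewrite mul1r.
Qed.

Lemma step_charge_fine nu v w :
  cell_charge d_gt0 (step_charge nu (size w)) (v ++ w) =
  cell_charge d_gt0 nu w * 2^-1 ^+ size v.
Proof.
rewrite [LHS](_ : _ = cell_pairing d_gt0 (fun=> 1) (cell_charge d_gt0 nu)
  \1_(cell d_gt0 (v ++ w)) (size w))//.
(* Both sides measure the same intersection; exchanging the roles allows the lemmas on subcells
   [v ++ w] to apply. *)
have comm w' : cell_integral d_gt0 \1_(cell d_gt0 (v ++ w)) w' =
    cell_integral d_gt0 \1_(cell d_gt0 w') (v ++ w) :> R.
  rewrite !cell_integral_indic; [|exact: measurable_cell..].
  by rewrite setIC.
rewrite /cell_pairing (bigD1_seq w) ?words_uniq ?mem_words//=.
rewrite [X in _ + X](_ : _ = 0) ?addr0; last first.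
  rewrite big_seq_cond; apply: big1 => w' /andP[w'w ne].
  by rewrite comm cell_integral_cell_out ?mulr0 ?(size_words w'w)// eq_sym.
rewrite comm cell_integral_cell_sub size_cat exprD mul1r -!mulrA.
have E : 2 ^+ size w * 2^-1 ^+ size w = 1 :> R.
  by rewrite -exprMn divff ?expr1n// pnatr_eq0.
by rewrite [2 ^+ _ * _]mulrCA E mulr1.
Qed.

(** Up to level [n] the step charge equals [nu] on cells; beyond, it is halved with the cell, a
    decay at least as fast as that of [eta]. *)
Lemma step_charge_le nu n (A eta : R) : is_bv_charge nu -> 0 <= A -> 2^-1 <= eta ->
  (forall w, `|cell_charge d_gt0 nu w| <= A * eta ^+ size w) ->
  forall w, `|cell_charge d_gt0 (step_charge nu n) w| <= A * eta ^+ size w.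
Proof.
move=> nuC A0 eta2 nuA w; have [wn|nw] := leqP (size w) n.
  by rewrite step_charge_coarse.
have eta0 : 0 <= eta by apply: le_trans eta2; rewrite invr_ge0.
rewrite -(cat_take_drop (size w - n) w); set v := take _ w; set w' := drop _ w.
have w'n : size w' = n by rewrite size_drop subKn// ltnW.
rewrite -w'n step_charge_fine normrM (ger0_norm (x := _ ^+ size v)); last first.
  by rewrite exprn_ge0// invr_ge0.
rewrite size_cat addnC exprD mulrA ler_pM ?exprn_ge0 ?invr_ge0//.
by rewrite lerXn2r// nnegrE ?invr_ge0.
Qed.

End step_charges.

(** * Sequential continuity in the strong norm *)

Section sequential_continuity.
Context (R : realType) (d : nat).
Hypothesis d_gt0 : (0 < d)%N.
Variables (beta gamma : R).
Hypotheses (beta01 : 0 < beta < 1) (gamma01 : 0 < gamma < 1)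
  (beta_gamma : d%:R < beta + d%:R * gamma).
Local Notation eta := (volume_ratio gamma).
Local Notation sigma := (holder_ratio d beta).

Let eta0 := volume_ratio01 gamma01.
Let sigma_ge := side_holder_ratio d_gt0 beta01.
Let q_lt1 := rate_lt1 d_gt0 beta_gamma.

Lemma half_le_volume_ratio : 2^-1 <= eta.
Proof.
have /andP[_ g1] := gamma01; rewrite -powR_inv1// ler_powR ?ler1n//.
by rewrite lerN2 ltW.
Qed.

Lemma holder_product1 nu : nu \in holder_charge_pred gamma ->
  product_charge d_gt0 (fun=> 1) (cell_charge d_gt0 nu) = nu.
Proof.
move=> nuH; have /asboolP[nuC _] := nuH.
exact: (product_charge1 eta0 sigma_ge q_lt1 (charge_cst_ge0 d_gt0 nuH) nuC
  (cell_charge_le d_gt0 gamma01 nuH)).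
Qed.

Lemma step_charge_holder_norm nu n : nu \in holder_charge_pred gamma ->
  (holder_norm gamma (step_charge d_gt0 nu n) <=
    (2 ^+ d * fine (holder_norm gamma nu))%:E)%E.
Proof.
move=> nuH; have /asboolP[nuC _] := nuH.
apply: (holder_norm_le (d_gt0 := d_gt0)) => k w _.
exact: (step_charge_le n nuC (charge_cst_ge0 d_gt0 nuH) half_le_volume_ratio
  (cell_charge_le d_gt0 gamma01 nuH)).
Qed.

Lemma step_charge_mem nu n : nu \in holder_charge_pred gamma ->
  step_charge d_gt0 nu n \in holder_charge_pred gamma.
Proof.
move=> nuH; apply/asboolP; split; first exact: step_charge_is_bv_charge.
by apply: le_lt_trans (step_charge_holder_norm n nuH) _; rewrite ltry.
Qed.

(** Both charges are products with the constant 1, and on each cell [w] they coincide once [n]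
    reaches [size w]. *)
Lemma step_charge_strong_cvg nu : nu \in holder_charge_pred gamma ->
  (fun n => strong_norm (fun B => (step_charge d_gt0 nu n B - nu B)%R)) @ \oo --> 0%E.
Proof.
move=> nuH; have /asboolP[nuC _] := nuH.
have A0 := charge_cst_ge0 d_gt0 nuH.
have nuA := cell_charge_le d_gt0 gamma01 nuH.
have E n : (fun B => step_charge d_gt0 nu n B - nu B) =
    (fun B => product_charge d_gt0 (fun=> 1) (cell_charge d_gt0 (step_charge d_gt0 nu n)) B -
      product_charge d_gt0 (fun=> 1) (cell_charge d_gt0 nu) B).
  by rewrite !holder_product1//; exact: step_charge_mem.
under eq_fun do rewrite E.
apply: (@product_strong_cvg R d d_gt0 eta sigma eta0 sigma_ge q_lt1
  (fun _ _ => 1) (fun n => cell_charge d_gt0 (step_charge d_gt0 nu n)) (fun=> 1)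
  (cell_charge d_gt0 nu) (2 ^+ d * fine (holder_norm gamma nu)) 1 0
  A0 ler01 (lexx 0)).
- by move=> n; apply: cell_charge_additive; exact: step_charge_is_bv_charge.
- exact: cell_charge_additive.
- by move=> n; exact: (step_charge_le n nuC A0 half_le_volume_ratio nuA).
- exact: nuA.
- by move=> _ _; rewrite normr1.
- by move=> _; rewrite normr1.
- by move=> _ b w; rewrite subrr normr0 mul0r.
- by move=> b w; rewrite subrr normr0 mul0r.
- by move=> w; exact: cvg_cst.
- move=> w; apply: cvg_near_cst; exists (size w) => // n wn.
  exact: step_charge_coarse.
Qed.

(** Pointwise convergence gives convergence on cells. What remains is to extract bounds common to
    the sequence and its limit. *)
Lemma holder_product_strong_cvg (f_ : nat -> cube R d -> R) (f : cube R d -> R)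
    (nu_ : nat -> cubeBV R d -> R) (nu : cubeBV R d -> R) :
  (forall p, f_ p \in holder_pred beta) -> f \in holder_pred beta ->
  (forall p, nu_ p \in holder_charge_pred gamma) -> nu \in holder_charge_pred gamma ->
  (forall x, f_ ^~ x @ \oo --> f x) ->
  (forall B, nu_ ^~ B @ \oo --> nu B) ->
  (ereal_sup (range (fun p => lip beta (f_ p))) < +oo)%E ->
  (ereal_sup (range (fun p => holder_norm gamma (nu_ p))) < +oo)%E ->
  (fun p => strong_norm (fun B => (holder_product d_gt0 (f_ p) (nu_ p) B -
    holder_product d_gt0 f nu B)%R)) @ \oo --> 0%E.
Proof.
move=> fH_ fH nuH_ nuH cf cnu Loo Hoo.
(* The parameter [c] receives the value at the limit, so that one bound covers the sequence and the
   limit. *)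
have bnd (F : nat -> \bar R) (c : R) : (forall p, F p \is a fin_num) ->
    (ereal_sup (range F) < +oo)%E ->
    exists2 M : R, c <= M & forall p, fine (F p) <= M.
  move=> Ffin Soo; pose S := ereal_sup (range F).
  have le p : (F p <= S)%E by apply: ereal_sup_ubound; exists p.
  exists (Num.max c (fine S)); first by rewrite le_max lexx.
  move=> p; rewrite le_max fine_le ?orbT//.
  rewrite fin_numElt Soo andbT (lt_le_trans _ (le 0%N))//.
  by have := Ffin 0%N; rewrite fin_numElt => /andP[].
have [L LL LL_] := bnd (fun p => lip beta (f_ p)) (fine (lip beta f))
  (fun p => lip_fin d_gt0 (fH_ p)) Loo.
have [H HH HH_] := bnd (fun p => holder_norm gamma (nu_ p)) (fine (holder_norm gamma nu))
  (fun p => holder_norm_fin d_gt0 (nuH_ p)) Hoo.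
pose x0 := corner R d_gt0 [::].
have L0 : 0 <= L by apply: le_trans LL; exact: (lip_ge0 d_gt0 beta f).
have H0 : 0 <= H by apply: le_trans HH; exact: (holder_norm_ge0 d_gt0 nuH).
have [M M0 HM] : exists2 M, 0 <= M & forall p, `|f_ p x0| <= M.
  have [M [_ HM]] := cvg_seq_bounded (cvgP _ (cf x0)).
  have M1 : M < `|M| + 1 by rewrite (le_lt_trans (ler_norm M))// ltrDl.
  exists (`|M| + 1); first by rewrite addr_ge0.
  by move=> p; exact: HM.
(* A common sup bound for the [f_ p]: their values at one corner converge and so are bounded by [M],
   and the oscillation over the cube is at most [2 * d%:R * L]. *)
pose F := Num.max (fine (sup_norm (cube R d) f)) (M + 2 * d%:R * L).
have F0 : 0 <= F.
  by rewrite le_max; apply/orP; left; exact: (corner_sup_ge0 d_gt0 beta01 fH).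
have d0 : 0 <= 2 * d%:R :> R by rewrite mulr_ge0.
have oscL g v w : g \in holder_pred beta -> fine (lip beta g) <= L ->
    `|corner_value d_gt0 g (v ++ w) - corner_value d_gt0 g w| <=
    2 * d%:R * L * sigma ^+ size w.
  move=> gH gL; rewrite (le_trans (corner_value_osc d_gt0 beta01 gH v w))//.
  by rewrite ler_wpM2r ?exprn_ge0 ?powR_ge0// ler_wpM2l.
have cL nu' w : nu' \in holder_charge_pred gamma ->
    fine (holder_norm gamma nu') <= H ->
    `|cell_charge d_gt0 nu' w| <= 2 ^+ d * H * eta ^+ size w.
  move=> nuH' nuH2; rewrite (le_trans (cell_charge_le d_gt0 gamma01 nuH' w))//.
  by rewrite ler_wpM2r ?exprn_ge0 ?powR_ge0// ler_wpM2l// exprn_ge0.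
apply: (@product_strong_cvg R d d_gt0 eta sigma eta0 sigma_ge q_lt1
  (fun p => corner_value d_gt0 (f_ p)) (fun p => cell_charge d_gt0 (nu_ p))
  (corner_value d_gt0 f) (cell_charge d_gt0 nu) (2 ^+ d * H) F (2 * d%:R * L)) => //.
- by rewrite mulr_ge0// exprn_ge0.
- by rewrite mulr_ge0.
- by move=> p; have /asboolP[? _] := nuH_ p; exact: cell_charge_additive.
- by have /asboolP[? _] := nuH; exact: cell_charge_additive.
- by move=> p w; exact: cL.
- by move=> w; exact: cL.
- move=> p w; rewrite le_max; apply/orP; right.
  have := oscL (f_ p) w [::] (fH_ p) (LL_ p); rewrite cats0 expr0 mulr1 => h.
  rewrite -(subrK (corner_value d_gt0 (f_ p) [::]) (corner_value d_gt0 (f_ p) w)).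
  by rewrite (le_trans (ler_normD _ _))// addrC lerD// HM.
- move=> w; rewrite le_max; apply/orP; left.
  exact: (corner_value_le d_gt0 beta01 fH).
- by move=> p b w; exact: (oscL _ [:: b]).
- by move=> b w; exact: (oscL _ [:: b]).
- by move=> w; exact: cf.
- by move=> w; exact: cnu.
Qed.

End sequential_continuity.

(** * Products of densities *)

Section densities.
Context (R : realType) (d : nat).
Hypothesis d_gt0 : (0 < d)%N.
Implicit Types (g : cube R d -> R) (G : Rd R d -> R).
Local Notation ext g := ('valL_0 g : Rd R d -> R).

Lemma Rintegral_dist G (B B' : set (Rd R d)) : measurable B -> measurable B' ->
  (leb R d).-integrable setT (EFin \o G) ->
  `|\int[leb R d]_(x in B) G x - \int[leb R d]_(x in B') G x| <=
  \int[leb R d]_(x in B `+` B') `|G x|.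
Proof.
move=> mB mB' iG; rewrite -(Rintegral_indicM _ B) -(Rintegral_indicM _ B')
  -(Rintegral_indicM _ (B `+` B')).
have iB := integrable_indicM mB iG; have iB' := integrable_indicM mB' iG.
rewrite -RintegralB//; apply: le_trans (le_normr_Rintegral _ _) _ => //.
  by have := integrableB measurableT iB iB'; exact: eq_integrable.
rewrite le_eqVlt; apply/orP; left; apply/eqP; apply: eq_Rintegral => x _.
rewrite -mulrBr normrM; congr (_ * _); rewrite !indicE.
have -> : (x \in B `+` B') = (x \in B) (+) (x \in B').
  have [Bx|Bx] := pselect (B x); have [B'x|B'x] := pselect (B' x);
    rewrite ?(mem_set Bx) ?(memNset Bx) ?(mem_set B'x) ?(memNset B'x) /=.
  - by apply: memNset => -[[]|[]].
  - by apply: mem_set; left.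
  - by apply: mem_set; right.
  - by apply: memNset => -[[]|[]].
by case: (x \in B); case: (x \in B'); rewrite /= ?subrr ?subr0 ?sub0r ?normrN ?normr0 ?normr1.
Qed.

Lemma density_is_bv_charge g : (leb R d).-integrable setT (EFin \o ext g) ->
  is_bv_charge (density g).
Proof.
move=> ig; split=> [B1 B2 B B12 BU|B_ B [BB _]].
  rewrite /density BU Rintegral_setU_null//; try exact: measurable_cubeBV.
  by apply: integrableS ig => //; apply: measurableU; exact: measurable_cubeBV.
apply/cvgrPdist_le => e e0.
have [r [r0 Hr]] := integral_normr_continuous ig e0.
have /fine_cvgP[fin /cvgrPdist_lt/(_ _ r0) lim] := BB.
apply: filterS2 fin lim => n fin lim; rewrite distrC.
apply: le_trans (Rintegral_dist (measurable_cubeBV _) (measurable_cubeBV _) ig) _.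
apply/ltW/Hr.
  by apply: measurableU; apply: measurableD; exact: measurable_cubeBV.
apply: (@le_lt_trans _ _ (fine (leb R d (B_ n `+` B)))%:E).
  by rewrite fineK.
by rewrite lte_fin (le_lt_trans _ lim)// sub0r normrN; exact: ler_norm.
Qed.

(** The absolute value of [g] is at most the indicator of the cube plus its power [p]. *)
Lemma Lp_integrable g (p : R) : 1 <= p -> Lp p g ->
  (leb R d).-integrable setT (EFin \o ext g).
Proof.
move=> p1 gp; have mg : measurable_fun setT (ext g).
  by have := gp; rewrite /Lp inE => /andP[/set_mem].
have ip := Lfun_integrable p1 gp.
have ic : (leb R d).-integrable setT (EFin \o (\1_(cube R d) : Rd R d -> R)).
  by apply: integrable_indic_lty; [exact: measurable_box|exact: leb_cube_lty].
apply: (le_integrable measurableT _ _ (integrableD measurableT ic ip)).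
  exact/measurable_EFinP.
move=> x _; rewrite /comp -EFinD abse_EFin lee_fin.
have [xc|xc] := boolP (x \in cube R d).
  rewrite indicE xc (ger0_norm (x := true%:R + _)) ?addr_ge0 ?powR_ge0//.
  have [g1|g1] := leP `|ext g x| 1.
    by apply: (le_trans g1); rewrite lerDl powR_ge0.
  apply: (@le_trans _ _ (`|ext g x| `^ p)); last by rewrite lerDr.
  by rewrite -[leLHS]powRr1//; apply: ler_powR => //; exact: ltW.
have -> : ext g x = 0 by exact: valL_out.
by rewrite normr0.
Qed.

Section holder_density.
Variables (beta : R) (f : cube R d -> R).
Hypotheses (beta01 : 0 < beta < 1) (fH : f \in holder_pred beta).
Local Notation L := (fine (lip beta f)).

(** Composing [f] with the coordinatewise projection onto the cube extends it continuously to the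
    whole space; the extension by zero is then measurable as a product with an indicator. *)
Let clamp (x : 'rV[R]_d) : 'rV[R]_d := \row_i Num.max 0 (Num.min 1 (x 0 i)).

Let clamp_cube x : clamp x \in cube R d.
Proof. by apply/mem_set => i; rewrite !mxE le_max lexx ge_max ler01 ge_min lexx. Qed.

Let extend (x : 'rV[R]_d) : R := f (SigSub (clamp_cube x)).

Let enorm_clamp x y : enorm (clamp x - clamp y) <= d%:R * `|x - y|.
Proof.
apply: le_trans (enorm_le_sum _) _.
apply: (@le_trans _ _ (\sum_(i < d) `|x - y|)); last first.
  by rewrite sumr_const card_ord mulr_natl.
apply: ler_sum => i _; apply: le_trans (normr_coord_le (x - y) i).
rewrite !mxE; move: (x 0 i) (y 0 i) => a b.
have m01 : Num.max 0 1 = 1 :> R by exact/max_r/ler01.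
case: (leP 1 a) => a1; case: (leP 1 b) => b1; rewrite ?m01 ?subrr ?normr0//.
- by case: (leP 0 b) => b0; rewrite !ger0_norm; lra.
- by case: (leP 0 a) => a0; rewrite ler_norml; case: (ger0P (a - b)); lra.
- by case: (leP 0 a) => a0; case: (leP 0 b) => b0; rewrite ler_norml;
    case: (ger0P (a - b)); lra.
Qed.

Let extend_continuous : continuous extend.
Proof.
move=> x; have /andP[b0 b1] := beta01; have L0 := lip_ge0 d_gt0 beta f.
apply/(cvgrPdist_le (FF := nbhs_filter x)) => e e0; have L1 : 0 < L + 1 by rewrite ltr_wpDl.
have d0 : 0 < d%:R :> R by rewrite ltr0n.
(* Solves [s ^ beta = e / (L + 1)]; the 1 keeps the denominator positive when [L = 0]. *)
pose s := (e / (L + 1)) `^ beta^-1.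
have s0 : 0 < s by rewrite powR_gt0// divr_gt0.
apply/nbhs_ballP; exists (s / d%:R) => /=; first by rewrite divr_gt0.
move=> y; rewrite -ball_normE /= => /ltW xy.
apply: le_trans (lip_le d_gt0 beta01 fH (s := s) _) _.
  rewrite /=; apply: le_trans (enorm_clamp x y) _.
  by rewrite -ler_pdivlMl// mulrC.
rewrite /s -powRrM mulVf ?gt_eqF// powRr1; last by rewrite divr_ge0// ltW.
by rewrite mulrA ler_pdivrMr// mulrC ler_wpM2l ?(ltW e0)// lerDl.
Qed.

Lemma extE g x : cube R d x -> exists2 x' : cube R d, val x' = x & ext g x = g x'.
Proof.
move=> /mem_set xc; exists (SigSub xc) => //.
exact: (valL_in g (SigSub xc)).
Qed.

Let ext_holder x : ext f x = extend x * \1_(cube R d) x.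
Proof.
have [/set_mem xc|xc] := boolP (x \in cube R d); last first.
  by rewrite (valL_out f xc) indicE (negbTE xc) mulr0.
have [x' xE ->] := extE f xc; rewrite indicE mem_set// mulr1.
congr f; apply/val_inj => /=; rewrite xE; apply/rowP => i.
rewrite mxE; have := xc i; rewrite !mxE => /andP[x0 x1].
by rewrite min_r// max_r.
Qed.

Lemma measurable_ext_holder : measurable_fun setT (ext f).
Proof.
rewrite (_ : ext f = fun x => extend x * \1_(cube R d) x); last first.
  by apply/funext => x; exact: ext_holder.
apply: measurable_funM.
  exact: (continuous_measurable_Rd extend_continuous).
by apply: measurable_indic; exact: measurable_box.
Qed.

Let extM g x : ext (f \* g) x = ext f x * ext g x.
Proof.
have [xc|xc] := boolP (x \in cube R d); last first.
  by rewrite (valL_out f xc) (valL_out (f \* g) xc) mul0r.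
by rewrite (valL_in f (SigSub xc)) (valL_in g (SigSub xc)) (valL_in (f \* g) (SigSub xc)).
Qed.

Lemma integrable_holderM g : (leb R d).-integrable setT (EFin \o ext g) ->
  (leb R d).-integrable setT (EFin \o ext (f \* g)).
Proof.
move=> ig; have F0 := corner_sup_ge0 d_gt0 beta01 fH.
set F := fine (sup_norm (cube R d) f) in F0.
have mg : measurable_fun setT (ext g).
  by have /integrableP[/measurable_EFinP] := ig.
apply: (le_integrable measurableT _ _ (integrableZl measurableT F ig)).
  apply/measurable_EFinP; rewrite (_ : ext (f \* g) = fun x => ext f x * ext g x).
    by apply: measurable_funM; [exact: measurable_ext_holder|exact: mg].
  by apply/funext => x; exact: extM.
move=> x _; rewrite /comp -EFinM !abse_EFin lee_fin (extM g x) !normrM ler_wpM2r//.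
rewrite (ger0_norm F0); have [xc|xc] := boolP (x \in cube R d).
  by rewrite (valL_in f (SigSub xc)); exact: (sup_norm_le d_gt0 beta01 fH).
by rewrite (valL_out f xc) normr0.
Qed.

Lemma density_holderM_cell g w : (leb R d).-integrable setT (EFin \o ext g) ->
  `|cell_charge d_gt0 (density (f \* g)) w -
    corner_value d_gt0 f w * cell_charge d_gt0 (density g) w| <=
  2 * d%:R * L * holder_ratio d beta ^+ size w *
    cell_integral d_gt0 (fun x => `|ext g x|) w.
Proof.
move=> ig; have ifg := integrable_holderM ig.
have mw := @measurable_cell R d d_gt0 w.
set c := corner_value _ _ _; set M := 2 * _ * _ * _.
have ig' := integrableS measurableT mw (subsetT _) ig.
have ifg' := integrableS measurableT mw (subsetT _) ifg.
have icg : (leb R d).-integrable (cell d_gt0 w) (EFin \o (fun x => c * ext g x)).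
  by have := integrableZl mw c ig'; exact: eq_integrable.
have in' := integrable_norm ig'.
rewrite /cell_charge /density -RintegralZl// -RintegralB//.
have i1 : (leb R d).-integrable (cell d_gt0 w)
    (EFin \o (fun x => ext (f \* g) x - c * ext g x)).
  by have := integrableB mw ifg' icg; exact: eq_integrable.
apply: le_trans (le_normr_Rintegral mw i1) _.
rewrite /cell_integral -RintegralZl//; apply: le_Rintegral => //.
- exact: (integrable_norm i1).
- by have := integrableZl mw M in'; exact: eq_integrable.
move=> x wx; have xc := sub_cell_cube wx.
have [x' xE fx] := extE f xc.
rewrite (extM g x) -mulrBl normrM ler_wpM2r// fx.
apply: (cell_oscillation (d_gt0 := d_gt0) beta01 fH); first by rewrite xE.
exact: (corner_cell R d_gt0 [::]).
Qed.

(** It suffices to compare on cells, where the product is the limit of Riemann sums. On subcells [k]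
    levels down, [f] is within a multiple of [sigma ^+ k] of its corner value, and the integrals of
    the absolute value of [g] over them add up to a fixed number. *)
Lemma holder_product_density gamma g : 0 < gamma < 1 ->
  d%:R < beta + d%:R * gamma ->
  (leb R d).-integrable setT (EFin \o ext g) ->
  density g \in holder_charge_pred gamma ->
  holder_product d_gt0 f (density g) = density (f \* g).
Proof.
move=> gamma01 bg ig gH; have ifg := integrable_holderM ig.
have gC := density_is_bv_charge ig; have fgC := density_is_bv_charge ifg.
apply/funext => B; apply: (charge_ext (d_gt0 := d_gt0)) => //.
  exact: (holder_product_is_bv_charge d_gt0 beta01 gamma01 bg).
move=> w.
have := cell_pairing_cell_cvg (holder_product_cvg (d_gt0 := d_gt0) beta01 gamma01 bg fH gH
  (BV_function_indic (cellBV R d_gt0 w))).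
set s := fun k => _ => sl; apply: (cvg_unique (@Rhausdorff R) sl).
pose N := cell_integral d_gt0 (fun x => `|ext g x|).
have Nadd : tree_additive N.
  by move=> v; apply: cell_integral_split; exact: (integrable_norm ig).
set M := 2 * d%:R * L; set sigma := holder_ratio d beta.
have /andP[s0 s1] : 0 < sigma < 1.
  have /andP[b0 _] := beta01; rewrite powR_gt0//= powR2_lt1// oppr_lt0 divr_gt0//.
  by rewrite ltr0n.
apply/subr_cvg0; apply: norm_cvg0.
apply: (@squeeze_cvgr _ _ _ _ (fun=> 0) (fun k => M * sigma ^+ size w * N w * sigma ^+ k)).
- apply: nearW => k; rewrite normr_ge0 /= distrC.
  rewrite (tree_additive_words k w (cell_charge_additive d_gt0 fgC)) /s -sumrB.
  rewrite (le_trans (ler_norm_sum _ _ _))// (tree_additive_words k w Nadd).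
  rewrite mulr_sumr mulr_suml big_seq [leRHS]big_seq; apply: ler_sum => v vk.
  apply: le_trans (density_holderM_cell (v ++ w) ig) _.
  rewrite size_cat (size_words vk) exprD -/(N _) -/M -/sigma.
  by rewrite le_eqVlt; apply/orP; left; apply/eqP; ring.
- exact: cvg_cst.
- rewrite -[X in _ --> X](mulr0 (M * sigma ^+ size w * N w)).
  apply: cvgM; first exact: cvg_cst.
  by apply: cvg_expr; rewrite ger0_norm ?(ltW s0).
Qed.

End holder_density.
End densities.

(** * The bilinear map *)

Section product_map.
Context (R : realType) (d : nat) (beta gamma : R).
Hypothesis d_gt0 : (0 < d)%N.
Hypotheses (beta01 : 0 < beta < 1) (gamma01 : 0 < gamma < 1)
  (beta_gamma : d%:R < beta + d%:R * gamma).

Definition product_map (f : holder R d beta) (w : holder_charge R d gamma) :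
    holder_charge R d gamma :=
  HolderCharge (holder_product_mem d_gt0 beta01 gamma01 beta_gamma
    (holderP f) (holder_chargeP w)).

Lemma product_map_bilinear : bilinear_for
  (GRing.Scale.Law.clone _ _ ( *:%R ) _) (GRing.Scale.Law.clone _ _ ( *:%R ) _)
  product_map.
Proof.
split=> [w a f g|f a w w']; apply: val_inj => /=.
  exact: (holder_product_combl d_gt0 beta01 gamma01 beta_gamma a (holderP f)
    (holderP g) (holder_chargeP w)).
exact: (holder_product_combr d_gt0 beta01 gamma01 beta_gamma a (holderP f)
  (holder_chargeP w) (holder_chargeP w')).
Qed.

HB.instance Definition _ := bilinear_isBilinear.Build R (holder R d beta)
  (holder_charge R d gamma) (holder_charge R d gamma) _ _ product_map product_map_bilinear.

Lemma product_map_extends : extends_density_product product_map.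
Proof.
move=> f g w gp wg; have /andP[g0 g1] := gamma01.
rewrite -(holder_product_density d_gt0 beta01 (holderP f) gamma01 beta_gamma).
- by rewrite -wg.
- apply: (Lp_integrable _ gp); rewrite invf_ge1 ?subr_gt0//.
  by rewrite gerBl ltW.
- by rewrite -wg; exact: holder_chargeP.
Qed.

Lemma product_map_continuous : strongly_continuous product_map.
Proof.
move=> f_ f w_ w cf cw Loo Hoo.
apply: (holder_product_strong_cvg d_gt0 beta01 gamma01 beta_gamma
  (f_ := fun p => f_ p) (nu_ := fun p => w_ p)) => //.
- by move=> p; exact: holderP.
- exact: holderP.
- by move=> p; exact: holder_chargeP.
- exact: holder_chargeP.
- move=> x; have h := (pointwise_cvgP _ _).1 (pointwise_uniform_cvg _ cf) x.
  exact: h.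
- by move=> B; apply/subr_cvg0; exact: (strong_norm_cvg_eval B cw).
Qed.

Lemma product_map_unique (m m' : holder R d beta -> holder_charge R d gamma ->
    holder_charge R d gamma) :
  extends_density_product m -> strongly_continuous m ->
  extends_density_product m' -> strongly_continuous m' ->
  forall f w, m f w = m' f w.
Proof.
move=> em cm em' cm' f w; have wH := holder_chargeP w.
have /andP[g0 g1] := gamma01.
pose w_ n := HolderCharge (step_charge_mem d_gt0 gamma01 n wH).
have mE n : m f (w_ n) = m' f (w_ n) :> (cubeBV R d -> R).
  have wE : w_ n = density (step_density d_gt0 w n) :> (cubeBV R d -> R).
    exact: step_chargeE.
  have gp : Lp (1 - gamma)^-1 (step_density d_gt0 w n).
    by apply: Lp_step_density; rewrite invr_gt0 subr_gt0.
  by rewrite (em _ _ _ gp wE) (em' _ _ _ gp wE).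
have cw : (fun n => strong_norm (w_ n - w)) @ \oo --> 0%E.
  exact: (step_charge_strong_cvg d_gt0 beta01 gamma01 beta_gamma wH).
have Loo : (ereal_sup (range (fun _ : nat => lip beta f)) < +oo)%E.
  apply: (@le_lt_trans _ _ (lip beta f)); last exact/asboolP/holderP.
  by apply: ge_ereal_sup => _ [n _ <-].
have Hoo : (ereal_sup (range (fun n => holder_norm gamma (w_ n))) < +oo)%E.
  apply: (@le_lt_trans _ _ (2 ^+ d * fine (holder_norm gamma w))%:E); last by rewrite ltry.
  apply: ge_ereal_sup => _ [n _ <-]; exact: step_charge_holder_norm.
have cf : {uniform, (fun _ : nat => f : cube R d -> R) @ \oo --> (f : cube R d -> R)}.
  exact: (@cvg_cst {uniform cube R d -> R}).
have cv (k : holder R d beta -> holder_charge R d gamma -> holder_charge R d gamma) :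
    strongly_continuous k -> forall B, (fun n => k f (w_ n) B) @ \oo --> k f w B.
  move=> ck B; apply/subr_cvg0.
  exact: (strong_norm_cvg_eval B (ck (fun=> f) f w_ w cf cw Loo Hoo)).
apply: val_inj; apply/funext => B /=.
apply: (cvg_unique (@Rhausdorff R) (cv m cm B)).
have -> : (fun n => m f (w_ n) B) = (fun n => m' f (w_ n) B).
  by apply/funext => n; rewrite mE.
exact: cv.
Qed.

Lemma product_map_cube_le (f : holder R d beta) (w : holder_charge R d gamma)
    (K : cubeBV R d) : dyadic_cube K ->
  (`|product_map f w K|%:E <= (@holder_product_cst R d beta gamma)%:E *
    (sup_norm K f + (fine (leb R d K) `^ (beta / d%:R))%:E * lip beta f) *
    holder_norm gamma w * (fine (leb R d K) `^ gamma)%:E)%E.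
Proof.
move=> /(dyadic_cubeP d_gt0)[n [v vn /(cubeBV_cell (d_gt0 := d_gt0)) ->]].
have fH := holderP f; have wH := holder_chargeP w.
set K' := cellBV R d_gt0 v.
have supfin : sup_norm K' f \is a fin_num.
  rewrite ge0_fin_numE.
    apply: (@le_lt_trans _ _ (sup_norm (cube R d) f)).
      apply: le_ereal_sup => _ [x _ <-]; exists x => //; exact: (set_mem (valP x)).
    rewrite -(fineK (sup_norm_fin d_gt0 beta01 fH)) ltry//.
  apply: le_trans (sup_norm_ge f (corner_cell R d_gt0 [::] v)).
  by rewrite lee_fin.
rewrite -(fineK supfin) -(fineK (lip_fin d_gt0 fH)) -(fineK (holder_norm_fin d_gt0 wH)).
rewrite -(EFinM (_ `^ _)) -EFinD -!EFinM lee_fin /K' fine_leb_cell !half_powR.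
apply: le_trans (holder_product_cell d_gt0 beta01 gamma01 beta_gamma fH wH vn) _.
have C0 := holder_product_cst_ge0 d_gt0 beta_gamma.
have H0 := holder_norm_ge0 d_gt0 wH.
rewrite ler_wpM2r ?exprn_ge0 ?powR_ge0// ler_wpM2r// ler_wpM2l// lerD2r.
by rewrite -lee_fin fineK// sup_norm_ge//; exact: (corner_cell R d_gt0 [::] v).
Qed.

Lemma product_map_norm_le (f : holder R d beta) (w : holder_charge R d gamma) :
  (holder_norm gamma (product_map f w) <= (@holder_product_cst R d beta gamma)%:E *
    (sup_norm (cube R d) f + lip beta f) * holder_norm gamma w)%E.
Proof.
have fH := holderP f; have wH := holder_chargeP w.
rewrite -(fineK (sup_norm_fin d_gt0 beta01 fH)) -(fineK (lip_fin d_gt0 fH)).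
rewrite -(fineK (holder_norm_fin d_gt0 wH)) -EFinD -!EFinM.
exact: (holder_product_norm_le d_gt0 beta01 gamma01 beta_gamma fH wH).
Qed.

End product_map.

Theorem theorem5 (R : realType) (d : nat) (beta gamma : R)
    (d_ge1 : (1 <= d)%N) (beta01 : 0 < beta < 1) (gamma01 : 0 < gamma < 1)
    (beta_gamma : d%:R < beta + d%:R * gamma) :
  exists m : {bilinear holder R d beta -> holder_charge R d gamma ->
                       holder_charge R d gamma},
    [/\ extends_density_product m,
        strongly_continuous m,
        (forall m' : {bilinear holder R d beta -> holder_charge R d gamma ->
                               holder_charge R d gamma},
           extends_density_product m' -> strongly_continuous m' ->
           forall f w, m' f w = m f w)
      & exists C : R,
          [/\ 0 <= C,
              (forall (f : holder R d beta) (w : holder_charge R d gamma)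
                      (K : cubeBV R d), dyadic_cube K ->
                 (`|m f w K|%:E <=
                    C%:E *
                    (sup_norm K f +
                     (fine (leb R d K) `^ (beta / d%:R))%:E * lip beta f) *
                    holder_norm gamma w * (fine (leb R d K) `^ gamma)%:E)%E)
            & (forall (f : holder R d beta) (w : holder_charge R d gamma),
                 (holder_norm gamma (m f w) <=
                    C%:E * (sup_norm (cube R d) f + lip beta f) *
                    holder_norm gamma w)%E)]].
Proof.
exists (product_map d_ge1 beta01 gamma01 beta_gamma); split.
- exact: product_map_extends.
- exact: product_map_continuous.
- move=> m' em' cm' f w; apply: (product_map_unique d_ge1 beta01 gamma01 beta_gamma em' cm').
  + exact: product_map_extends.
  + exact: product_map_continuous.
exists (@holder_product_cst R d beta gamma); split.
- exact: (holder_product_cst_ge0 d_ge1 beta_gamma).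
- exact: product_map_cube_le.
- exact: product_map_norm_le.
Qed.
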